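(* Let $R,P>0$ and $v_1,v_2,v_3,v_4>0$, and let $A$ be the operator on $X$ defined in the context. (i) Suppose that $v_1>v_2$, $v_2<v_3$, $v_3>v_4$ and $v_4<v_1$. Then there exists a (unique) largest real eigenvalue $\lambda_0\in\mathbb{R}$ of $A$, and $\lambda_0<0$. Moreover, if $\lambda\in\mathbb{C}$ is any eigenvalue of $A$, then $\operatorname{Re}(\lambda)\le\lambda_0$. This $\lambda_0$ has a strictly positive eigenfunction $(c_0(x),q_0(x))^T$, in the sense that $c_0(x)>0$ and $q_0(x)>0$ for all $x\in[-2,2]$ (at the points where $c_0$ jumps, this refers to both one-sided limits). It also satisfies the bound $-M_0\le\lambda_0<0$, where $$M_0:=R-\frac{R^2P^2\,v^{min}}{v^{min}\left(\frac{v^{max}-v^{min}}{2}\right)+v^{max}\left(RP^2+1\right)}>0,$$ with $v^{max}:=\max\{v_1,v_2,v_3,v_4\}$ and $v^{min}:=\min\{v_1,v_2,v_3,v_4\}$. (ii) Suppose that $v_1>v_2$, $v_2<v_3$, $v_3>v_4$ and $v_4<v_1$, and let $\lambda_0$ and $(c_0,q_0)^T$ be as in (i). If $(c(x,t),q(x,t))^T=e^{tA}(c(x,0),q(x,0))^T$ with an (a.e.) bounded initial condition $(c(x,0),q(x,0))^T$, then there exists $K>0$, depending only on the initial condition, such that $$-K e^{t\lambda_0}\left(|c_0(x)|,|q_0(x)|\right)^T\le\left(c(x,t),q(x,t)\right)^T\le K e^{t\lambda_0}\left(|c_0(x)|,|q_0(x)|\right)^T$$ (componentwise) for all $t\ge0$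 and a.e. $x\in(-2,2)$. If $(c,q)^T$ is a non-real solution, then the same inequality holds for the real and imaginary parts of the solution. The number $K$ can be chosen as the smallest real number for which these inequalities hold at $t=0$. (iii) In the limit case where $v_1\ge v_2$, $v_2\le v_3$, $v_3\ge v_4$, $v_4\le v_1$ with $v_1=v_2$ and $v_3=v_4$ (so that all four $v_i$ are equal), the largest real eigenvalue of $A$ is $\lambda_0=0$. The solutions $(c(x,t),q(x,t))^T=e^{tA}(c(x,0),q(x,0))^T$ with (a.e.) bounded initial condition also satisfy the inequality displayed in (ii), with $\lambda_0=0$ and $(c_0,q_0)^T$ an eigenfunction of $A$ for the eigenvalue $0$.
   Context: Let $x_i=-3+i$ for $i=1,\dots,5$ and $I_i=(x_i,x_{i+1})$ for $i=1,2,3,4$, so $I_1=(-2,-1)$, $I_2=(-1,0)$, $I_3=(0,1)$, $I_4=(1,2)$. Let $X=L^2(-2,2)\times L^2(-2,2)$ (real or complex valued; complex when non-real eigenvalues or solutions are considered) with scalar product $\langle (c_1,q_1)^T,(c_2,q_2)^T\rangle_X=\int_{-2}^2(c_1\overline{c_2}+q_1\overline{q_2})\,dx$. The unbounded linear operator $A:D(A)\subset X\to X$ is defined on each interval $I_i$ by $$A\begin{pmatrix}c\\ q\end{pmatrix}=\begin{pmatrix}-v_ic_x-RP^2c+RPq\\ q_x+RPc-Rq\end{pmatrix}\quad\text{on } I_i,\ i=1,2,3,4,$$ and $D(A)$ is the set of $(c,q)^T\in\prod_{i=1}^4H^1(I_i)\times\prod_{i=1}^4H^1(I_i)$ satisfying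 $c(-1^-)=c(-1^+)$, $c(1^-)=c(1^+)$, $v_1c(-2^+)=v_4c(2^-)$, $v_3c(0^+)=v_2c(0^-)$, and $q(x_0^-)=q(x_0^+)$ for $x_0=-1,0,1$ together with $q(-2^+)=q(2^-)$. Under the non-strict inequalities $v_1\ge v_2>0$, $v_2\le v_3$, $v_3\ge v_4>0$, $v_4\le v_1$, the operator $A$ generates a $C_0$-semigroup of contractions on $X$, denoted $e^{tA}$, $t\ge0$. *)

(* Defs.v *)
From HB Require Import structures.
From mathcomp Require Import all_boot all_order all_algebra.
From mathcomp Require Import complex.
From mathcomp Require Import all_classical all_reals all_analysis.

Set Implicit Arguments.
Unset Strict Implicit.
Unset Printing Implicit Defensive.

Import Order.TTheory GRing.Theory Num.Theory.
Import numFieldNormedType.Exports.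

Local Open Scope classical_set_scope.
Local Open Scope ring_scope.
Local Open Scope complex_scope.

Notation re := (@complex.Re _) (only parsing).
Notation im := (@complex.Im _) (only parsing).

Section Sobolev.
Context {R : realType}.
Implicit Types (a b : R) (f g phi : R -> R).

Local Notation mu := (@lebesgue_measure R).

Definition L2 a b f :=
  measurable_fun `]a, b[%classic f /\
  mu.-integrable `]a, b[%classic (EFin \o (fun x => f x ^+ 2)).

(* Functions of class C^1 on the line with compact support in ]a, b[. *)
Definition test_function a b phi :=
  [/\ forall x, derivable phi x 1,
      continuous (derive1 phi) &
      exists a' b', [/\ a < a', b' < b &
        forall x, x \notin `[a', b'] -> phi x = 0]].

(* f belongs to H^1(a, b) and g is its weak derivative. *)
Definition H1_deriv a b f g :=
  [/\ L2 a b f, L2 a b g &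
      forall phi, test_function a b phi ->
        \int[mu]_(x in `]a, b[) (f x * derive1 phi x) =
        - \int[mu]_(x in `]a, b[) (g x * phi x)].

Definition complex_L2 a b (f : R -> R[i]) :=
  L2 a b (re \o f) /\ L2 a b (im \o f).

Definition complex_H1_deriv a b (f g : R -> R[i]) :=
  H1_deriv a b (re \o f) (re \o g) /\
  H1_deriv a b (im \o f) (im \o g).

Definition complex_H1 a b (f : R -> R[i]) :=
  exists g : R -> R[i], complex_H1_deriv a b f g.

(* w is the representative of f that is continuous up to the boundary, so that
   w a and w b are the one-sided limits of f at a^+ and b^-. *)
Definition continuous_rep a b (f w : R -> R[i]) :=
  [/\ {within `[a, b], continuous (re \o w)},
      {within `[a, b], continuous (im \o w)} &
      {ae mu, forall x, x \in `]a, b[ -> f x = w x}].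

End Sobolev.

(* The elements of X are represented by pairs of functions on the line, of which
   only the restriction to ]-2, 2[ matters, up to equality almost everywhere. *)
Definition state (R : realType) : Type := ((R -> R[i]) * (R -> R[i]))%type.

Section StateSpace.
Context {R : realType}.
Implicit Types (u w f : state R) (z : R[i]).

Local Notation mu := (@lebesgue_measure R).

Definition inX u := complex_L2 (-2) 2 u.1 /\ complex_L2 (-2) 2 u.2.

Definition eqX u w :=
  {ae mu, forall x, x \in `](-2 : R), 2[ -> u.1 x = w.1 x /\ u.2 x = w.2 x}.

Definition addX u w : state R :=
  (fun x => u.1 x + w.1 x, fun x => u.2 x + w.2 x).

Definition scaleX z u : state R := (fun x => z * u.1 x, fun x => z * u.2 x).

Definition subX u w : state R := addX u (scaleX (-1) w).

Definition zeroX : state R := (fun=> 0, fun=> 0).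

Definition sqr_modulus z : R := re z ^+ 2 + im z ^+ 2.

Definition modulus z : R := Num.sqrt (sqr_modulus z).

Definition normX u : R :=
  Num.sqrt (\int[mu]_(x in `](-2)%R, 2%R[)
    (sqr_modulus (u.1 x) + sqr_modulus (u.2 x))).

Definition boundedX u := exists M : R,
  {ae mu, forall x, x \in `](-2 : R), 2[ ->
    modulus (u.1 x) <= M /\ modulus (u.2 x) <= M}.

(* An unbounded operator on X is given by its graph: A u f means that u belongs
   to the domain of A and that A u = f. *)
Definition operatorX := state R -> state R -> Prop.

Definition is_eigenfunction (A : operatorX) z u :=
  [/\ inX u, ~ eqX u zeroX & A u (scaleX z u)].

Definition is_eigenvalue (A : operatorX) z := exists u, is_eigenfunction A z u.

Definition largest_real_eigenvalue (A : operatorX) (l : R) :=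
  is_eigenvalue A l%:C /\ forall m : R, is_eigenvalue A m%:C -> m <= l.

(* T is a strongly continuous semigroup of contractions (t >= 0) on X. *)
Definition contraction_semigroup (T : R -> state R -> state R) :=
  [/\ forall t u, 0 <= t -> inX u -> inX (T t u),
      forall t z u w, 0 <= t -> inX u -> inX w ->
        eqX (T t (addX (scaleX z u) w)) (addX (scaleX z (T t u)) (T t w)),
      forall t u, 0 <= t -> inX u -> normX (T t u) <= normX u,
      (forall u, inX u -> eqX (T 0 u) u) /\
      (forall s t u, 0 <= s -> 0 <= t -> inX u ->
        eqX (T (s + t) u) (T s (T t u))) &
      forall u, inX u -> normX (subX (T h u) u) @[h --> 0^'+] --> (0 : R)].

Definition generates (A : operatorX) (T : R -> state R -> state R) :=
  forall u f, inX u -> inX f ->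
    (A u f <->
     normX (subX (scaleX (h^-1)%:C (subX (T h u) u)) f) @[h --> 0^'+]
       --> (0 : R)).

Definition is_semigroup_of (A : operatorX) (T : R -> state R -> state R) :=
  contraction_semigroup T /\ generates A T.

End StateSpace.
Arguments operatorX : clear implicits.

Section Operator.
Context {R : realType}.
Implicit Types (u f : state R) (i : nat).

Local Notation mu := (@lebesgue_measure R).

Definition node i : R := i%:R - 3.

(* The operator below is A, with k standing for the constant R; the intervals
   I_i = ]node i, node i.+1[ and the velocities are indexed by 1 <= i <= 4. *)
Definition velocity (v1 v2 v3 v4 : R) i : R := nth 0 [:: 0; v1; v2; v3; v4] i.

Definition domA (v1 v2 v3 v4 : R) u :=
  (forall i, (1 <= i <= 4)%N ->
    complex_H1 (node i) (node i.+1) u.1 /\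
    complex_H1 (node i) (node i.+1) u.2) /\
  exists c q : nat -> R -> R[i],
    [/\ forall i, (1 <= i <= 4)%N ->
          continuous_rep (node i) (node i.+1) u.1 (c i) /\
          continuous_rep (node i) (node i.+1) u.2 (q i),
        [/\ c 1%N (-1) = c 2%N (-1),
            c 3%N 1 = c 4%N 1,
            v1%:C * c 1%N (-2) = v4%:C * c 4%N 2 &
            v3%:C * c 3%N 0 = v2%:C * c 2%N 0] &
        [/\ q 1%N (-1) = q 2%N (-1),
            q 2%N 0 = q 3%N 0,
            q 3%N 1 = q 4%N 1 &
            q 1%N (-2) = q 4%N 2]].

Definition opA (k P v1 v2 v3 v4 : R) : operatorX R := fun u f =>
  [/\ domA v1 v2 v3 v4 u, inX f &
      exists cx qx : R -> R[i], forall i, (1 <= i <= 4)%N ->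
        [/\ complex_H1_deriv (node i) (node i.+1) u.1 cx,
            complex_H1_deriv (node i) (node i.+1) u.2 qx &
            {ae mu, forall x, x \in `]node i, node i.+1[ ->
              f.1 x = - (velocity v1 v2 v3 v4 i)%:C * cx x
                      - (k * P ^+ 2)%:C * u.1 x + (k * P)%:C * u.2 x /\
              f.2 x = qx x + (k * P)%:C * u.1 x - k%:C * u.2 x}]].

(* Both components are real and positive on each closed interval
   [node i, node i.+1], one-sided limits at the nodes included. *)
Definition strictly_positive u :=
  forall i, (1 <= i <= 4)%N -> exists c q : R -> R,
    [/\ continuous_rep (node i) (node i.+1) u.1 (fun x => (c x)%:C),
        continuous_rep (node i) (node i.+1) u.2 (fun x => (q x)%:C) &
        forall x, x \in `[node i, node i.+1] -> 0 < c x /\ 0 < q x].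

Definition vmax (v1 v2 v3 v4 : R) :=
  Num.max (Num.max v1 v2) (Num.max v3 v4).

Definition vmin (v1 v2 v3 v4 : R) :=
  Num.min (Num.min v1 v2) (Num.min v3 v4).

Definition M0 (k P v1 v2 v3 v4 : R) :=
  let vM := vmax v1 v2 v3 v4 in
  let vm := vmin v1 v2 v3 v4 in
  k - k ^+ 2 * P ^+ 2 * vm /
      (vm * ((vM - vm) / 2) + vM * (k * P ^+ 2 + 1)).

(* p is the real or the imaginary part: the corresponding part of u lies
   between - K (|c_0|, |q_0|) and K (|c_0|, |q_0|), where e = (c_0, q_0). *)
Definition enveloped (p : R[i] -> R) (e : state R) (K : R) u :=
  {ae mu, forall x, x \in `](-2 : R), 2[ ->
    (- (K * modulus (e.1 x)) <= p (u.1 x) <= K * modulus (e.1 x)) /\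
    (- (K * modulus (e.2 x)) <= p (u.2 x) <= K * modulus (e.2 x))}.

Definition smallest_envelope (p : R[i] -> R) (e : state R) u (K : R) :=
  enveloped p e K u /\ forall K', enveloped p e K' u -> K <= K'.

Definition exp_enveloped (T : R -> state R -> state R) (l : R) (e u : state R)
    (p : R[i] -> R) (K : R) :=
  forall t, 0 <= t -> enveloped p e (K * expR (t * l)) (T t u).

(* The estimate is stated separately for the real part and for the imaginary
   part of the solution, each with its own constant.  A real solution is the case
   where the imaginary part of u vanishes: the smallest constant for that part is
   then 0, so that T t u stays real.  The smallest constant is positive unless
   the part in question vanishes, whence the two clauses. *)
Definition exp_estimate (T : R -> state R -> state R) (l : R) (e u : state R) :=
  forall p : R[i] -> R, p = re \/ p = im ->
    (exists K, 0 < K /\ exp_enveloped T l e u p K) /\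
    (exists K, smallest_envelope p e u K /\ exp_enveloped T l e u p K).

End Operator.

(* Main.v *)
(* A positive solution (c0, q0) of the eigenvalue problem controls everything.

   Existence: on each interval the eigenvalue problem is an autonomous linear
   system with an explicit flow, and l is an eigenvalue when the monodromy matrix
   M of (c, q) over one period has the fixed vector 1.  At l = 0 the solution
   starting from (0, 1) has q > 0 and M22 > 1, and det (M - 1) < 0.  Let l be the
   supremum of the parameters in [-k, 0] where one of these properties fails: there
   det (M - 1) = 0, and the fixed vector is positive because the quotient of the
   second components of two solutions is monotone (by their Wronskian).

   Spectrum: for an eigenfunction (C, Q) with eigenvalue z, the quotients
   |C / c0|^2 and |Q / q0|^2 are continuous across the nodes and periodic, and if
   Re z > l their derivatives have a strict sign at a positive common maximum.

   Lower bound: integrate (s^2 ln c0 - ln q0)' over the period, use the AM-GM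
   inequality, and optimize in s.

   Exponential estimate: A is dispersive, i.e. the L^2 norm of the negative part
   of a c0 exp(t l) + s Re (T t u) does not increase.  This is shown on the domain
   of A by an Euler scheme, and extended to bounded data by density. *)
Require Import Defs.
From HB Require Import structures.
From mathcomp Require Import all_boot all_order all_algebra.
From mathcomp Require Import complex.
From mathcomp Require Import all_classical all_reals all_analysis.
From mathcomp Require Import measurable_realfun ring lra.

Set Implicit Arguments.
Unset Strict Implicit.
Unset Printing Implicit Defensive.

Import Order.TTheory GRing.Theory Num.Theory.
Import numFieldNormedType.Exports.

Local Open Scope classical_set_scope.
Local Open Scope ring_scope.
Local Open Scope complex_scope.

(** * Integration on an interval *)

(** The component [c] is carried to the right and [q] to the left, each fed by the other with a
    positive coefficient: information on [c] enters an interval at its left end, information on [q]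
    at its right end. The order of the velocities acts at every node. Where [c] is continuous (at -1
    and 1) the speed drops, so the flux [v c] is lost; where the flux is continuous (at 0 and 2) the
    speed rises, so [v c ^+ 2] decreases. The obstacle is that derivatives in x are only weak and
    that the semigroup is only known through norm limits of difference quotients. Weak derivatives
    are therefore traded for increments, and the chain rule for the squared positive part is proved
    from increments; in time, the error of a difference quotient is uniform along an orbit because
    [T t] commutes with it and contracts. The parameter - k is the one at which the growth term of
    [q] vanishes. In the lower bound, the logarithms left by the jumps are compared with the square
    of the sum of the [v_i ^ (- 1/2)], the quantity produced by the AM-GM step. *)

Section IntegrableReal.
Context d (T : measurableType d) {R : realType}.
Variable mu : {measure set T -> \bar R}.
Implicit Types (D : set T) (f g : T -> R).

Lemma integrable_dominated D f g : measurable D ->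
  measurable_fun D f -> (forall x, D x -> `|f x| <= g x) ->
  mu.-integrable D (EFin \o g) -> mu.-integrable D (EFin \o f).
Proof.
move=> mD mf fg; apply: le_integrable => //; first exact/measurable_EFinP.
by move=> x Dx /=; rewrite lee_fin (le_trans (fg x Dx))// ler_norm.
Qed.

Lemma integrable_measurable D f :
  mu.-integrable D (EFin \o f) -> measurable_fun D f.
Proof. by move=> /measurable_int /measurable_EFinP. Qed.

Lemma integrable_add D f g : measurable D ->
  mu.-integrable D (EFin \o f) -> mu.-integrable D (EFin \o g) ->
  mu.-integrable D (EFin \o (fun x => f x + g x)).
Proof.
move=> mD mf mg; have := integrableD mD mf mg.
by apply: eq_integrable.
Qed.

Lemma integrable_sub D f g : measurable D ->
  mu.-integrable D (EFin \o f) -> mu.-integrable D (EFin \o g) ->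
  mu.-integrable D (EFin \o (fun x => f x - g x)).
Proof.
move=> mD mf mg; have := integrableB mD mf mg.
by apply: eq_integrable.
Qed.

Lemma integrable_scale D (z : R) f : measurable D ->
  mu.-integrable D (EFin \o f) ->
  mu.-integrable D (EFin \o (fun x => z * f x)).
Proof.
move=> mD mf; have := integrableZl mD z mf.
by apply: eq_integrable.
Qed.

Lemma ae_imply (P Q : T -> Prop) : (forall x, P x -> Q x) ->
  {ae mu, forall x, P x} -> {ae mu, forall x, Q x}.
Proof. by move=> PQ; apply: filterS. Qed.

Lemma ae_imply2 (P Q S : T -> Prop) : (forall x, P x -> Q x -> S x) ->
  {ae mu, forall x, P x} -> {ae mu, forall x, Q x} -> {ae mu, forall x, S x}.
Proof. by move=> PQS; apply: filterS2. Qed.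

Lemma ae_Rintegral D f g : measurable D ->
  measurable_fun D f -> measurable_fun D g ->
  {ae mu, forall x, D x -> f x = g x} ->
  \int[mu]_(x in D) f x = \int[mu]_(x in D) g x.
Proof.
move=> mD mf mg fg; congr fine; apply: ae_eq_integral => //.
- exact/measurable_EFinP.
- exact/measurable_EFinP.
by apply: filterS fg => x fgx Dx /=; rewrite fgx.
Qed.

(** Replacing [g] by [max f g], which equals it almost everywhere, makes the inequality
    pointwise. *)
Lemma ae_le_Rintegral D f g : measurable D ->
  mu.-integrable D (EFin \o f) -> mu.-integrable D (EFin \o g) ->
  {ae mu, forall x, D x -> f x <= g x} ->
  \int[mu]_(x in D) f x <= \int[mu]_(x in D) g x.
Proof.
move=> mD mf mg fg.
have mf' := integrable_measurable mf; have mg' := integrable_measurable mg.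
have mm : measurable_fun D (fun x => Num.max (f x) (g x)).
  exact: measurable_maxr.
have im : mu.-integrable D (EFin \o (fun x => Num.max (f x) (g x))).
  apply: (integrable_dominated (g := fun x => `|f x| + `|g x|)) => //.
    by move=> x _; rewrite /Num.max; case: ifP => _; rewrite ?lerDl ?lerDr.
  by apply: integrable_add => //; exact: integrable_norm.
rewrite -[leRHS](ae_Rintegral (f := fun x => Num.max (f x) (g x))) //.
  apply: le_Rintegral => // x Dx; by rewrite le_max lexx.
by apply: filterS fg => x fgx Dx; rewrite max_r// fgx.
Qed.

Lemma Rintegral_eq0 D f : measurable D -> mu.-integrable D (EFin \o f) ->
  (forall x, D x -> 0 <= f x) -> \int[mu]_(x in D) f x <= 0 ->
  {ae mu, forall x, D x -> f x = 0}.
Proof.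
move=> mD mf f0 le0.
have mf' := measurable_int mu mf.
have z : (\int[mu]_(x in D) `|(EFin \o f) x| = 0)%E.
  rewrite (@eq_integral _ _ _ _ _ (EFin \o f)); last first.
    by move=> x xD /=; rewrite ger0_norm// f0//; exact/set_mem.
  have h : \int[mu]_(x in D) f x = 0 by apply/eqP; rewrite eq_le le0 Rintegral_ge0.
  by rewrite -[LHS]fineK ?(integrable_fin_num _ mf)//; congr EFin.
have := (ae_eq_integral_abs mu mD mf').1 z.
by apply: ae_imply => x hx Dx; have [] := hx Dx.
Qed.

End IntegrableReal.

Section IntegralToolbox.
Context {R : realType}.
Local Notation mu := (@lebesgue_measure R).
Implicit Types (a b : R) (f g : R -> R).

Lemma integrable_itv_cst a b (z : R) : mu.-integrable `]a, b[ (EFin \o cst z).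
Proof.
apply: measurable_bounded_integrable.
- exact: measurable_itv.
- by rewrite /= lebesgue_measure_itv/=; case: ifP => // _; rewrite -EFinB ltry.
- exact: measurable_cst.
- by exists `|z|; split => // M zM x _ /=; exact: ltW.
Qed.

(** The interval has finite measure, so [|f| <= 1 + f ^+ 2] suffices. *)
Lemma L2_integrable a b f : L2 a b f -> mu.-integrable `]a, b[ (EFin \o f).
Proof.
move=> [mf f2]; apply: (integrable_dominated (mu := mu) (g := fun x => 1 + f x ^+ 2)) => //.
  move=> x _; rewrite ler_norml; have := sqr_ge0 (f x - 1); have := sqr_ge0 (f x + 1).
  by rewrite !expr2 => h1 h2; apply/andP; split; nra.
by apply: integrable_add => //; exact: integrable_itv_cst.
Qed.

Lemma L2_mul a b f g : L2 a b f -> L2 a b g ->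
  mu.-integrable `]a, b[ (EFin \o (fun x => f x * g x)).
Proof.
move=> [mf f2] [mg g2].
apply: (integrable_dominated (mu := mu) (g := fun x => f x ^+ 2 + g x ^+ 2)) => //.
- exact: measurable_funM.
- move=> x _; rewrite ler_norml; apply/andP; split; nra.
- exact: integrable_add.
Qed.

Lemma L2_add a b f g : L2 a b f -> L2 a b g -> L2 a b (fun x => f x + g x).
Proof.
move=> Lf Lg; have [mf f2] := Lf; have [mg g2] := Lg.
split; first exact: measurable_funD.
apply: (integrable_dominated (mu := mu) (g := fun x => 2 * (f x ^+ 2 + g x ^+ 2))) => //.
- by apply: measurable_funX; exact: measurable_funD.
- move=> x _; rewrite ger0_norm ?sqr_ge0//; have := sqr_ge0 (f x - g x); nra.
- by apply: integrable_scale => //; exact: integrable_add.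
Qed.

Lemma L2_scale a b (z : R) f : L2 a b f -> L2 a b (fun x => z * f x).
Proof.
move=> [mf f2]; split.
  exact: measurable_funM.
apply: (integrable_dominated (mu := mu) (g := fun x => z ^+ 2 * f x ^+ 2)) => //.
- by apply: measurable_funX; exact: measurable_funM.
- by move=> x _; rewrite exprMn ger0_norm// mulr_ge0 ?sqr_ge0.
- exact: integrable_scale.
Qed.

Lemma continuous_itv_integrable a b f : continuous f ->
  mu.-integrable `]a, b[ (EFin \o f).
Proof.
move=> cf; have := @continuous_compact_integrable R f `[a, b]
  (@segment_compact _ a b) (continuous_subspaceT cf).
by apply: integrableS => //; exact: subset_itv_oo_cc.
Qed.

Lemma continuous_L2 a b f : continuous f -> L2 a b f.
Proof.
move=> cf; split.
  apply: (integrable_measurable (mu := mu)); exact: continuous_itv_integrable.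
apply: continuous_itv_integrable => x.
apply: (@continuous_comp _ _ _ f (fun y => y ^+ 2)); first exact: cf.
exact: exprn_continuous.
Qed.

Lemma L2_sub_itv a b a' b' f : a <= a' -> b' <= b -> L2 a b f -> L2 a' b' f.
Proof.
move=> aa' bb' [mf f2].
have sub : `]a', b'[%classic `<=` `]a, b[%classic.
  by apply: subset_itv; rewrite bnd_simp.
split; [exact: measurable_funS mf | exact: integrableS f2].
Qed.

End IntegralToolbox.

(** * From weak derivatives to increments *)

Section Bump.
Context {R : realType}.
Implicit Types (x y e : R).

Definition pos x : R := Num.max x 0.

Lemma pos_ge0 x : 0 <= pos x.
Proof. by rewrite /pos le_max lexx orbT. Qed.

Lemma posE x : pos x = x /\ 0 <= x \/ pos x = 0 /\ x <= 0.
Proof.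
rewrite /pos; case: (lerP x 0) => h; first by right; split.
by left; split => //; exact: ltW.
Qed.

Lemma continuous_pos : continuous pos.
Proof.
move=> x; apply: (@continuous_max _ _ id (fun=> 0) x); first exact: cvg_id.
exact: cvg_cst.
Qed.

Lemma pos_le x y : x <= y -> pos x <= pos y.
Proof. by case: (posE x) => -[-> ?]; case: (posE y) => -[-> ?]; lra. Qed.

Lemma pos_lipschitz x y : `|pos x - pos y| <= `|x - y|.
Proof.
wlog: x y / x <= y.
  move=> h; case/orP: (le_total x y) => xy; first exact: h.
  by rewrite distrC (distrC x); exact: h.
move=> xy; rewrite distrC (distrC x) !ger0_norm ?subr_ge0//; last exact: pos_le.
by case: (posE x) => -[-> ?]; case: (posE y) => -[-> ?]; lra.
Qed.

(** The derivative [2 * pos] is 2-Lipschitz. This gives both the derivative of the squared positive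
    part and, applied to short increments of a function, the chain rule [pos_sqr_increment]. *)
Lemma pos_sqr_slope x y z (e : R) : `|x - z| <= e -> `|y - z| <= e ->
  `|pos y ^+ 2 - pos x ^+ 2 - 2 * pos z * (y - x)| <= 2 * e * `|y - x|.
Proof.
wlog: x y / x <= y => [hw|xy].
  case/orP: (le_total x y) => xy hx hy; first exact: hw.
  have := hw _ _ xy hy hx; rewrite distrC (distrC x y).
  by congr (_ <= _); congr (`|_|); ring.
rewrite (ger0_norm (_ : 0 <= y - x)) ?subr_ge0// !ler_norml.
move=> /andP[h1 h2] /andP[h3 h4]; apply/andP.
by case: (posE x) => -[-> ?]; case: (posE y) => -[-> ?];
  case: (posE z) => -[-> ?]; split; nra.
Qed.

Lemma is_derive_pos_sqr x :
  is_derive x (1 : R) (fun y => pos y ^+ 2) (2 * pos x).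
Proof.
have h : (fun h => h^-1 *: (pos (h *: 1 + x) ^+ 2 - pos x ^+ 2)) @ 0^'
    --> 2 * pos x.
  apply/cvgrPdist_le => e e0; near=> t.
  have t0 : t != 0 by near: t; exact: nbhs_dnbhs_neq.
  have te : `|t| <= e / 2.
    near: t; apply: dnbhs0_le; lra.
  have := @pos_sqr_slope x (t + x) x `|t|; rewrite subrr normr0 normr_ge0 addrK.
  move=> /(_ isT (lexx _)) hh.
  rewrite distrC [t *: 1]mulr1 -(ler_pM2l (_ : 0 < `|t|)) ?normr_gt0// -normrM.
  rewrite mulrBr [t * _]mulrA divff// mul1r.
  rewrite [t * (2 * _)]mulrC; apply: (le_trans hh).
  by have := normr_ge0 t; nra.
split; first by apply/cvg_ex; exists (2 * pos x).
exact: cvg_lim h.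
Unshelve. all: by end_near. Qed.

(** The triangle of base [0, 2] and height 1, hence of integral 1: the derivative of [ramp] and,
    once rescaled, an approximate identity. *)
Definition hat y : R := pos y - 2 * pos (y - 1) + pos (y - 2).

(* A quadratic spline of class C^1, which climbs from 0 to 1 on [0, 2]. *)
Definition ramp y : R :=
  (pos y ^+ 2 - 2 * pos (y - 1) ^+ 2 + pos (y - 2) ^+ 2) / 2.

Lemma ramp_itv y : 0 <= ramp y <= 1.
Proof.
rewrite /ramp; apply/andP; case: (posE y) => -[-> ?];
  case: (posE (y - 1)) => -[-> ?]; case: (posE (y - 2)) => -[-> ?]; split; nra.
Qed.

Lemma ramp_le0 y : y <= 0 -> ramp y = 0.
Proof.
move=> y0; rewrite /ramp /pos !max_r; lra.
Qed.

Lemma ramp_ge2 y : 2 <= y -> ramp y = 1.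
Proof.
move=> y2; rewrite /ramp /pos !max_l; [by field|lra..].
Qed.

Lemma hat_ge0 y : 0 <= hat y.
Proof.
by rewrite /hat; case: (posE y) => -[-> ?];
  case: (posE (y - 1)) => -[-> ?]; case: (posE (y - 2)) => -[-> ?]; lra.
Qed.

Lemma hat_eq0 y : (y <= 0) || (2 <= y) -> hat y = 0.
Proof.
by case/orP=> y0; rewrite /hat; case: (posE y) => -[-> ?];
  case: (posE (y - 1)) => -[-> ?]; case: (posE (y - 2)) => -[-> ?]; lra.
Qed.

Lemma continuous_hat : continuous hat.
Proof.
have c z : continuous (fun y => pos (y - z)).
  move=> y; apply: (@continuous_comp _ _ _ (fun y => y - z) pos).
    by apply: cvgB; [exact: cvg_id|exact: cvg_cst].
  exact: continuous_pos.
move=> y; apply: cvgD; last exact: c.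
apply: cvgB; first exact: continuous_pos.
by apply: cvgM; [exact: cvg_cst|exact: c].
Qed.

Lemma is_derive_shift (f : R -> R) (x s e d : R) :
  is_derive ((x - s) / e) (1 : R) f d ->
  is_derive x (1 : R) (fun y => f ((y - s) / e)) (d / e).
Proof.
move=> df.
have dg : is_derive x (1 : R) (fun y : R => (y - s) / e) (e^-1).
  rewrite (_ : (fun y => _) = (fun y => e^-1 * (y - s))); last first.
    by apply/funext => y; rewrite mulrC.
  by apply: is_derive_eq; rewrite subr0 [_ *: _]mulr1.
have := @is_derive1_comp R f (fun y : R => (y - s) / e) x d e^-1 df dg.
by [].
Qed.

Lemma is_derive_ramp x : is_derive x (1 : R) ramp (hat x).
Proof.
have d z : is_derive x (1 : R) (fun y => pos (y - z) ^+ 2) (2 * pos (x - z)).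
  have := @is_derive_shift (fun y => pos y ^+ 2) x z 1 (2 * pos (x - z)).
  rewrite !divr1 (_ : (fun y => pos ((y - z) / 1) ^+ 2) = (fun y => pos (y - z) ^+ 2)); last first.
    by apply/funext => y; rewrite divr1.
  by apply; exact: is_derive_pos_sqr.
have d0 := is_derive_pos_sqr x; have d1 := d 1; have d2 := d 2.
rewrite /ramp (_ : (fun y => _) = (fun y => 2^-1 * (pos y ^+ 2 - 2 * pos (y - 1) ^+ 2 + pos (y - 2) ^+ 2))); last first.
  by apply/funext => y; rewrite mulrC.
by apply: is_derive_eq; rewrite /hat /GRing.scale /=; field.
Qed.

End Bump.

(** * Increments as integrals of the weak derivative *)

Section WeakDerivative.
Context {R : realType}.
Local Notation mu := (@lebesgue_measure R).
Implicit Types (a b s t e : R) (f g w : R -> R).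

Lemma Rintegral_dominated_cvg d (T : measurableType d)
    (nu : {measure set T -> \bar R}) (D : set T) (f_ : nat -> T -> R)
    (f g : T -> R) : measurable D ->
  (forall n, measurable_fun D (f_ n)) -> measurable_fun D f ->
  {ae nu, forall x, D x -> f_ ^~ x @ \oo --> f x} ->
  nu.-integrable D (EFin \o g) ->
  (forall n x, D x -> `|f_ n x| <= g x) ->
  (fun n => \int[nu]_(x in D) f_ n x) @ \oo --> \int[nu]_(x in D) f x.
Proof.
move=> mD mf_ mf ff ig fg.
have h1 n : measurable_fun D (EFin \o f_ n) by exact/measurable_EFinP.
have h2 : measurable_fun D (EFin \o f) by exact/measurable_EFinP.
have h3 : {ae nu, forall x, D x -> (fun n => (EFin \o f_ n) x) @ \oo --> (EFin \o f) x}.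
  by apply: (ae_imply _ ff) => x ffx Dx; apply: cvg_EFin; [exact: nearW|exact: ffx].
have h4 : {ae nu, forall x n, D x -> (`|(EFin \o f_ n) x| <= (EFin \o g) x)%E}.
  by apply: aeW => x n Dx; rewrite /= lee_fin fg.
have [intf _ cv] := dominated_convergence mD h1 h2 h3 ig h4.
apply: fine_cvg; rewrite fineK//.
exact: integrable_fin_num.
Qed.

Lemma Rintegral_FTC (F f : R -> R) a b : a < b -> continuous f ->
  (forall x, is_derive x (1 : R) F (f x)) ->
  \int[mu]_(x in `]a, b[) f x = F b - F a.
Proof.
move=> ab cf dF.
have cF : continuous F.
  move=> x; apply/differentiable_continuous/derivable1_diffP.
  by have [] := dF x.
rewrite Rintegral_itv_obnd_cbnd; last exact: continuous_itv_integrable.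
rewrite Rintegral_itv_bndo_bndc; last first.
  apply: integrableS (@continuous_compact_integrable R f `[a, b]
    (@segment_compact _ a b) (continuous_subspaceT cf)) => //.
  exact: subset_itv_co_cc.
rewrite /Rintegral (@continuous_FTC2 R f F a b ab) ?fineB//.
- exact: continuous_subspaceT.
- split; first by move=> x _; have [] := dF x.
  + exact/cvg_at_right_filter/cF.
  + exact/cvg_at_left_filter/cF.
- by move=> x _; rewrite derive1E; have [_ ->] := dF x.
Qed.

Lemma is_derive_ramp_scaled s e x :
  is_derive x (1 : R) (fun y => ramp ((y - s) / e)) (hat ((x - s) / e) / e).
Proof. by apply: is_derive_shift; exact: is_derive_ramp. Qed.

Lemma continuous_hat_scaled s e : continuous (fun y => hat ((y - s) / e) / e).
Proof.
move=> y; apply: cvgM; last exact: cvg_cst.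
apply: (@continuous_comp _ _ _ (fun y => (y - s) / e) hat).
  by apply: cvgM; [apply: cvgB; [exact: cvg_id|exact: cvg_cst]|exact: cvg_cst].
exact: continuous_hat.
Qed.

(** The rescaled triangle has mass 1 and lives on [s, s + 2 e_n], where [w] is close to [w s]. *)
Lemma hat_approximates_dirac w a b s (e_ : nat -> R) : continuous w ->
  a < s < b -> (forall n, 0 < e_ n) -> e_ @ \oo --> 0 ->
  (fun n => \int[mu]_(x in `]a, b[) (w x * (hat ((x - s) / e_ n) / e_ n)))
    @ \oo --> w s.
Proof.
move=> cw /andP[as_ sb] e0 ecv; apply/cvgrPdist_le => eta eta0.
have /cvgrPdist_le/(_ eta eta0) := cw s.
rewrite -nbhs_ballE => -[r /= r0 hr].
near=> n.
have en : e_ n < Num.min (r / 2) ((b - s) / 2).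
  near: n; have := cvgr_lt _ ecv; apply.
  by rewrite lt_min; apply/andP; split; lra.
move: en; rewrite lt_min => /andP[en1 en2].
pose B x := hat ((x - s) / e_ n) / e_ n.
have cB : continuous B by exact: continuous_hat_scaled.
have iB : mu.-integrable `]a, b[ (EFin \o B) by exact: continuous_itv_integrable.
have B0 x : 0 <= B x by rewrite /B mulr_ge0 ?hat_ge0// invr_ge0 ltW.
(* The bump is the derivative of a rescaled [ramp], which climbs from 0 to 1 inside ]a, b[ because 2
   e_n < b - s. *)
have BI : \int[mu]_(x in `]a, b[) B x = 1.
  have ab : a < b by lra.
  rewrite (Rintegral_FTC ab cB (fun x => is_derive_ramp_scaled s (e_ n) x)).
  rewrite ramp_ge2 ?ramp_le0 ?subr0//.
    by rewrite pmulr_lle0 ?invr_gt0//; lra.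
  by rewrite ler_pdivlMr//; lra.
have iwB : mu.-integrable `]a, b[ (EFin \o (fun x => w x * B x)).
  by apply: continuous_itv_integrable => x; apply: cvgM; [exact: cw|exact: cB].
have iwsB : mu.-integrable `]a, b[ (EFin \o (fun x => w s * B x)).
  exact: integrable_scale.
rewrite -[X in X - _]mulr1 -BI -RintegralZl// -RintegralB//.
have iwd : mu.-integrable `]a, b[ (EFin \o (fun x => w s * B x - w x * B x)).
  exact: integrable_sub.
apply: (le_trans (le_normr_Rintegral _ iwd)) => //.
rewrite -[leRHS]mulr1 -BI -RintegralZl//.
apply: le_Rintegral => //.
- exact: integrable_norm.
- exact: integrable_scale.
move=> x _; rewrite -mulrBl normrM (ger0_norm (B0 x)).
have [xs|xs] := boolP ((x - s) / e_ n <= 0); first by rewrite /B hat_eq0 ?xs// mul0r !mulr0.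
have [xs2|xs2] := boolP (2 <= (x - s) / e_ n); first by rewrite /B hat_eq0 ?xs2 ?orbT// mul0r !mulr0.
apply: ler_wpM2r => //; apply: hr; rewrite /ball /=.
move: xs xs2; rewrite -!ltNge ltr_pdivrMr// => xs xs2.
have {}xs : 0 < x - s by move: xs; rewrite pmulr_lgt0// invr_gt0.
rewrite ltr_norml; apply/andP; split; lra.
Unshelve. all: by end_near. Qed.

(** A C^1 version of the indicator of ]s, t]: both ramps start at the left, so the pointwise limit
    as e tends to 0 is exactly this half-open indicator. *)
Lemma ramp_difference_test a b s t e : a < s -> s <= t -> t + 2 * e < b -> 0 < e ->
  test_function a b (fun x => ramp ((x - s) / e) - ramp ((x - t) / e)).
Proof.
move=> as_ st tb e0.
have d x : is_derive x (1 : R) (fun x => ramp ((x - s) / e) - ramp ((x - t) / e))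
    (hat ((x - s) / e) / e - hat ((x - t) / e) / e).
  have d1 := is_derive_ramp_scaled s e x; have d2 := is_derive_ramp_scaled t e x.
  exact: is_deriveB.
split.
- by move=> x; have [] := d x.
- rewrite (_ : derive1 _ = fun x => hat ((x - s) / e) / e - hat ((x - t) / e) / e); last first.
    by apply/funext => x; rewrite derive1E; have [_ ->] := d x.
  by move=> x; apply: cvgB; exact: continuous_hat_scaled.
- exists s, (t + 2 * e); split => // x.
  rewrite in_itv/= negb_and -!ltNge => /orP[xs|xt].
    by rewrite !ramp_le0 ?subrr// pmulr_lle0 ?invr_gt0//; lra.
  by rewrite !ramp_ge2 ?subrr// ler_pdivlMr//; lra.
Qed.

Lemma derive1_ramp_difference s t e x :
  derive1 (fun x => ramp ((x - s) / e) - ramp ((x - t) / e)) x =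
  hat ((x - s) / e) / e - hat ((x - t) / e) / e.
Proof.
rewrite derive1E.
have d1 := is_derive_ramp_scaled s e x; have d2 := is_derive_ramp_scaled t e x.
by have [_ ->] := is_deriveB d1 d2.
Qed.

Lemma cvg_shrinking (r : R) : 0 < r -> (fun n : nat => r / n.+1%:R) @ \oo --> 0.
Proof.
move=> r0; rewrite -[X in _ --> X](mulr0 r).
by apply: cvgM; [exact: cvg_cst|exact: cvg_harmonic].
Qed.

(** Test the weak derivative against smoothed indicators of ]s, t]. Their derivatives are two
    opposite approximate Dirac masses, which give [w s - w t]; the other side converges by
    domination by [|g|]. *)
Lemma H1_deriv_increment_in a b f g w : H1_deriv a b f g -> continuous w ->
  {ae mu, forall x, x \in `]a, b[ -> f x = w x} ->
  forall s t, a < s -> s <= t -> t < b ->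
  w t - w s = \int[mu]_(x in `]a, b[) (g x * \1_`]s, t] x).
Proof.
move=> [L2f L2g weak] cw fw s t as_ st tb.
(* Since e_n <= r, the right end t + 2 e_n of the support stays below b. *)
pose r := (b - t) / 4; have r0 : 0 < r by rewrite /r; lra.
pose e_ n := r / n.+1%:R.
have e0 n : 0 < e_ n by rewrite divr_gt0.
have er n : e_ n <= r by rewrite ler_pdivrMr// ler_peMr ?ler1n// ltW.
have ecv : e_ @ \oo --> 0 by exact: cvg_shrinking.
pose phi n x := ramp ((x - s) / e_ n) - ramp ((x - t) / e_ n).
have tphi n : test_function a b (phi n).
  by apply: ramp_difference_test => //; have := er n; rewrite /r; lra.
have cphi n : continuous (phi n).
  by move=> x; apply/differentiable_continuous/derivable1_diffP; have [] := tphi n.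
have lhs n : \int[mu]_(x in `]a, b[) (f x * derive1 (phi n) x) =
    \int[mu]_(x in `]a, b[) (w x * (hat ((x - s) / e_ n) / e_ n)) -
    \int[mu]_(x in `]a, b[) (w x * (hat ((x - t) / e_ n) / e_ n)).
  have cwh u : continuous (fun x => w x * (hat ((x - u) / e_ n) / e_ n)).
    by move=> x; apply: cvgM; [exact: cw|exact: continuous_hat_scaled].
  rewrite -RintegralB//; try exact: continuous_itv_integrable.
  apply: ae_Rintegral => //.
  - apply: measurable_funM; first by case: L2f.
    apply: (integrable_measurable (mu := mu)); apply: continuous_itv_integrable.
    by case: (tphi n).
  - apply: (integrable_measurable (mu := mu)); apply: continuous_itv_integrable => x.
    by apply: cvgB; exact: cwh.
  apply: (ae_imply _ fw) => x fwx xab.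
  by rewrite derive1_ramp_difference fwx// mulrBr.
have cl : (fun n => \int[mu]_(x in `]a, b[) (f x * derive1 (phi n) x)) @ \oo -->
    w s - w t.
  under eq_fun do rewrite lhs.
  by apply: cvgB; apply: hat_approximates_dirac => //; apply/andP; split; lra.
have mg : measurable_fun `]a, b[ g by case: L2g.
have cr : (fun n => \int[mu]_(x in `]a, b[) (g x * phi n x)) @ \oo -->
    \int[mu]_(x in `]a, b[) (g x * \1_`]s, t] x).
  apply: (@Rintegral_dominated_cvg _ _ mu _ _ _ (fun x => `|g x|)) => //.
  - move=> n; apply: measurable_funM => //.
    by apply: (integrable_measurable (mu := mu)); exact: continuous_itv_integrable.
  - by apply: measurable_funM => //.
  - apply: aeW => x _; apply: cvgM; first exact: cvg_cst.
    apply: cvg_near_cst; rewrite indicE.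
    have [xs|xs] := lerP x s.
      near=> n; rewrite memNset /=; last by rewrite in_itv/=; lra.
      by rewrite /phi !ramp_le0 ?subrr// pmulr_lle0 ?invr_gt0//; lra.
    have [xt|xt] := lerP x t.
      near=> n; rewrite mem_set /=; last by rewrite in_itv/=; lra.
      rewrite /phi ramp_ge2 ?ramp_le0 ?subr0//.
        by rewrite pmulr_lle0 ?invr_gt0//; lra.
      rewrite ler_pdivlMr//.
      have : e_ n < (x - s) / 2 by near: n; apply: (cvgr_lt _ ecv); lra.
      lra.
    near=> n; rewrite memNset /=; last by rewrite in_itv/=; lra.
    rewrite /phi !ramp_ge2 ?subrr// ler_pdivlMr//.
      have : e_ n < (x - t) / 2 by near: n; apply: (cvgr_lt _ ecv); lra.
      lra.
    have : e_ n < (x - s) / 2 by near: n; apply: (cvgr_lt _ ecv); lra.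
    lra.
  - by apply: integrable_norm; exact: L2_integrable.
  - move=> n x _; rewrite normrM ler_piMr// ler_norml /phi.
    have := ramp_itv ((x - s) / e_ n); have := ramp_itv ((x - t) / e_ n); lra.
have eqn n : \int[mu]_(x in `]a, b[) (f x * derive1 (phi n) x) =
    - \int[mu]_(x in `]a, b[) (g x * phi n x) by exact: weak.
have cl' : (fun n => \int[mu]_(x in `]a, b[) (f x * derive1 (phi n) x)) @ \oo -->
    - \int[mu]_(x in `]a, b[) (g x * \1_`]s, t] x).
  by under eq_fun do rewrite eqn; exact: cvgN.
have := cvg_lim (@Rhausdorff R) cl; rewrite (cvg_lim (@Rhausdorff R) cl') => h.
by rewrite -[RHS]opprK h opprB.
Unshelve. all: by end_near. Qed.

End WeakDerivative.

(** * The squared positive part of an absolutely continuous function *)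

Section ChainRule.
Context {R : realType}.
Local Notation mu := (@lebesgue_measure R).
Implicit Types (a b s t u e : R) (f g h w F : R -> R).

Lemma uniformly_continuous_itv w a b e : continuous w -> 0 < e ->
  exists d, 0 < d /\ forall x y, x \in `[a, b] -> `|x - y| < d -> `|w x - w y| <= e.
Proof.
move=> cw e0.
have := (compact_near_coveringP `[a, b]%classic).1 (@segment_compact R a b).
move=> /(_ R (0^'+) (fun d x => forall y, `|x - y| < d -> `|w x - w y| <= e) _).
move=> [].
  move=> x _ ; have /cvgrPdist_le/(_ (e / 2)) := cw x.
  move=> /(_ (divr_gt0 e0 (ltr0Sn _ 1))); rewrite -nbhs_ballE => -[r /= r0 hr].
  have r20 : 0 < r / 2 by rewrite divr_gt0.
  exists (ball x (r / 2), [set d | d < r / 2]) => /=.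
    split; first exact: nbhsx_ballx.
    exact: nbhs_right_lt.
  move=> [x' d] /= [xx' dr] y x'y.
  have h1 : `|w x - w x'| <= e / 2.
    by apply: hr => /=; move: xx'; rewrite /ball/=; lra.
  have h2 : `|w x - w y| <= e / 2.
    apply: hr; rewrite /ball/= -(subrKA x') (le_lt_trans (ler_normD _ _))//.
    move: xx'; rewrite /ball/=; lra.
  rewrite (_ : w x' - w y = (w x - w y) - (w x - w x')); last by ring.
  by rewrite (le_trans (ler_normB _ _))//; lra.
move=> d /= d0 hd; exists (d / 2); split; first by lra.
have dball : ball_ [eta Num.Def.normr] 0 d (d / 2).
  by rewrite /= distrC subr0 ger0_norm; lra.
by move=> x y xab xy; apply: (hd _ dball _ _ xab _ xy); lra.
Qed.

(** Cut [a, b] into steps of length at most d and telescope; the induction is on the number of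
    steps. *)
Lemma local_increment_bound (H G : R -> R) d a b : 0 < d -> a <= b ->
  (forall s t, a <= s -> s <= t -> t <= b -> t <= s + d -> `|H t - H s| <= G t - G s) ->
  `|H b - H a| <= G b - G a.
Proof.
move=> d0 + loc.
have [n nd] : exists n : nat, b - a <= n%:R * d.
  exists (Num.truncn ((b - a) / d)).+1.
  by rewrite -ler_pdivrMr// ltW// truncnS_gt.
have : forall c, a <= c -> c <= b -> c - a <= n%:R * d -> `|H c - H a| <= G c - G a.
  elim: n {nd} => [|n ih] c ac cb cn.
    have -> : c = a by lra.
    by rewrite !subrr normr0.
  (* The step ending at c may be shorter than d when it reaches a. *)
  pose m := Num.max a (c - d).
  have am : a <= m by rewrite le_max lexx.
  have cdm : c - d <= m by rewrite le_max lexx orbT.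
  have mc : m <= c by rewrite ge_max ac/=; lra.
  have mn : m - a <= n%:R * d.
    rewrite /m /Num.max; case: ifP => _; last by rewrite subrr mulr_ge0// ltW.
    by move: cn; rewrite -natr1 mulrDl mul1r; lra.
  have h1 := ih m am (le_trans mc cb) mn.
  have h2 : `|H c - H m| <= G c - G m by apply: loc => //; lra.
  rewrite -(subrKA (H m)) (le_trans (ler_normD _ _))//; lra.
by move=> hc ab; apply: hc.
Qed.

(** The integral over ]s, t], written with an indicator so that the domain of integration stays
    fixed. *)
Definition itv_integral a b h s t := \int[mu]_(x in `]a, b[) (h x * \1_`]s, t] x).

Lemma integrable_indic_mul a b h s t : mu.-integrable `]a, b[ (EFin \o h) ->
  mu.-integrable `]a, b[ (EFin \o (fun x => h x * \1_`]s, t] x)).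
Proof.
move=> ih; apply: (integrable_dominated (mu := mu) (g := (fun x => `|h x|))) => //.
- by apply: measurable_funM => //; exact: (integrable_measurable (mu := mu)).
- by move=> x _; rewrite normrM ler_piMr// indicE; case: (_ \in _); rewrite ?normr1 ?normr0.
- exact: integrable_norm.
Qed.

Lemma itv_integral_cat a b h s t u : mu.-integrable `]a, b[ (EFin \o h) ->
  s <= t -> t <= u ->
  itv_integral a b h s u = itv_integral a b h s t + itv_integral a b h t u.
Proof.
move=> ih st tu; rewrite /itv_integral -RintegralD//; try exact: integrable_indic_mul.
apply: eq_Rintegral => x _; rewrite -mulrDr; congr (_ * _); rewrite !indicE.
have := lerP x s; have := lerP x t; have := lerP x u => hu ht hs.
have i (p q : R) : (x \in [set` `]p, q]]) = (p < x) && (x <= q).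
  by apply/idP/idP; rewrite inE/= in_itv.
rewrite !i; case: hu => hu; case: ht => ht; case: hs => hs /=; rewrite ?addr0 ?add0r//; lra.
Qed.

Lemma itv_integral_norm a b g h e s t : mu.-integrable `]a, b[ (EFin \o g) ->
  mu.-integrable `]a, b[ (EFin \o h) ->
  (forall x, x \in `]s, t] -> `|h x| <= e * `|g x|) ->
  `|itv_integral a b h s t| <= e * itv_integral a b (fun x => `|g x|) s t.
Proof.
move=> ig ih hg.
have igi := integrable_indic_mul s t (integrable_norm ig).
have ihi := integrable_indic_mul s t ih.
apply: (le_trans (le_normr_Rintegral _ ihi)) => //.
rewrite -RintegralZl//; apply: le_Rintegral => //.
- exact: integrable_norm.
- exact: integrable_scale.
move=> x _; rewrite normrM mulrA indicE.
have [xst|xst] := boolP (x \in _); last by rewrite normr0 !mulr0.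
rewrite normr1 !mulr1; apply: hg; by rewrite inE/= in xst.
Qed.

(** Let s decrease to a and t increase to b: continuity of [F] on one side, dominated convergence on
    the other. *)
Lemma increment_closure a b F h : a < b -> continuous F ->
  mu.-integrable `]a, b[ (EFin \o h) ->
  (forall s t, a < s -> s <= t -> t < b -> F t - F s = itv_integral a b h s t) ->
  F b - F a = \int[mu]_(x in `]a, b[) h x.
Proof.
move=> ab cF ih incr.
pose r := (b - a) / 4; have r0 : 0 < r by rewrite /r; lra.
pose e_ n := r / n.+1%:R.
have e0 n : 0 < e_ n by rewrite divr_gt0.
have er n : e_ n <= r by rewrite ler_pdivrMr// ler_peMr ?ler1n// ltW.
have ecv : e_ @ \oo --> 0 by exact: cvg_shrinking.
have c1 : (fun n => F (b - e_ n) - F (a + e_ n)) @ \oo --> F b - F a.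
  have cb : (fun n => b - e_ n) @ \oo --> b.
    by rewrite -[X in _ --> X]subr0; apply: cvgB => //; exact: cvg_cst.
  have ca : (fun n => a + e_ n) @ \oo --> a.
    by rewrite -[X in _ --> X]addr0; apply: cvgD => //; exact: cvg_cst.
  apply: cvgB.
    by apply: (cvg_comp _ _ cb); exact: cF.
  by apply: (cvg_comp _ _ ca); exact: cF.
have c2 : (fun n => F (b - e_ n) - F (a + e_ n)) @ \oo --> \int[mu]_(x in `]a, b[) h x.
  have e n : F (b - e_ n) - F (a + e_ n) = itv_integral a b h (a + e_ n) (b - e_ n).
    by have := er n; have := e0 n; rewrite /r => *; apply: incr; lra.
  under eq_fun do rewrite e.
  have mh : measurable_fun `]a, b[ h by exact: (integrable_measurable (mu := mu)).
  apply: (@Rintegral_dominated_cvg _ _ _ mu _ _ _ (fun x => `|h x|)) => //.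
  - by move=> n; apply: measurable_funM.
  - apply: aeW => x /=; rewrite in_itv/= => /andP[ax xb].
    rewrite -[X in _ --> X]mulr1; apply: cvgM; first exact: cvg_cst.
    apply: cvg_near_cst; near=> n; rewrite indicE mem_set//= in_itv/=.
    have h1 : e_ n < x - a by near: n; apply: (cvgr_lt _ ecv); lra.
    have h2 : e_ n < b - x by near: n; apply: (cvgr_lt _ ecv); lra.
    apply/andP; split; lra.
  - exact: integrable_norm.
  - move=> n x _; rewrite normrM ler_piMr// indicE.
    by case: (_ \in _); rewrite ?normr1 ?normr0.
by rewrite -(cvg_lim (@Rhausdorff R) c1); exact: (cvg_lim (@Rhausdorff R) c2).
Unshelve. all: by end_near. Qed.

(** Chain rule for an absolutely continuous [w]. Let [H] be the difference of the two sides as a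
    function of the end point, and [G] the integral of [|g|]. On steps short enough for [w] to vary
    by at most e, the increment of [H] is at most 4 e times that of [G]; by telescoping this holds
    on any interval, and e is arbitrary. *)
Lemma pos_sqr_increment a b w g : a < b -> continuous w ->
  mu.-integrable `]a, b[ (EFin \o g) ->
  (forall s t, a < s -> s <= t -> t < b -> w t - w s = itv_integral a b g s t) ->
  pos (w b) ^+ 2 - pos (w a) ^+ 2 = \int[mu]_(x in `]a, b[) (2 * pos (w x) * g x).
Proof.
move=> ab cw ig incr.
have cp : continuous (fun x => pos (w x)).
  by move=> x; apply: continuous_comp; [exact: cw|exact: continuous_pos].
pose h x := 2 * pos (w x) * g x.
have c2p : continuous (fun x => 2 * pos (w x)).
  by move=> x; apply: cvgM; [exact: cvg_cst|exact: cp].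
have bounded_mul f : continuous f -> mu.-integrable `]a, b[ (EFin \o (fun x => f x * g x)).
  move=> cf; have [M M0 fM] : exists2 M, 0 <= M & forall x, x \in `[a, b] -> `|f x| <= M.
    have cnf : continuous (fun x => `|f x|).
      by move=> x; apply: continuous_comp; [exact: cf|exact: norm_continuous].
    have [c _ hc] := @EVT_max R (fun x => `|f x|) a b (ltW ab) (continuous_subspaceT cnf).
    by exists `|f c|.
  apply: (integrable_dominated (mu := mu) (g := (fun x => M * `|g x|))) => //.
  - apply: measurable_funM; last exact: (integrable_measurable (mu := mu)).
    by apply: (integrable_measurable (mu := mu)); exact: continuous_itv_integrable.
  - move=> x xab; rewrite normrM ler_wpM2r//; apply: fM; exact: subset_itv_oo_cc.
  - by apply: integrable_scale => //; exact: integrable_norm.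
have ih : mu.-integrable `]a, b[ (EFin \o h) by exact: bounded_mul.
apply: (@increment_closure a b (fun x => pos (w x) ^+ 2) h ab _ ih).
  move=> x; apply: (@continuous_comp _ _ _ (fun x => pos (w x)) (fun y => y ^+ 2)).
    exact: cp.
  exact: exprn_continuous.
move=> s t as_ st tb.
pose G x := itv_integral a b (fun x => `|g x|) s x.
pose H x := pos (w x) ^+ 2 - itv_integral a b h s x.
have ing := integrable_norm ig.
have Gcat x y : s <= x -> x <= y -> itv_integral a b (fun x => `|g x|) x y = G y - G x.
  by move=> sx xy; rewrite /G (itv_integral_cat ing sx xy); ring.
have self k : itv_integral a b k s s = 0.
  rewrite /itv_integral (@eq_Rintegral _ _ _ _ _ (fun=> 0 * 0)); last first.
    move=> x _; rewrite indicE memNset ?mulr0 ?mul0r//= in_itv/=; lra.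
  by rewrite RintegralZl// ?mul0r//; exact: integrable_itv_cst.
suff small e : 0 < e -> `|H t - H s| <= 4 * e * (G t - G s).
  have G0 : 0 <= G t - G s.
    rewrite -(Gcat s t) //; apply: Rintegral_ge0 => x _.
    by rewrite mulr_ge0// indicE; case: (_ \in _).
  have : `|H t - H s| <= 0.
    apply/ler_addgt0Pl => e e0; rewrite addr0.
    have k0 : 0 < G t - G s + 1 by lra.
    (* The added 1 avoids a division by zero when [g] vanishes on ]s, t]. *)
    have := small (e / (4 * (G t - G s + 1))) (divr_gt0 e0 (mulr_gt0 (ltr0Sn _ 3) k0)).
    move=> hs; apply: (le_trans hs).
    rewrite (_ : 4 * _ * _ = e * ((G t - G s) / (G t - G s + 1))); last by field; lra.
    by rewrite ler_piMr ?ltW// ltr_pdivrMr//; lra.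
  rewrite normr_le0 => /eqP; rewrite /H self; lra.
move=> e0.
have [d [d0 hd]] := uniformly_continuous_itv a b cw e0.
pose d2 := d / 2.
have loc := @local_increment_bound H (fun x => 4 * e * G x) d2 s t.
rewrite mulrBr; apply: loc => //; first by rewrite /d2; lra.
move=> x y sx xy yt yx.
have wxy : w y - w x = itv_integral a b g x y by apply: incr; lra.
have nwxy : `|w y - w x| <= G y - G x.
  rewrite wxy -[leRHS]mul1r -Gcat//; apply: itv_integral_norm => // z _.
  by rewrite mul1r.
have close z : x <= z -> z <= y -> `|w z - w x| <= e.
  move=> xz zy; apply: hd; first by rewrite in_itv/=; apply/andP; split; lra.
  by rewrite ger0_norm; rewrite /d2 in yx; lra.
have hxy : itv_integral a b h s y - itv_integral a b h s x = itv_integral a b h x y.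
  by rewrite (itv_integral_cat ih sx xy); ring.
have part2 : `|itv_integral a b (fun z => (2 * pos (w z) - 2 * pos (w x)) * g z) x y|
    <= 2 * e * (G y - G x).
  rewrite -Gcat//; apply: itv_integral_norm => //.
    by apply: bounded_mul => z; apply: cvgB; [exact: c2p|exact: cvg_cst].
  move=> z; rewrite in_itv/= => /andP[xz zy]; rewrite normrM ler_wpM2r// -mulrBr normrM.
  rewrite ger0_norm// ler_wpM2l//; apply: (le_trans (pos_lipschitz _ _)).
  by apply: close => //; exact: ltW.
have split_h : itv_integral a b h x y =
    itv_integral a b (fun z => (2 * pos (w z) - 2 * pos (w x)) * g z) x y +
    2 * pos (w x) * (w y - w x).
  rewrite wxy /itv_integral -RintegralZl//; last exact: integrable_indic_mul.
  rewrite -RintegralD//.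
  - by apply: eq_Rintegral => z _; rewrite /h; ring.
  - apply: integrable_indic_mul.
    by apply: bounded_mul => z; apply: cvgB; [exact: c2p|exact: cvg_cst].
  - by apply: integrable_scale => //; exact: integrable_indic_mul.
have part1 : `|pos (w y) ^+ 2 - pos (w x) ^+ 2 - 2 * pos (w x) * (w y - w x)|
    <= 2 * e * (G y - G x).
  have := @pos_sqr_slope R (w x) (w y) (w x) e.
  rewrite subrr normr0 => /(_ (ltW e0) (close y xy (lexx _))) hh.
  by apply: (le_trans hh); rewrite ler_wpM2l// mulr_ge0// ltW.
rewrite /H (_ : _ - _ = (pos (w y) ^+ 2 - pos (w x) ^+ 2 - 2 * pos (w x) * (w y - w x))
  - itv_integral a b (fun z => (2 * pos (w z) - 2 * pos (w x)) * g z) x y).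
  apply: (le_trans (ler_normB _ _)); apply: (le_trans (lerD part1 part2)).
  lra.
by move: hxy; rewrite split_h; lra.
Qed.

End ChainRule.

(** * Dispersivity *)

Section RealGraph.
Context {R : realType}.
Local Notation mu := (@lebesgue_measure R).
Implicit Types (a b s t : R) (c q f g w : R -> R).

Definition clamp a b (x : R) : R := Num.max a (Num.min x b).

Lemma clamp_id a b x : a <= x <= b -> clamp a b x = x.
Proof. by move=> /andP[ax xb]; rewrite /clamp min_l// max_r. Qed.

Lemma clamp_itv a b x : a <= b -> a <= clamp a b x <= b.
Proof. by move=> ab; rewrite /clamp le_max lexx/= ge_max ab ge_min lexx orbT. Qed.

Lemma continuous_clamp a b : continuous (clamp a b).
Proof.
move=> x; apply: (@continuous_max _ _ (fun=> a) (fun y => Num.min y b)).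
  exact: cvg_cst.
by apply: (@continuous_min _ _ id (fun=> b)); [exact: cvg_id|exact: cvg_cst].
Qed.

(** Composition with the retraction onto [a, b] gives continuity on the whole line, the form in
    which the lemmas on increments take their functions. *)
Lemma continuous_extension a b w : a <= b -> {within `[a, b], continuous w} ->
  continuous (fun x => w (clamp a b x)).
Proof.
move=> ab /subspace_continuousP cw x.
have xab : `[a, b]%classic (clamp a b x) by rewrite /= in_itv/= clamp_itv.
have h := cw _ xab.
apply: (@cvg_comp _ _ _ (clamp a b) w _ (within `[a, b]%classic (nbhs (clamp a b x)))).
  move=> A hA; have hc : nbhs x (fun y => `[a, b]%classic (clamp a b y) -> A (clamp a b y)).
    exact: (@continuous_clamp a b x _ hA).
  change (nbhs x (fun y => A (clamp a b y))).
  by apply: filterS hc => y; apply; rewrite /= in_itv/=; exact: clamp_itv.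
exact: h.
Qed.

Definition has_increments a b w g :=
  forall s t, a < s -> s <= t -> t < b -> w t - w s = itv_integral a b g s t.

Lemma H1_deriv_rep a b f g w : a < b -> H1_deriv a b f g ->
  {within `[a, b], continuous w} -> {ae mu, forall x, x \in `]a, b[ -> f x = w x} ->
  [/\ continuous (fun x => w (clamp a b x)),
      has_increments a b (fun x => w (clamp a b x)) g &
      {ae mu, forall x, x \in `]a, b[ -> f x = w (clamp a b x)}].
Proof.
move=> ab H1 cw fw.
have cw' := continuous_extension (ltW ab) cw.
have fw' : {ae mu, forall x, x \in `]a, b[ -> f x = w (clamp a b x)}.
  apply: (ae_imply _ fw) => x fwx xab; rewrite clamp_id ?fwx//.
  by move: xab; rewrite in_itv/= => /andP[/ltW -> /ltW ->].
split => // s t as_ st tb; exact: (H1_deriv_increment_in H1 cw' fw').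
Qed.

Lemma integral_split (a b c : R) h : a < b -> b < c ->
  mu.-integrable `]a, c[ (EFin \o h) ->
  \int[mu]_(x in `]a, c[) h x = \int[mu]_(x in `]a, b[) h x + \int[mu]_(x in `]b, c[) h x.
Proof.
move=> ab bc ih.
have := @Rintegral_itvB R h (BRight a) (BLeft c) b ih.
rewrite !bnd_simp => /(_ (ltW ab) bc) <-.
rewrite [X in _ = X + _]Rintegral_itv_bndo_bndc; first by ring.
by apply: integrableS ih => //; apply: subset_itvl; rewrite bnd_simp ltW.
Qed.

Lemma node_lt i : node i < node i.+1 :> R.
Proof. by rewrite /node -natr1; lra. Qed.

Lemma integral_nodes h : mu.-integrable `](-2)%R, 2%R[ (EFin \o h) ->
  \int[mu]_(x in `](-2)%R, 2%R[) h x =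
  \int[mu]_(x in `]node 1, node 2[) h x + \int[mu]_(x in `]node 2, node 3[) h x +
  \int[mu]_(x in `]node 3, node 4[) h x + \int[mu]_(x in `]node 4, node 5[) h x.
Proof.
move=> ih.
have n1 : node 1 = -2 :> R by rewrite /node; lra.
have n2 : node 2 = -1 :> R by rewrite /node; lra.
have n3 : node 3 = 0 :> R by rewrite /node; lra.
have n4 : node 4 = 1 :> R by rewrite /node; lra.
have n5 : node 5 = 2 :> R by rewrite /node; lra.
rewrite n1 n2 n3 n4 n5.
have sub (c : R) : -2 <= c -> mu.-integrable `]c, 2%R[ (EFin \o h).
  by move=> c2; apply: integrableS ih => //; apply: subset_itvr; rewrite bnd_simp.
rewrite (@integral_split (-2) (-1) 2)//; try lra.
rewrite (@integral_split (-1) 0 2)//; try lra; last by apply: sub; lra.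
rewrite (@integral_split 0 1 2)//; try lra; last by apply: sub; lra.
Qed.

Lemma node_sub i : (1 <= i <= 4)%N -> -2 <= node i :> R /\ node i.+1 <= 2 :> R.
Proof.
move=> /andP[i1 i4]; rewrite /node; split.
  have : 1%:R <= i%:R :> R by rewrite ler_nat.
  by lra.
have : i.+1%:R <= 5%:R :> R by rewrite ler_nat.
lra.
Qed.

Lemma pos_mul (x y : R) : 0 <= x -> x * pos y = pos (x * y).
Proof. by move=> x0; rewrite /pos maxr_pMr// mulr0. Qed.

Lemma L2_pos a b f : L2 a b f -> L2 a b (fun x => pos (f x)).
Proof.
move=> [mf f2]; have mp : measurable_fun `]a, b[ (fun x => pos (f x)).
  by apply: measurable_maxr => //.
split => //; apply: (integrable_dominated (mu := mu) (g := (fun x => f x ^+ 2))) => //.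
  exact: measurable_funX.
move=> x _; rewrite ger0_norm ?sqr_ge0//.
by case: (posE (f x)) => -[-> _]//; rewrite expr0n/= sqr_ge0.
Qed.

Lemma L2_opp a b f : L2 a b f -> L2 a b (fun x => - f x).
Proof.
move=> /(L2_scale (-1)); congr L2; apply/funext => x; exact: mulN1r.
Qed.

Lemma L2_sqr a b f : L2 a b f -> mu.-integrable `]a, b[ (EFin \o (fun x => f x ^+ 2)).
Proof. by case. Qed.

Lemma neg_increment a b w g : a < b -> continuous w -> L2 a b g ->
  has_increments a b w g ->
  pos (- w b) ^+ 2 - pos (- w a) ^+ 2 = - 2 * \int[mu]_(x in `]a, b[) (pos (- w x) * g x).
Proof.
move=> ab cw Lg incr.
have cNw : continuous (fun x => - w x) by move=> x; apply: cvgN; exact: cw.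
have ig := L2_integrable Lg.
rewrite (@pos_sqr_increment R a b (fun x => - w x) (fun x => - g x) ab cNw).
- rewrite -RintegralZl//.
    by apply: eq_Rintegral => x _; ring.
  apply: L2_mul => //; apply: L2_pos; exact: continuous_L2.
- exact/L2_integrable/L2_opp.
- move=> s t as_ st tb; rewrite -opprD (_ : w t + - w s = w t - w s)// incr//.
  rewrite /itv_integral -mulN1r -RintegralZl//; last exact: integrable_indic_mul.
  by apply: eq_Rintegral => x _; ring.
Qed.

Section Graph.
Variables (k P v1 v2 v3 v4 : R).
Local Notation v := (velocity v1 v2 v3 v4).

Definition interval_data i c q f g (C Q Cx Qx : R -> R) :=
  [/\ [/\ continuous C, continuous Q, L2 (node i) (node i.+1) Cx &
          L2 (node i) (node i.+1) Qx],
      has_increments (node i) (node i.+1) C Cx,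
      has_increments (node i) (node i.+1) Q Qx &
      {ae mu, forall x, x \in `]node i, node i.+1[ ->
        [/\ c x = C x, q x = Q x,
            f x = - v i * Cx x - k * P ^+ 2 * C x + k * P * Q x &
            g x = Qx x + k * P * C x - k * Q x]}].

Definition boundary_data (C Q : nat -> R -> R) :=
  [/\ C 1%N (-1) = C 2%N (-1), C 3%N 1 = C 4%N 1,
      v1 * C 1%N (-2) = v4 * C 4%N 2 & v3 * C 3%N 0 = v2 * C 2%N 0] /\
  [/\ Q 1%N (-1) = Q 2%N (-1), Q 2%N 0 = Q 3%N 0, Q 3%N 1 = Q 4%N 1 &
      Q 1%N (-2) = Q 4%N 2].

(* The graph of the operator on real states, in terms of the representatives
   [C i], [Q i] that are continuous up to the ends of the i-th interval. *)
Definition real_graph c q f g :=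
  [/\ L2 (-2) 2 c, L2 (-2) 2 q, L2 (-2) 2 f, L2 (-2) 2 g &
  exists C Q Cx Qx : nat -> R -> R,
    (forall i, (1 <= i <= 4)%N -> interval_data i c q f g (C i) (Q i) (Cx i) (Qx i)) /\
    boundary_data C Q].

Lemma has_increments_comb a b w w' g g' (x y : R) :
  mu.-integrable `]a, b[ (EFin \o g) -> mu.-integrable `]a, b[ (EFin \o g') ->
  has_increments a b w g -> has_increments a b w' g' ->
  has_increments a b (fun z => x * w z + y * w' z) (fun z => x * g z + y * g' z).
Proof.
move=> ig ig' h h' s t as_ st tb.
rewrite (_ : _ - _ = x * (w t - w s) + y * (w' t - w' s)); last by ring.
rewrite h// h'// /itv_integral -!RintegralZl//; try exact: integrable_indic_mul.
rewrite -RintegralD//.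
- by apply: eq_Rintegral => z _; ring.
- by apply: integrable_scale => //; exact: integrable_indic_mul.
- by apply: integrable_scale => //; exact: integrable_indic_mul.
Qed.

Lemma L2_comb a b f g (x y : R) : L2 a b f -> L2 a b g ->
  L2 a b (fun z => x * f z + y * g z).
Proof. by move=> Lf Lg; apply: L2_add; exact: L2_scale. Qed.

Lemma continuous_comb w w' (x y : R) : continuous w -> continuous w' ->
  continuous (fun z => x * w z + y * w' z).
Proof.
move=> cw cw' z; apply: cvgD.
  by apply: cvgM; [exact: cvg_cst|exact: cw].
by apply: cvgM; [exact: cvg_cst|exact: cw'].
Qed.

Lemma real_graph_comb (x y : R) c q f g c' q' f' g' :
  real_graph c q f g -> real_graph c' q' f' g' ->
  real_graph (fun z => x * c z + y * c' z) (fun z => x * q z + y * q' z)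
    (fun z => x * f z + y * f' z) (fun z => x * g z + y * g' z).
Proof.
move=> [Lc Lq Lf Lg [C [Q [Cx [Qx [hi [[b1 b2 b3 b4] [b5 b6 b7 b8]]]]]]]].
move=> [Lc' Lq' Lf' Lg' [C' [Q' [Cx' [Qx' [hi' [[b1' b2' b3' b4'] [b5' b6' b7' b8']]]]]]]].
split; try exact: L2_comb.
exists (fun i z => x * C i z + y * C' i z), (fun i z => x * Q i z + y * Q' i z),
  (fun i z => x * Cx i z + y * Cx' i z), (fun i z => x * Qx i z + y * Qx' i z).
split; last first.
  split; split; rewrite /= ?b1 ?b2 ?b5 ?b6 ?b7 ?b8 ?b1' ?b2' ?b5' ?b6' ?b7' ?b8'//.
    by rewrite !mulrDr !(mulrCA v1) b3 b3' !(mulrCA _ v4).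
  by rewrite !mulrDr !(mulrCA v3) b4 b4' !(mulrCA _ v2).
move=> i i14.
have [[cC cQ LCx LQx] iC iQ e] := hi i i14.
have [[cC' cQ' LCx' LQx'] iC' iQ' e'] := hi' i i14.
split.
- by split; try exact: L2_comb; exact: continuous_comb.
- by apply: has_increments_comb => //; exact: L2_integrable.
- by apply: has_increments_comb => //; exact: L2_integrable.
apply: (ae_imply2 _ e e') => z ez ez' zi.
have [-> -> -> ->] := ez zi; have [-> -> -> ->] := ez' zi.
by split => //; ring.
Qed.

Hypotheses (k_gt0 : 0 < k) (P_gt0 : 0 < P).
Hypotheses (v1_gt0 : 0 < v1) (v2_gt0 : 0 < v2) (v3_gt0 : 0 < v3) (v4_gt0 : 0 < v4).

(** Multiply the equations by the negative parts. The transport terms integrate to the boundary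
    terms by the chain rule, and the reaction terms are nonnegative pointwise. *)
Lemma interval_dispersive i c q f g C Q Cx Qx : (1 <= i <= 4)%N ->
  L2 (node i) (node i.+1) c -> L2 (node i) (node i.+1) q ->
  L2 (node i) (node i.+1) f -> L2 (node i) (node i.+1) g ->
  interval_data i c q f g C Q Cx Qx ->
  v i / 2 * (pos (- C (node i.+1)) ^+ 2 - pos (- C (node i)) ^+ 2) -
  2^-1 * (pos (- Q (node i.+1)) ^+ 2 - pos (- Q (node i)) ^+ 2) <=
  \int[mu]_(x in `]node i, node i.+1[) (pos (- c x) * f x + pos (- q x) * g x).
Proof.
move=> i14 Lc Lq Lf Lg [[cC cQ LCx LQx] iC iQ e].
have LC := continuous_L2 (node i) (node i.+1) cC.
have LQ := continuous_L2 (node i) (node i.+1) cQ.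
have LpC := L2_pos (L2_opp LC); have LpQ := L2_pos (L2_opp LQ).
have iCx := L2_mul LpC LCx; have iQx := L2_mul LpQ LQx.
rewrite (neg_increment (node_lt i) cC LCx iC) (neg_increment (node_lt i) cQ LQx iQ).
rewrite (_ : _ - _ = \int[mu]_(x in `]node i, node i.+1[)
   (- v i * (pos (- C x) * Cx x) + pos (- Q x) * Qx x)); last first.
  rewrite RintegralD//; last exact: integrable_scale.
  rewrite RintegralZl//; lra.
apply: ae_le_Rintegral => //.
- by apply: integrable_add => //; exact: integrable_scale.
- apply: integrable_add => //; apply: L2_mul => //.
    exact/L2_pos/L2_opp.
  exact/L2_pos/L2_opp.
apply: (ae_imply _ e) => x ex xi; have [-> -> -> ->] := ex xi.
(* The reaction matrix is symmetric, negative semidefinite, with positive off-diagonal entries.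
   Against the negative parts it leaves this square plus k P times products of a negative part with
   a positive part. *)
suff : 0 <= k * (P * pos (- C x) - pos (- Q x)) ^+ 2 +
  ((pos (- C x) * (- k * P ^+ 2 * C x + k * P * Q x) + pos (- Q x) * (k * P * C x - k * Q x))
   - k * (P * pos (- C x) - pos (- Q x)) ^+ 2) by nra.
apply: addr_ge0; first by rewrite mulr_ge0 ?sqr_ge0// ltW.
have kP : 0 < k * P by exact: mulr_gt0.
rewrite (_ : _ - _ = k * P ^+ 2 * (- (pos (- C x) * C x) - pos (- C x) ^+ 2)
  + k * (- (pos (- Q x) * Q x) - pos (- Q x) ^+ 2)
  + k * P * ((pos (- C x) * Q x + pos (- C x) * pos (- Q x)) +
             (pos (- Q x) * C x + pos (- Q x) * pos (- C x)))); last by ring.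
have e0 (y : R) : - (pos (- y) * y) - pos (- y) ^+ 2 = 0 by case: (posE (- y)) => -[-> _]; ring.
have e1 (y z : R) : 0 <= pos (- y) * z + pos (- y) * pos (- z).
  by rewrite -mulrDr mulr_ge0 ?pos_ge0//; case: (posE (- z)) => -[-> ?]; lra.
by rewrite !e0 !mulr0 !add0r; apply: mulr_ge0; [exact: ltW|exact: addr_ge0].
Qed.

(** Add up the boundary terms of the four intervals. Those of [q] telescope around the period; those
    of [c] lose energy at each node, by the velocity drop at -1 and 1 and by the flux condition at 0
    and 2. *)
Lemma real_graph_dispersive c q f g :
  v2 <= v1 -> v2 <= v3 -> v4 <= v3 -> v4 <= v1 -> real_graph c q f g ->
  0 <= \int[mu]_(x in `](-2)%R, 2%R[) (pos (- c x) * f x + pos (- q x) * g x).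
Proof.
move=> v21 v23 v43 v41 [Lc Lq Lf Lg [C [Q [Cx [Qx [hi [bC bQ]]]]]]].
rewrite integral_nodes; last first.
  by apply: integrable_add => //; apply: L2_mul => //; exact/L2_pos/L2_opp.
have n1 : node 1 = -2 :> R by rewrite /node; lra.
have n2 : node 2 = -1 :> R by rewrite /node; lra.
have n3 : node 3 = 0 :> R by rewrite /node; lra.
have n4 : node 4 = 1 :> R by rewrite /node; lra.
have n5 : node 5 = 2 :> R by rewrite /node; lra.
have ineq i : (1 <= i <= 4)%N -> _ <= _ := fun i14 =>
  let n := node_sub i14 in
  interval_dispersive i14 (L2_sub_itv n.1 n.2 Lc) (L2_sub_itv n.1 n.2 Lq)
   (L2_sub_itv n.1 n.2 Lf) (L2_sub_itv n.1 n.2 Lg) (hi i i14).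
have := ineq 1%N isT; have := ineq 2%N isT; have := ineq 3%N isT; have := ineq 4%N isT.
rewrite /velocity /= n1 n2 n3 n4 n5.
case: bC => b1 b2 b3 b4; case: bQ => b5 b6 b7 b8.
rewrite b1 b2 b5 b6 b7 b8.
have e1 : v1 ^+ 2 * pos (- C 1%N (-2)) ^+ 2 = v4 ^+ 2 * pos (- C 4%N 2) ^+ 2.
  rewrite -!exprMn; congr (_ ^+ 2).
  by rewrite !pos_mul ?ltW// !mulrN b3.
have e2 : v3 ^+ 2 * pos (- C 3%N 0) ^+ 2 = v2 ^+ 2 * pos (- C 2%N 0) ^+ 2.
  rewrite -!exprMn; congr (_ ^+ 2).
  by rewrite !pos_mul ?ltW// !mulrN b4.
move: e1 e2.
have := sqr_ge0 (pos (- C 1%N (-2))); have := sqr_ge0 (pos (- C 4%N 2)).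
have := sqr_ge0 (pos (- C 3%N 0)); have := sqr_ge0 (pos (- C 2%N 0)).
have := sqr_ge0 (pos (- C 2%N (-1))); have := sqr_ge0 (pos (- C 4%N 1)).
set A1 := pos (- C 1%N (-2)) ^+ 2; set A4 := pos (- C 4%N 2) ^+ 2.
set A3 := pos (- C 3%N 0) ^+ 2; set A2 := pos (- C 2%N 0) ^+ 2.
set al := pos (- C 2%N (-1)) ^+ 2; set be := pos (- C 4%N 1) ^+ 2.
move=> be0 al0 A20 A30 A40 A10 e1 e2.
(* Here [v1 ^+ 2 * A1 = v4 ^+ 2 * A4], and dividing by the larger velocity [v1] decreases the
   right-hand side. *)
have i1 : v1 * A1 <= v4 * A4.
  rewrite -(ler_pM2l v1_gt0) mulrA -expr2 e1 expr2 -!mulrA mulrCA.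
  by rewrite ler_wpM2r// mulr_ge0// ltW.
have i2 : v3 * A3 <= v2 * A2.
  rewrite -(ler_pM2l v3_gt0) mulrA -expr2 e2 expr2 -!mulrA mulrCA.
  by rewrite ler_wpM2r// mulr_ge0// ltW.
have i3 : v2 * al <= v1 * al by rewrite ler_wpM2r.
have i4 : v4 * be <= v3 * be by rewrite ler_wpM2r.
lra.
Qed.

End Graph.
End RealGraph.

(** * Real and imaginary parts, energies *)

Section Parts.
Context {R : realType}.
Local Notation mu := (@lebesgue_measure R).
Implicit Types (z : R[i]) (u w f : state R) (p : R[i] -> R).

Definition is_part p := p = @complex.Re R \/ p = @complex.Im R.

Lemma partD p z z' : is_part p -> p (z + z') = p z + p z'.
Proof. by case=> ->; case: z => a b; case: z'. Qed.

Lemma partN p z : is_part p -> p (- z) = - p z.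
Proof. by case=> ->; case: z => a b. Qed.

Lemma partM p (x : R) z : is_part p -> p (x%:C * z) = x * p z.
Proof. by case=> ->; case: z => a b /=; ring. Qed.

Lemma part_sqr p z : is_part p -> p z ^+ 2 <= sqr_modulus z.
Proof. by rewrite /sqr_modulus; case=> ->; rewrite ?lerDl ?lerDr sqr_ge0. Qed.

Lemma part_le_modulus p z : is_part p -> `|p z| <= modulus z.
Proof.
by move=> hp; rewrite /modulus -sqrtr_sqr ler_wsqrtr//; exact: part_sqr.
Qed.

Lemma complex_L2_part p a b (f : R -> R[i]) : is_part p ->
  complex_L2 a b f -> L2 a b (p \o f).
Proof. by case=> -> []. Qed.

Lemma inX_part p u : is_part p -> inX u ->
  L2 (-2) 2 (p \o u.1) /\ L2 (-2) 2 (p \o u.2).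
Proof. by move=> hp [h1 h2]; split; exact: complex_L2_part. Qed.

Lemma complex_H1_part p a b (f g : R -> R[i]) : is_part p ->
  complex_H1_deriv a b f g -> H1_deriv a b (p \o f) (p \o g).
Proof. by case=> -> []. Qed.

Lemma continuous_rep_part p a b (f w : R -> R[i]) : is_part p ->
  continuous_rep a b f w ->
  {within `[a, b], continuous (p \o w)} /\
  {ae mu, forall x, x \in `]a, b[ -> (p \o f) x = (p \o w) x}.
Proof.
move=> hp [c1 c2 e]; split; first by case: hp => ->.
by apply: (ae_imply _ e) => x fw xab; rewrite /= fw.
Qed.

Lemma clamp_node (i : nat) :
  clamp (node i) (node i.+1) (node i) = node i :> R /\
  clamp (node i) (node i.+1) (node i.+1) = node i.+1 :> R.
Proof. by split; rewrite clamp_id// !lexx ltW//= ?ltW//; exact: node_lt. Qed.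

Lemma node1 : node 1 = -2 :> R. Proof. by rewrite /node; lra. Qed.
Lemma node2 : node 2 = -1 :> R. Proof. by rewrite /node; lra. Qed.
Lemma node3 : node 3 = 0 :> R. Proof. by rewrite /node; lra. Qed.
Lemma node4 : node 4 = 1 :> R. Proof. by rewrite /node; lra. Qed.
Lemma node5 : node 5 = 2 :> R. Proof. by rewrite /node; lra. Qed.

(** The coefficients are real, so both parts satisfy the same system; the representatives are
    extended by constants beyond their interval. *)
Lemma opA_real_graph p (k P v1 v2 v3 v4 : R) u f : is_part p -> inX u ->
  opA k P v1 v2 v3 v4 u f ->
  real_graph k P v1 v2 v3 v4 (p \o u.1) (p \o u.2) (p \o f.1) (p \o f.2).
Proof.
move=> hp uX [[_ [c [q [rep [b1 b2 b3 b4] [b5 b6 b7 b8]]]]] fX [cx [qx hi]]].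
have [Lc Lq] := inX_part hp uX; have [Lf Lg] := inX_part hp fX.
split => //.
pose C i x := p (c i (clamp (node i) (node i.+1) x)).
pose Q i x := p (q i (clamp (node i) (node i.+1) x)).
exists C, Q, (fun=> p \o cx), (fun=> p \o qx); split; last first.
  have [l1 r1] := clamp_node 1; have [l2 r2] := clamp_node 2.
  have [l3 r3] := clamp_node 3; have [l4 r4] := clamp_node 4.
  move: l1 r1 l2 r2 l3 r3 l4 r4; rewrite node1 node2 node3 node4 node5.
  move=> l1 r1 l2 r2 l3 r3 l4 r4.
  split; split; rewrite /C /Q ?node1 ?node2 ?node3 ?node4 ?node5 ?l1 ?r1 ?l2 ?r2 ?l3 ?r3 ?l4 ?r4.
  - by rewrite b1.
  - by rewrite b2.
  - by rewrite -!partM// b3.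
  - by rewrite -!partM// b4.
  - by rewrite b5.
  - by rewrite b6.
  - by rewrite b7.
  - by rewrite b8.
move=> i i14; have [rc rq] := rep i i14; have [hc hq e] := hi i i14.
have [cc ec] := continuous_rep_part hp rc; have [cq eq] := continuous_rep_part hp rq.
have Hc := complex_H1_part hp hc; have Hq := complex_H1_part hp hq.
have [contC incC eC] := H1_deriv_rep (node_lt i) Hc cc ec.
have [contQ incQ eQ] := H1_deriv_rep (node_lt i) Hq cq eq.
split => //.
  by split => //; [case: Hc|case: Hq].
have eb : {ae mu, forall x, x \in `]node i, node i.+1[ ->
    (p \o u.1) x = C i x /\ (p \o u.2) x = Q i x}.
  by apply: (ae_imply2 _ eC eQ) => x h1 h2 xi; split; [exact: h1|exact: h2].
apply: (ae_imply2 _ eb e).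
move=> x h1 h2 xi; have [e1 e2] := h1 xi; have [f1 f2] := h2 xi.
split => //=.
  by rewrite f1 !partD// !partN// -rmorphN !partM// -e1 -e2.
by rewrite f2 !partD// !partN// !partM// -e1 -e2.
Qed.

End Parts.

Section Energy.
Context {R : realType}.
Local Notation mu := (@lebesgue_measure R).
Implicit Types (c q f g : R -> R) (u w : state R).

Definition energy c q : R := \int[mu]_(x in `](-2)%R, 2%R[) (c x ^+ 2 + q x ^+ 2).

(** It vanishes exactly when both components are nonnegative almost everywhere, so that its decay
    along an orbit is a comparison principle. *)
Definition negative_energy c q : R :=
  \int[mu]_(x in `](-2)%R, 2%R[) (pos (- c x) ^+ 2 + pos (- q x) ^+ 2).

Lemma energy_integrable c q : L2 (-2) 2 c -> L2 (-2) 2 q ->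
  mu.-integrable `](-2)%R, 2%R[ (EFin \o (fun x => c x ^+ 2 + q x ^+ 2)).
Proof. by move=> [_ Lc] [_ Lq]; exact: integrable_add. Qed.

Lemma negative_energy_integrable c q : L2 (-2) 2 c -> L2 (-2) 2 q ->
  mu.-integrable `](-2)%R, 2%R[ (EFin \o (fun x => pos (- c x) ^+ 2 + pos (- q x) ^+ 2)).
Proof.
by move=> Lc Lq; apply: energy_integrable; exact/L2_pos/L2_opp.
Qed.

Lemma energy_ge0 c q : 0 <= energy c q.
Proof. by apply: Rintegral_ge0 => x _; rewrite addr_ge0 ?sqr_ge0. Qed.

Lemma neg_sqr_le (x : R) : pos (- x) ^+ 2 <= x ^+ 2.
Proof. by case: (posE (- x)) => -[-> _]; rewrite ?sqrrN// expr0n/= sqr_ge0. Qed.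

Lemma negative_energy_le c q : L2 (-2) 2 c -> L2 (-2) 2 q ->
  negative_energy c q <= energy c q.
Proof.
move=> Lc Lq; apply: le_Rintegral => //.
- exact: negative_energy_integrable.
- exact: energy_integrable.
by move=> x _; rewrite lerD ?neg_sqr_le.
Qed.

Lemma energyZ (x y : R) c q c' q' :
  L2 (-2) 2 c -> L2 (-2) 2 q -> L2 (-2) 2 c' -> L2 (-2) 2 q' ->
  energy (fun z => x * c z + y * c' z) (fun z => x * q z + y * q' z) <=
  2 * x ^+ 2 * energy c q + 2 * y ^+ 2 * energy c' q'.
Proof.
move=> Lc Lq Lc' Lq'.
have i1 := energy_integrable Lc Lq; have i2 := energy_integrable Lc' Lq'.
rewrite /energy -!RintegralZl// -RintegralD//; try exact: integrable_scale.
apply: le_Rintegral => //.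
- by apply: energy_integrable; exact: L2_comb.
- by apply: integrable_add => //; exact: integrable_scale.
move=> z _.
have := sqr_ge0 (x * c z - y * c' z); have := sqr_ge0 (x * q z - y * q' z).
lra.
Qed.

Lemma neg_perturb (x y : R) : pos (- (x + y)) ^+ 2 <= 2 * pos (- x) ^+ 2 + 2 * y ^+ 2.
Proof.
have := sqr_ge0 (pos (- x) + y); case: (posE (- (x + y))) => -[-> h];
 case: (posE (- x)) => -[-> h']; nra.
Qed.

Lemma negative_energy_perturb c q c' q' :
  L2 (-2) 2 c -> L2 (-2) 2 q -> L2 (-2) 2 c' -> L2 (-2) 2 q' ->
  negative_energy (fun z => c z + c' z) (fun z => q z + q' z) <=
  2 * negative_energy c q + 2 * energy c' q'.
Proof.
move=> Lc Lq Lc' Lq'.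
have i1 := negative_energy_integrable Lc Lq; have i2 := energy_integrable Lc' Lq'.
rewrite /energy /negative_energy -!RintegralZl// -RintegralD//; try exact: integrable_scale.
apply: le_Rintegral => //.
- by apply: negative_energy_integrable; exact: L2_add.
- by apply: integrable_add => //; exact: integrable_scale.
by move=> z _; have := neg_perturb (c z) (c' z); have := neg_perturb (q z) (q' z); lra.
Qed.

(** One Euler step with slope [f] and remainder [r]. The term in [pos (- x) * f] is kept exact,
    since its sign is known only after integration; the one in [r] is split by Young's inequality
    with weight [s]. *)
Lemma neg_step (x f r h s : R) : 0 < s ->
  pos (- (x + (h * f + r))) ^+ 2 <=
  pos (- x) ^+ 2 - 2 * h * (pos (- x) * f) + s * pos (- x) ^+ 2 + s^-1 * r ^+ 2
    + 2 * h ^+ 2 * f ^+ 2 + 2 * r ^+ 2.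
Proof.
move=> s0; set y := h * f + r.
(* Indeed - (x + y) <= pos (- x) - y, because - x <= pos (- x). *)
have h1 : pos (- (x + y)) ^+ 2 <= (pos (- x) - y) ^+ 2.
  by case: (posE (- (x + y))) => -[-> h1]; case: (posE (- x)) => -[-> h2];
    rewrite ?expr0n ?sqr_ge0//=; nra.
apply: (le_trans h1).
have h2 : - 2 * pos (- x) * r <= s * pos (- x) ^+ 2 + s^-1 * r ^+ 2.
  have := mulr_ge0 (ltW s0) (sqr_ge0 (pos (- x) + s^-1 * r)).
  have -> : s * (pos (- x) + s^-1 * r) ^+ 2 =
      s * pos (- x) ^+ 2 + 2 * pos (- x) * r + s^-1 * r ^+ 2 by field; lra.
  by rewrite -subr_ge0 => h0; rewrite -subr_ge0; move: h0; congr (_ <= _); ring.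
have h3 := sqr_ge0 (h * f - r).
rewrite /y; lra.
Qed.

Lemma negative_energy_step c q f g r r' (h s B e : R) : 0 < h -> 0 < s ->
  L2 (-2) 2 c -> L2 (-2) 2 q -> L2 (-2) 2 f -> L2 (-2) 2 g ->
  L2 (-2) 2 r -> L2 (-2) 2 r' ->
  0 <= \int[mu]_(x in `](-2)%R, 2%R[) (pos (- c x) * f x + pos (- q x) * g x) ->
  energy c q <= B -> energy f g <= B -> energy r r' <= e ->
  negative_energy (fun x => c x + (h * f x + r x)) (fun x => q x + (h * g x + r' x)) <=
  negative_energy c q + (s * B + s^-1 * e + 2 * h ^+ 2 * B + 2 * e).
Proof.
move=> h0 s0 Lc Lq Lf Lg Lr Lr' disp hB hB' he.
have Lpc := L2_pos (L2_opp Lc); have Lpq := L2_pos (L2_opp Lq).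
pose N x := pos (- c x) ^+ 2 + pos (- q x) ^+ 2.
pose D x := pos (- c x) * f x + pos (- q x) * g x.
pose A x := f x ^+ 2 + g x ^+ 2.
pose E x := r x ^+ 2 + r' x ^+ 2.
have iN : mu.-integrable `](-2)%R, 2%R[ (EFin \o N) by exact: energy_integrable.
have iD : mu.-integrable `](-2)%R, 2%R[ (EFin \o D).
  by apply: integrable_add => //; exact: L2_mul.
have iA : mu.-integrable `](-2)%R, 2%R[ (EFin \o A) by exact: energy_integrable.
have iE : mu.-integrable `](-2)%R, 2%R[ (EFin \o E) by exact: energy_integrable.
have step1 : negative_energy (fun x => c x + (h * f x + r x)) (fun x => q x + (h * g x + r' x)) <=
    \int[mu]_(x in `](-2)%R, 2%R[) ((1 + s) * N x + (- 2 * h) * D x +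
      (s^-1 + 2) * E x + (2 * h ^+ 2) * A x).
  apply: le_Rintegral => //.
  - apply: negative_energy_integrable; apply: L2_add => //; apply: L2_add => //; exact: L2_scale.
  - by repeat (apply: integrable_add => //); exact: integrable_scale.
  move=> x _; have := neg_step (c x) (f x) (r x) h s0; have := neg_step (q x) (g x) (r' x) h s0.
  rewrite /N /D /E /A; lra.
apply: (le_trans step1).
rewrite !RintegralD//; try by repeat (apply: integrable_add => //); exact: integrable_scale.
rewrite !RintegralZl// -/(energy f g) -/(energy r r') -/(negative_energy c q).
have hn : negative_energy c q <= B by apply: (le_trans (negative_energy_le Lc Lq)).
have hs : s * negative_energy c q <= s * B by rewrite ler_wpM2l// ltW.
have hh : h ^+ 2 * energy f g <= h ^+ 2 * B by rewrite ler_wpM2l// sqr_ge0.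
have hi : s^-1 * energy r r' <= s^-1 * e by rewrite ler_wpM2l// invr_ge0 ltW.
have hd : 0 <= h * \int[mu]_(x in `](-2)%R, 2%R[) D x by rewrite mulr_ge0// ltW.
lra.
Qed.

End Energy.

(** * Orbits of the semigroup *)

Section Orbits.
Context {R : realType}.
Local Notation mu := (@lebesgue_measure R).
Implicit Types (u w f : state R) (p : R[i] -> R).

(** Euler scheme with n equal steps: dispersivity removes the first-order term, and the remainder of
    energy at most e h^2, uniformly in time, lets each step gain at most [h * kap], with
    [t * kap = eps] in total. *)
Lemma negative_energy_orbit (c q f g : R -> R -> R) (B : R) :
  (forall t, 0 <= t -> [/\ L2 (-2) 2 (c t), L2 (-2) 2 (q t), L2 (-2) 2 (f t) & L2 (-2) 2 (g t)]) ->
  (forall t, 0 <= t -> 0 <= \int[mu]_(x in `](-2)%R, 2%R[)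
     (pos (- c t x) * f t x + pos (- q t x) * g t x)) ->
  (forall t, 0 <= t -> energy (c t) (q t) <= B /\ energy (f t) (g t) <= B) ->
  (forall e, 0 < e -> exists h0, 0 < h0 /\ forall t h, 0 <= t -> 0 < h -> h < h0 ->
     energy (fun x => c (t + h) x - c t x - h * f t x)
            (fun x => q (t + h) x - q t x - h * g t x) <= e * h ^+ 2) ->
  forall t, 0 <= t -> negative_energy (c t) (q t) <= negative_energy (c 0) (q 0).
Proof.
move=> hL disp hB incr t; rewrite le_eqVlt => /orP[/eqP <-//|t0].
have B0 : 0 <= B by have [h _] := hB 0 (lexx _); exact: (le_trans (energy_ge0 _ _) h).
apply/ler_addgt0Pr => eps eps0.
(* The Young weight of a step will be [h * eta]. Then the two Young terms cost at most [h * kap / 4]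
   each, and [h1] makes the terms of order h^2 cost at most [h * kap / 2]. [B + 1] keeps the
   denominator positive. *)
pose kap := eps / t; have kap0 : 0 < kap by rewrite divr_gt0.
pose B' := B + 1; have B'0 : 0 < B' by rewrite /B'; lra.
pose eta := kap / (4 * B'); have eta0 : 0 < eta by rewrite divr_gt0// mulr_gt0.
pose e := kap * eta / 4; have e0 : 0 < e by rewrite divr_gt0// mulr_gt0.
have [h0 [h00 hh]] := incr e e0.
pose h1 := Num.min h0 (kap / (4 * (B' + e))).
have h10 : 0 < h1 by rewrite lt_min h00/= divr_gt0// mulr_gt0// addr_gt0.
pose n := (Num.truncn (t / h1)).+1.
pose h := t / n%:R.
have hpos : 0 < h by rewrite divr_gt0.
have hsmall : h < h1.
  by rewrite /h ltr_pdivrMr// mulrC -ltr_pdivrMr// truncnS_gt.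
have hh0 : h < h0 by apply: (lt_le_trans hsmall); rewrite ge_min lexx.
have hk : h * (4 * (B' + e)) <= kap.
  have be : 0 < 4 * (B' + e) by rewrite mulr_gt0// addr_gt0.
  rewrite -ler_pdivlMr//; apply: ltW; apply: (lt_le_trans hsmall).
  by rewrite ge_min lexx orbT.
have step s : 0 <= s -> negative_energy (c (s + h)) (q (s + h)) <=
    negative_energy (c s) (q s) + h * kap.
  move=> s0; have [Lc Lq Lf Lg] := hL s s0.
  have [Lc' Lq' _ _] := hL (s + h) (addr_ge0 s0 (ltW hpos)).
  have [hB1 hB2] := hB s s0.
  pose r x := c (s + h) x - c s x - h * f s x.
  pose r' x := q (s + h) x - q s x - h * g s x.
  have Lr : L2 (-2) 2 r.
    by apply: L2_add; [apply: L2_add => //|]; apply: L2_opp => //; exact: L2_scale.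
  have Lr' : L2 (-2) 2 r'.
    by apply: L2_add; [apply: L2_add => //|]; apply: L2_opp => //; exact: L2_scale.
  have := negative_energy_step hpos (mulr_gt0 hpos eta0) Lc Lq Lf Lg Lr Lr' (disp s s0)
    hB1 hB2 (hh s h s0 hpos hh0).
  rewrite (_ : (fun x => c s x + (h * f s x + r x)) = c (s + h)); last first.
    by apply/funext => x; rewrite /r; ring.
  rewrite (_ : (fun x => q s x + (h * g s x + r' x)) = q (s + h)); last first.
    by apply/funext => x; rewrite /r'; ring.
  move=> hs; apply: (le_trans hs); rewrite lerD2l.
  have e1 : (h * eta)^-1 * (e * h ^+ 2) = h * (kap / 4).
    by rewrite /e; field; rewrite !gt_eqF.
  have e2 : h * eta * B <= h * (kap / 4).
    rewrite -mulrA; apply: ler_wpM2l; first exact: ltW.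
    rewrite /eta mulrAC ler_pdivrMr; last exact: mulr_gt0.
    rewrite (_ : kap / 4 * (4 * B') = kap * B'); last by field.
    by apply: ler_wpM2l; [exact: ltW|rewrite /B'; lra].
  rewrite e1; have := ler_wpM2l (ltW hpos) hk; rewrite /B' => h2.
  nra.
have chain m : negative_energy (c (m%:R * h)) (q (m%:R * h)) <=
    negative_energy (c 0) (q 0) + m%:R * (h * kap).
  elim: m => [|m ih]; first by rewrite !mul0r addr0.
  rewrite -natr1 !mulrDl !mul1r addrA.
  have m0 : 0 <= m%:R * h by rewrite mulr_ge0// ltW.
  by apply: (le_trans (step _ m0)); rewrite lerD2r.
have := chain n.
rewrite mulrA (_ : n%:R * h = t); last by rewrite /h mulrC divfK// gt_eqF.
by rewrite /kap mulrC divfK// gt_eqF.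
Qed.

Definition square_norm u := \int[mu]_(x in `](-2)%R, 2%R[)
  (sqr_modulus (u.1 x) + sqr_modulus (u.2 x)).

Lemma sqr_modulus_ge0 (z : R[i]) : 0 <= sqr_modulus z.
Proof. by rewrite addr_ge0 ?sqr_ge0. Qed.

Lemma square_norm_ge0 u : 0 <= square_norm u.
Proof. by apply: Rintegral_ge0 => x _; rewrite addr_ge0 ?sqr_modulus_ge0. Qed.

Lemma normX_sqr u : normX u ^+ 2 = square_norm u.
Proof. by rewrite /normX sqr_sqrtr ?square_norm_ge0. Qed.

Lemma normX_ge0 u : 0 <= normX u.
Proof. exact: sqrtr_ge0. Qed.

Lemma square_norm_integrable u : inX u -> mu.-integrable `](-2)%R, 2%R[
  (EFin \o (fun x => sqr_modulus (u.1 x) + sqr_modulus (u.2 x))).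
Proof.
by move=> [[[_ h1] [_ h2]] [[_ h3] [_ h4]]]; apply: integrable_add => //; exact: integrable_add.
Qed.

Lemma energy_part_le p u : is_part p -> inX u ->
  energy (p \o u.1) (p \o u.2) <= normX u ^+ 2.
Proof.
move=> hp uX; have [L1 L2] := inX_part hp uX.
rewrite normX_sqr; apply: le_Rintegral => //.
- exact: energy_integrable.
- exact: square_norm_integrable.
by move=> x _; rewrite lerD//; exact: part_sqr.
Qed.

Lemma ReM_real (x : R) (z : R[i]) : complex.Re (x%:C * z) = x * complex.Re z.
Proof. by rewrite partM//; left. Qed.

Lemma complex_L2_comb (a b : R) (f g : R -> R[i]) : complex_L2 (-2) 2 f ->
  complex_L2 (-2) 2 g -> complex_L2 (-2) 2 (fun x => a%:C * f x + b%:C * g x).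
Proof.
move=> [f1 f2] [g1 g2]; split.
  rewrite (_ : _ \o _ = fun x => a * complex.Re (f x) + b * complex.Re (g x)).
    exact: L2_comb.
  by apply/funext => x; rewrite /= partD ?partM//; left.
rewrite (_ : _ \o _ = fun x => a * complex.Im (f x) + b * complex.Im (g x)).
  exact: L2_comb.
by apply/funext => x; rewrite /= partD ?partM//; right.
Qed.

(** Differences, real multiples and difference quotients are all of this form, so one lemma each for
    linearity, membership and congruence covers them. *)
Definition combX (a : R) u (b : R) w : state R := addX (scaleX a%:C u) (scaleX b%:C w).

Lemma inX_comb a u b w : inX u -> inX w -> inX (combX a u b w).
Proof. by move=> [u1 u2] [w1 w2]; split; exact: complex_L2_comb. Qed.

Lemma subXE u w : subX u w = combX 1 u (-1) w.
Proof.
rewrite /combX /subX /addX /scaleX rmorphN rmorph1 /=.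
by congr pair; apply/funext => x; rewrite !mul1r.
Qed.

Lemma inX_sub u w : inX u -> inX w -> inX (subX u w).
Proof. by rewrite subXE; exact: inX_comb. Qed.

Lemma scaleXE (a : R) u : scaleX a%:C u = combX a u 0 u.
Proof.
rewrite /combX /addX /scaleX /=.
by congr pair; apply/funext => x; rewrite mul0r addr0.
Qed.

Lemma inX_scale (a : R) u : inX u -> inX (scaleX a%:C u).
Proof. by move=> uX; rewrite scaleXE; exact: inX_comb. Qed.

Lemma inX_zero : inX (@zeroX R).
Proof.
have c0 : L2 (-2) 2 (fun=> 0 : R) by apply: continuous_L2 => x; exact: cvg_cst.
by split; split.
Qed.

Lemma eqX_refl u : eqX u u.
Proof. by apply: aeW. Qed.

Lemma eqX_sym u w : eqX u w -> eqX w u.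
Proof. by move=> h; apply: (ae_imply _ h) => x hx xi; have [-> ->] := hx xi. Qed.

Lemma eqX_trans w u f : eqX u w -> eqX w f -> eqX u f.
Proof.
move=> h h'; apply: (ae_imply2 _ h h') => x hx hx' xi.
by have [-> ->] := hx xi; exact: hx'.
Qed.

Lemma eqX_comb a b u u' w w' : eqX u u' -> eqX w w' -> eqX (combX a u b w) (combX a u' b w').
Proof.
move=> h h'; apply: (ae_imply2 _ h h') => x hx hx' xi.
by rewrite /=; have [-> ->] := hx xi; have [-> ->] := hx' xi.
Qed.

Lemma eqX_normX u w : inX u -> inX w -> eqX u w -> normX u = normX w.
Proof.
move=> uX wX uw; rewrite /normX; congr Num.sqrt; apply: ae_Rintegral => //.
- exact: (integrable_measurable (mu := mu)) (square_norm_integrable uX).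
- exact: (integrable_measurable (mu := mu)) (square_norm_integrable wX).
by apply: (ae_imply _ uw) => x hx xi; have [-> ->] := hx xi.
Qed.

Section Semigroup.
Variables (A : operatorX R) (T : R -> state R -> state R).
Hypothesis TA : is_semigroup_of A T.

Lemma semigroup_inX t u : 0 <= t -> inX u -> inX (T t u).
Proof. by case: TA => [[h _ _ _ _] _]; exact: h. Qed.

Lemma semigroup_contraction t u : 0 <= t -> inX u -> normX (T t u) <= normX u.
Proof. by case: TA => [[_ _ h _ _] _]; exact: h. Qed.

Lemma semigroup_comb t a b u w : 0 <= t -> inX u -> inX w ->
  eqX (T t (combX a u b w)) (combX a (T t u) b (T t w)).
Proof.
case: TA => [[_ lin _ _ _] _] t0 uX wX.
(* Additivity is stated for [z u + w]; with z = -1 and both states zero it yields the image of zero,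
   needed to separate scaling from addition. *)
have T0 : eqX (T t zeroX) zeroX.
  have := lin t (-1) zeroX zeroX t0 inX_zero inX_zero.
  rewrite (_ : addX (scaleX (-1) zeroX) zeroX = zeroX); last first.
    by rewrite /addX /scaleX /zeroX /=; congr pair; apply/funext => x; rewrite mulr0 addr0.
  by apply: ae_imply => x hx xi; have [-> ->] := hx xi; rewrite /= !mulN1r !addNr.
have Tb : eqX (T t (scaleX b%:C w)) (scaleX b%:C (T t w)).
  have := lin t b%:C w zeroX t0 wX inX_zero.
  rewrite (_ : addX (scaleX b%:C w) zeroX = scaleX b%:C w); last first.
    by rewrite /addX /scaleX /zeroX /=; congr pair; apply/funext => x; rewrite addr0.
  move=> h; apply: (ae_imply2 _ h T0) => x hx hx' xi.
  by have [-> ->] := hx xi; have [e1 e2] := hx' xi; rewrite /= e1 e2 /= !addr0.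
apply: (eqX_trans (lin t a%:C u (scaleX b%:C w) t0 uX (inX_scale b wX))).
apply: (ae_imply _ Tb) => x hx xi; have [e1 e2] := hx xi.
by rewrite /= e1 e2.
Qed.

Lemma semigroup_add s t u : 0 <= s -> 0 <= t -> inX u -> eqX (T (s + t) u) (T s (T t u)).
Proof. by case: TA => [[_ _ _ [_ h] _] _]; exact: h. Qed.

Lemma semigroup_zero u : inX u -> eqX (T 0 u) u.
Proof. by case: TA => [[_ _ _ [h _] _] _]; exact: h. Qed.

Definition quotient h u : state R := scaleX (h^-1)%:C (subX (T h u) u).

Lemma quotientE h u : quotient h u = combX h^-1 (T h u) (- h^-1) u.
Proof.
rewrite /quotient subXE /combX /scaleX /addX /= !rmorphN !rmorph1 /=.
by congr pair; apply/funext => x; ring.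
Qed.

(** [T t] commutes with the difference quotient and contracts, so the error at time t is at most the
    error at time 0. *)
Lemma semigroup_quotient t h u f : 0 <= t -> 0 <= h -> inX u -> inX f ->
  normX (subX (quotient h (T t u)) (T t f)) <= normX (subX (quotient h u) f).
Proof.
move=> t0 h0 uX fX.
have TuX := semigroup_inX t0 uX; have ThX := semigroup_inX h0 uX.
have qX : inX (quotient h u) by rewrite quotientE; exact: inX_comb.
have qtX : inX (quotient h (T t u)).
  by rewrite quotientE; apply: inX_comb => //; exact: semigroup_inX.
have sX : inX (subX (quotient h u) f) by exact: inX_sub.
apply: (le_trans _ (semigroup_contraction t0 sX)).
rewrite (eqX_normX _ _ (w := T t (subX (quotient h u) f)))//.
- by apply: inX_sub => //; exact: semigroup_inX.
- exact: semigroup_inX.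
rewrite !subXE; apply: eqX_sym; apply: (eqX_trans (semigroup_comb _ _ t0 qX fX)).
apply: eqX_comb; last exact: eqX_refl.
rewrite !quotientE; apply: (eqX_trans (semigroup_comb _ _ t0 ThX uX)).
apply: eqX_comb; last exact: eqX_refl.
apply: (eqX_trans (eqX_sym (semigroup_add t0 h0 uX))); rewrite addrC.
exact: semigroup_add.
Qed.

Lemma semigroup_domain t u f : 0 <= t -> inX u -> inX f -> A u f -> A (T t u) (T t f).
Proof.
move=> t0 uX fX Auf; case: (TA) => _ gen.
apply/(gen _ _ (semigroup_inX t0 uX) (semigroup_inX t0 fX)).
have lim := (gen _ _ uX fX).1 Auf.
apply: (squeeze_cvgr _ (cvg_cst 0) lim).
near=> h; rewrite normX_ge0/=; apply: semigroup_quotient => //.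
Unshelve. all: by end_near. Qed.

(** By [semigroup_quotient] the remainder is controlled by the one at time 0, which is why [h0] does
    not depend on t. *)
Lemma semigroup_increment p u f : is_part p -> inX u -> inX f -> A u f ->
  forall e, 0 < e -> exists h0, 0 < h0 /\ forall t h, 0 <= t -> 0 < h -> h < h0 ->
  energy (fun x => p ((T (t + h) u).1 x) - p ((T t u).1 x) - h * p ((T t f).1 x))
         (fun x => p ((T (t + h) u).2 x) - p ((T t u).2 x) - h * p ((T t f).2 x))
    <= e * h ^+ 2.
Proof.
move=> hp uX fX Auf e e0; case: (TA) => _ gen.
have /cvgrPdist_le/(_ (Num.sqrt e)) := (gen _ _ uX fX).1 Auf.
rewrite sqrtr_gt0 => /(_ e0); rewrite -nbhs_nearE /at_right /within /= => -[h0 /= h00 hh].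
exists h0; split => // t h t0 hpos hlt.
have {hh} small : normX (subX (quotient h u) f) <= Num.sqrt e.
  have := hh h; rewrite /= distrC subr0 gtr0_norm// => /(_ hlt hpos).
  by rewrite distrC subr0 ger0_norm// normX_ge0.
pose Z := subX (quotient h (T t u)) (T t f).
have TuX := semigroup_inX t0 uX; have TfX := semigroup_inX t0 fX.
have ThX := semigroup_inX (ltW hpos) TuX.
have T'X := semigroup_inX (addr_ge0 t0 (ltW hpos)) uX.
have qX : inX (quotient h (T t u)) by rewrite quotientE; exact: inX_comb.
have ZX : inX Z by exact: inX_sub.
have Zle : normX Z <= Num.sqrt e.
  by apply: le_trans small; apply: semigroup_quotient => //; exact: ltW.
have [LZ1 LZ2] := inX_part hp ZX.
have [LT1 LT2] := inX_part hp TuX; have [LT'1 LT'2] := inX_part hp T'X.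
have [Lf1 Lf2] := inX_part hp TfX.
have eZ : eqX (T (t + h) u) (T h (T t u)) by rewrite addrC; apply: semigroup_add => //; exact: ltW.
have h_neq0 : h != 0 by rewrite gt_eqF.
rewrite /energy (@ae_Rintegral _ _ _ mu _ _
  (fun x => h ^+ 2 * ((p \o Z.1) x ^+ 2 + (p \o Z.2) x ^+ 2)))//.
- rewrite RintegralZl//; last exact: energy_integrable.
  rewrite mulrC ler_wpM2r ?sqr_ge0// (le_trans (energy_part_le hp ZX))//.
  rewrite -(sqr_sqrtr (ltW e0)) ler_sqr ?nnegrE ?sqrtr_ge0// normX_ge0//.
- apply: (integrable_measurable (mu := mu)); apply: energy_integrable.
    by apply: L2_add; [apply: L2_add => //|]; apply: L2_opp => //; exact: L2_scale.
  by apply: L2_add; [apply: L2_add => //|]; apply: L2_opp => //; exact: L2_scale.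
- apply: (integrable_measurable (mu := mu)); apply: integrable_scale => //.
  exact: energy_integrable.
apply: (ae_imply _ eZ) => x hx xi; have [e1 e2] := hx xi.
have pz (a b d : R[i]) : p ((h^-1)%:C * (a + -1 * b) + -1 * d) = h^-1 * (p a - p b) - p d.
  by rewrite !mulN1r !partD// partM// partD// !partN.
rewrite /= e1 e2 !pz; field; exact: h_neq0.
Qed.

End Semigroup.
End Orbits.

(** * Comparison with a positive eigenfunction *)

Section Comparison.
Context {R : realType}.
Local Notation mu := (@lebesgue_measure R).
Implicit Types (u w f : state R) (p : R[i] -> R).

(** From [1 - y <= expR (- y)] one gets [expR y <= 1 / (1 - y)], and the excess over 1 + y is then
    y^2 / (1 - y). *)
Lemma expR_second_order (y : R) : y <= 0 -> 0 <= expR y - 1 - y <= y ^+ 2.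
Proof.
move=> y0; apply/andP; split.
  by have := expR_ge1Dx y; lra.
have h1 := expR_ge1Dx (- y).
have : expR y * (1 - y) <= 1.
  by apply: (le_trans (ler_wpM2l (expR_ge0 y) h1)); rewrite expRxMexpNx_1.
by have := expR_gt0 y; nra.
Qed.

Section Domain.
Variables (k P v1 v2 v3 v4 : R).
Hypotheses (k_gt0 : 0 < k) (P_gt0 : 0 < P).
Hypotheses (v1_gt0 : 0 < v1) (v2_gt0 : 0 < v2) (v3_gt0 : 0 < v3) (v4_gt0 : 0 < v4).
Hypotheses (v21 : v2 <= v1) (v23 : v2 <= v3) (v43 : v4 <= v3) (v41 : v4 <= v1).
Local Notation A := (opA k P v1 v2 v3 v4).
Variable T : R -> state R -> state R.
Hypothesis TA : is_semigroup_of A T.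

(** The combination with [a * expR (t * l)] stays in the real graph and has the expected time
    derivative, because [(c0, q0)] is an eigenvector; [negative_energy_orbit] applies to it. *)
Lemma domain_comparison p (l a s : R) (c0 q0 : R -> R) u f : is_part p -> l <= 0 ->
  real_graph k P v1 v2 v3 v4 c0 q0 (fun x => l * c0 x) (fun x => l * q0 x) ->
  inX u -> inX f -> A u f -> forall t, 0 <= t ->
  negative_energy (fun x => a * expR (t * l) * c0 x + s * p ((T t u).1 x))
    (fun x => a * expR (t * l) * q0 x + s * p ((T t u).2 x)) <=
  negative_energy (fun x => a * c0 x + s * p (u.1 x)) (fun x => a * q0 x + s * p (u.2 x)).
Proof.
move=> hp l0 g0 uX fX Auf t t0.
have [Lc0 Lq0 _ _ _] := g0.
pose al t := a * expR (t * l).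
pose c t x := al t * c0 x + s * (p \o (T t u).1) x.
pose q t x := al t * q0 x + s * (p \o (T t u).2) x.
pose ff t x := al t * (l * c0 x) + s * (p \o (T t f).1) x.
pose gg t x := al t * (l * q0 x) + s * (p \o (T t f).2) x.
have gr r : 0 <= r -> real_graph k P v1 v2 v3 v4 (c r) (q r) (ff r) (gg r).
  move=> r0; apply: real_graph_comb => //.
  apply: opA_real_graph => //; first exact: (semigroup_inX TA).
  exact: (semigroup_domain TA).
have LT w r : 0 <= r -> inX w -> L2 (-2) 2 (p \o (T r w).1) /\ L2 (-2) 2 (p \o (T r w).2).
  by move=> r0 wX; apply: inX_part => //; exact: (semigroup_inX TA).
have al1 r : 0 <= r -> al r ^+ 2 <= a ^+ 2.
  move=> r0; rewrite exprMn ler_piMr ?sqr_ge0//.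
  have h : expR (r * l) <= 1 by rewrite expR_le1 mulr_ge0_le0.
  by have := expR_ge0 (r * l); nra.
have bT w r : 0 <= r -> inX w -> energy (p \o (T r w).1) (p \o (T r w).2) <= normX w ^+ 2.
  move=> r0 wX; apply: (le_trans (energy_part_le hp (semigroup_inX TA r0 wX))).
  by rewrite ler_sqr ?nnegrE ?normX_ge0// (semigroup_contraction TA).
pose E0 := energy c0 q0; pose E1 := energy (fun x => l * c0 x) (fun x => l * q0 x).
have E00 : 0 <= E0 by exact: energy_ge0.
have E10 : 0 <= E1 by exact: energy_ge0.
pose B := 2 * a ^+ 2 * (E0 + E1) + 2 * s ^+ 2 * (normX u ^+ 2 + normX f ^+ 2).
have main := @negative_energy_orbit R c q ff gg B _ _ _ _ t t0.
have lhs : negative_energy (c 0) (q 0) =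
    negative_energy (fun x => a * c0 x + s * p (u.1 x)) (fun x => a * q0 x + s * p (u.2 x)).
  have [Lu1 Lu2] := inX_part hp uX; have [LT1 LT2] := LT u 0 (lexx _) uX.
  apply: ae_Rintegral => //.
  - apply: (integrable_measurable (mu := mu)); apply: negative_energy_integrable; exact: L2_comb.
  - by apply: (integrable_measurable (mu := mu)); apply: negative_energy_integrable; exact: L2_comb.
  apply: (ae_imply _ (semigroup_zero TA uX)) => x hx xi; have [e1 e2] := hx xi.
  by rewrite /c /q /al /= e1 e2 mul0r expR0 mulr1.
rewrite -lhs; apply: main.
- by move=> r r0; have [] := gr r r0.
- by move=> r r0; apply: (real_graph_dispersive k_gt0 P_gt0 v1_gt0 v2_gt0 v3_gt0 v4_gt0 v21 v23 v43 v41); exact: gr.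
- move=> r r0; have [LT1 LT2] := LT u r r0 uX; have [LF1 LF2] := LT f r r0 fX.
  have h1 := energyZ (al r) s Lc0 Lq0 LT1 LT2.
  have h2 := energyZ (al r) s (L2_scale l Lc0) (L2_scale l Lq0) LF1 LF2.
  have ha := al1 r r0; have s2 := sqr_ge0 s.
  have k1 : s ^+ 2 * energy (p \o (T r u).1) (p \o (T r u).2) <= s ^+ 2 * normX u ^+ 2.
    by rewrite ler_wpM2l// bT.
  have k2 : s ^+ 2 * energy (p \o (T r f).1) (p \o (T r f).2) <= s ^+ 2 * normX f ^+ 2.
    by rewrite ler_wpM2l// bT.
  have k3 : al r ^+ 2 * E0 <= a ^+ 2 * E0 by rewrite ler_wpM2r.
  have k4 : al r ^+ 2 * E1 <= a ^+ 2 * E1 by rewrite ler_wpM2r.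
  have k5 : 0 <= s ^+ 2 * normX u ^+ 2 by rewrite mulr_ge0 ?sqr_ge0.
  have k6 : 0 <= s ^+ 2 * normX f ^+ 2 by rewrite mulr_ge0 ?sqr_ge0.
  have k7 : 0 <= a ^+ 2 * E0 by rewrite mulr_ge0 ?sqr_ge0.
  have k8 : 0 <= a ^+ 2 * E1 by rewrite mulr_ge0 ?sqr_ge0.
  rewrite /B; split.
    by apply: (le_trans h1); rewrite -/E0; lra.
  by apply: (le_trans h2); rewrite -/E1; lra.
move=> e e0.
(* Each of the two errors in [energyZ] may use half of e. This denominator absorbs the factor
   [2 * s ^+ 2] of the semigroup part; [Z] does the same for the exponential, whose remainder has
   energy of order h^4, and h < 1 is used there. *)
have den0 : 0 < 4 * (s ^+ 2 + 1) by have := sqr_ge0 s; lra.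
have [h1 [h10 hinc]] := semigroup_increment TA hp uX fX Auf (divr_gt0 e0 den0).
pose Z := 4 * (a ^+ 2 * l ^+ 4 * E0 + 1).
have ZE : 0 <= a ^+ 2 * l ^+ 4 * E0.
  by rewrite mulr_ge0// mulr_ge0 ?sqr_ge0// exprn_even_ge0.
have Zp : 0 < Z by rewrite /Z; lra.
pose h2 := Num.min 1 (e / Z).
have h20 : 0 < h2 by rewrite lt_min ltr01/= divr_gt0.
exists (Num.min h1 h2); split; first by rewrite lt_min h10.
move=> r h r0 hpos; rewrite !lt_min => /and3P[hh1 hh2 hh3].
have [LT1 LT2] := LT u r r0 uX; have [LF1 LF2] := LT f r r0 fX.
have [LT'1 LT'2] := LT u (r + h) (addr_ge0 r0 (ltW hpos)) uX.
pose be := al (r + h) - al r - h * (al r * l).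
have bound := energyZ be s Lc0 Lq0
  (c' := fun x => p ((T (r + h) u).1 x) - p ((T r u).1 x) - h * p ((T r f).1 x))
  (q' := fun x => p ((T (r + h) u).2 x) - p ((T r u).2 x) - h * p ((T r f).2 x)).
rewrite (_ : (fun x => c (r + h) x - c r x - h * ff r x) = (fun x => be * c0 x + s *
   (p ((T (r + h) u).1 x) - p ((T r u).1 x) - h * p ((T r f).1 x)))); last first.
  by apply/funext => x; rewrite /c /ff /be /=; ring.
rewrite (_ : (fun x => q (r + h) x - q r x - h * gg r x) = (fun x => be * q0 x + s *
   (p ((T (r + h) u).2 x) - p ((T r u).2 x) - h * p ((T r f).2 x)))); last first.
  by apply/funext => x; rewrite /q /gg /be /=; ring.
apply: le_trans (bound _ _) _.
- by apply: L2_add; [apply: L2_add => //|]; apply: L2_opp => //; exact: L2_scale.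
- by apply: L2_add; [apply: L2_add => //|]; apply: L2_opp => //; exact: L2_scale.
have hi := hinc r h r0 hpos hh1.
have beE : be = al r * (expR (h * l) - 1 - h * l).
  by rewrite /be /al mulrDl expRD; ring.
have hl0 : h * l <= 0 by rewrite mulr_ge0_le0// ltW.
have /andP[ex0 ex1] := expR_second_order hl0.
have be2 : be ^+ 2 <= a ^+ 2 * l ^+ 4 * h ^+ 4.
  rewrite beE exprMn -mulrA; apply: ler_pM; rewrite ?sqr_ge0//; first exact: al1.
  rewrite (_ : l ^+ 4 * h ^+ 4 = ((h * l) ^+ 2) ^+ 2); last by ring.
  by rewrite ler_sqr// nnegrE// sqr_ge0.
have t1 : 2 * be ^+ 2 * E0 <= e / 2 * h ^+ 2.
  have h3 : 2 * be ^+ 2 * E0 <= 2 * (a ^+ 2 * l ^+ 4 * h ^+ 4) * E0.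
    by rewrite ler_wpM2r// ler_wpM2l.
  apply: (le_trans h3).
  rewrite (_ : 2 * _ * E0 = (2 * (a ^+ 2 * l ^+ 4 * E0) * h ^+ 2) * h ^+ 2); last by ring.
  rewrite ler_wpM2r ?sqr_ge0//.
  have hZ : h * Z < e by rewrite -ltr_pdivlMr.
  have : h ^+ 2 * Z <= e.
    apply: le_trans (ltW hZ); apply: ler_wpM2r; first exact: ltW.
    by rewrite expr2 ler_piMl ?ltW.
  by rewrite /Z; have := sqr_ge0 h; lra.
have t2 : 2 * s ^+ 2 * (e / (4 * (s ^+ 2 + 1)) * h ^+ 2) <= e / 2 * h ^+ 2.
  rewrite mulrA ler_wpM2r ?sqr_ge0//.
  rewrite mulrA ler_pdivrMr//; have := sqr_ge0 s; nra.
have t3 := ler_wpM2l (_ : 0 <= 2 * s ^+ 2) hi.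
have s20 : 0 <= 2 * s ^+ 2 by rewrite mulr_ge0 ?sqr_ge0.
rewrite -/E0; lra.
Qed.

Lemma negative_energy_eq0 (c q : R -> R) : L2 (-2) 2 c -> L2 (-2) 2 q ->
  negative_energy c q <= 0 ->
  {ae mu, forall x, x \in `](-2)%R, 2%R[ -> 0 <= c x /\ 0 <= q x}.
Proof.
move=> Lc Lq ne0; have ii := negative_energy_integrable Lc Lq.
pose N x : R := pos (- c x) ^+ 2 + pos (- q x) ^+ 2.
have h : {ae mu, forall x, `](-2)%R, 2%R[%classic x -> N x = 0}.
  by apply: (Rintegral_eq0 _ ii _ ne0) => // x _; rewrite addr_ge0 ?sqr_ge0.
apply: (ae_imply _ h) => x hx xi; have e := hx xi; rewrite /N in e.
have := sqr_ge0 (pos (- c x)); have := sqr_ge0 (pos (- q x)) => h1 h2.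
have /eqP : pos (- c x) ^+ 2 = 0 by lra.
have /eqP : pos (- q x) ^+ 2 = 0 by lra.
rewrite !sqrf_eq0 => /eqP e1 /eqP e2; move: e1 e2.
by case: (posE (- c x)) => -[-> ?]; case: (posE (- q x)) => -[-> ?]; lra.
Qed.

(** Pass through a nearby state of the domain: [negative_energy] is stable under small L^2
    perturbations, and contractivity keeps the two orbits close. *)
Lemma comparison p (l a s : R) (c0 q0 : R -> R) u : is_part p -> l <= 0 ->
  real_graph k P v1 v2 v3 v4 c0 q0 (fun x => l * c0 x) (fun x => l * q0 x) ->
  inX u ->
  (forall e, 0 < e -> exists w f, [/\ inX w, inX f, A w f & normX (subX u w) <= e]) ->
  {ae mu, forall x, x \in `](-2)%R, 2%R[ ->
    0 <= a * c0 x + s * p (u.1 x) /\ 0 <= a * q0 x + s * p (u.2 x)} ->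
  forall t, 0 <= t -> {ae mu, forall x, x \in `](-2)%R, 2%R[ ->
    0 <= a * expR (t * l) * c0 x + s * p ((T t u).1 x) /\
    0 <= a * expR (t * l) * q0 x + s * p ((T t u).2 x)}.
Proof.
move=> hp l0 g0 uX dense init t t0.
have [Lc0 Lq0 _ _ _] := g0.
have [Lu1 Lu2] := inX_part hp uX.
have TuX := semigroup_inX TA t0 uX; have [LT1 LT2] := inX_part hp TuX.
apply: negative_energy_eq0; try exact: (L2_comb _ _ Lc0 LT1); try exact: (L2_comb _ _ Lq0 LT2).
have init0 : negative_energy (fun x => a * c0 x + s * p (u.1 x)) (fun x => a * q0 x + s * p (u.2 x)) = 0.
  rewrite /negative_energy (@ae_Rintegral _ _ _ mu _ _ (fun=> 0))//.
  - by rewrite Rintegral_cst//= mul0r.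
  - apply: (integrable_measurable (mu := mu)); apply: negative_energy_integrable.
      exact: (L2_comb _ _ Lc0 Lu1).
    exact: (L2_comb _ _ Lq0 Lu2).
  apply: (ae_imply _ init) => x hx xi; have [h1 h2] := hx xi.
  by rewrite /pos !max_r ?oppr_le0// expr0n/= addr0.
apply/ler_addgt0Pr => e e0; rewrite add0r.
(* The perturbation inequality is used at time t and at time 0; the total error is
   [6 * s ^+ 2 * d ^+ 2], below e. *)
pose d := Num.sqrt (e / (8 * (s ^+ 2 + 1))).
have den0 : 0 < 8 * (s ^+ 2 + 1) by have := sqr_ge0 s; lra.
have d0 : 0 < d by rewrite sqrtr_gt0 divr_gt0.
have d2 : d ^+ 2 = e / (8 * (s ^+ 2 + 1)) by rewrite sqr_sqrtr// ltW// divr_gt0.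
have [w [f [wX fX Awf uw]]] := dense d d0.
have TwX := semigroup_inX TA t0 wX; have [LW1 LW2] := inX_part hp TwX.
have dX := inX_sub uX wX; have TdX := inX_sub TuX TwX.
have small : energy (p \o (subX u w).1) (p \o (subX u w).2) <= d ^+ 2.
  apply: (le_trans (energy_part_le hp dX)).
  by rewrite ler_sqr ?nnegrE ?normX_ge0// ltW.
have Tsmall : energy (p \o (subX (T t u) (T t w)).1) (p \o (subX (T t u) (T t w)).2) <= d ^+ 2.
  apply: (le_trans (energy_part_le hp TdX)).
  rewrite ler_sqr ?nnegrE ?normX_ge0// ?(ltW d0)//; apply: le_trans uw.
  rewrite (eqX_normX _ _ (w := T t (subX u w)))//; first exact: (semigroup_contraction TA).
    exact: (semigroup_inX TA).
  by rewrite !subXE; apply: eqX_sym; exact: (semigroup_comb TA).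
have [Ld1 Ld2] := inX_part hp dX; have [LTd1 LTd2] := inX_part hp TdX.
have eqs (x y : R[i]) : p (x + -1 * y) = p x - p y by rewrite mulN1r partD// partN.
have step1 := negative_energy_perturb
  (L2_comb (a * expR (t * l)) s Lc0 LW1) (L2_comb (a * expR (t * l)) s Lq0 LW2)
  (L2_scale s LTd1) (L2_scale s LTd2).
rewrite (_ : (fun z => _) = (fun x => a * expR (t * l) * c0 x + s * p ((T t u).1 x))) in step1; last first.
  by apply/funext => x; rewrite /= eqs; ring.
rewrite [X in negative_energy _ X <= _](_ : _ = (fun x => a * expR (t * l) * q0 x + s * p ((T t u).2 x))) in step1; last first.
  by apply/funext => x; rewrite /= eqs; ring.
have step2 : negative_energy (fun x => a * expR (t * l) * c0 x + s * (p \o (T t w).1) x)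
    (fun x => a * expR (t * l) * q0 x + s * (p \o (T t w).2) x) <=
  negative_energy (fun x => a * c0 x + s * p (w.1 x)) (fun x => a * q0 x + s * p (w.2 x)).
  exact: (domain_comparison a s hp l0 g0 wX fX Awf t0).
have step3 := negative_energy_perturb
  (L2_comb a s Lc0 Lu1) (L2_comb a s Lq0 Lu2) (L2_scale (- s) Ld1) (L2_scale (- s) Ld2).
rewrite (_ : (fun z => _) = (fun x => a * c0 x + s * p (w.1 x))) in step3; last first.
  by apply/funext => x; rewrite /= eqs; ring.
rewrite [X in negative_energy _ X <= _](_ : _ = (fun x => a * q0 x + s * p (w.2 x))) in step3; last first.
  by apply/funext => x; rewrite /= eqs; ring.
have scale (b : R) (c q : R -> R) : L2 (-2) 2 c -> L2 (-2) 2 q ->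
    energy (fun z => b * c z) (fun z => b * q z) = b ^+ 2 * energy c q.
  move=> Lc Lq; rewrite /energy -RintegralZl//; last exact: energy_integrable.
  by apply: eq_Rintegral => x _; ring.
rewrite scale// in step1; rewrite scale// in step3.
rewrite sqrrN in step3.
have s2 := sqr_ge0 s.
have k1 := ler_wpM2l s2 small; have k2 := ler_wpM2l s2 Tsmall.
have k3 : s ^+ 2 * d ^+ 2 <= e / 8.
  rewrite d2 mulrA ler_pdivrMr//; nra.
move: step3; rewrite init0 => step3.
lra.
Qed.

End Domain.
End Comparison.

(** * The differential system of an eigenfunction *)

Section CoshSqrt.
Context {R : realType}.
Implicit Types (x z K : R) (c : nat -> R).

Lemma entire_pseries_cvg c K : 0 <= K -> (forall n, 0 <= c n <= n`!%:R^-1) ->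
  cvgn (pseries c K).
Proof.
move=> K0 hc; apply: (@series_le_cvg R _ (exp_coeff K)).
- by move=> n; have /andP[h _] := hc n; rewrite mulr_ge0// exprn_ge0.
- by move=> n; rewrite exp_coeff_ge0.
- move=> n; rewrite /exp_coeff /= mulrC ler_wpM2l ?exprn_ge0//.
  by have /andP[_ h] := hc n.
- exact: is_cvg_series_exp_coeff.
Qed.

Lemma pseries_cvg_norm c x : (forall n, 0 <= c n <= n`!%:R^-1) -> cvgn (pseries c x).
Proof.
move=> hc; apply: normed_cvg.
have := entire_pseries_cvg (normr_ge0 x) hc.
rewrite (_ : pseries c `|x| = [normed series (fun i => c i * x ^+ i)])//.
rewrite /pseries; congr series; apply/funext => i /=.
by have /andP[h _] := hc i; rewrite normrM normrX (ger0_norm h).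
Qed.

Definition cosh_coeff n : R := ((n.*2)`!%:R)^-1.
Definition sinh_coeff n : R := ((n.*2.+1)`!%:R)^-1.

(* cosh (sqrt z) and sinh (sqrt z) / sqrt z, as entire functions of z. *)
Definition cosh_sqrt z : R := limn (pseries cosh_coeff z).
Definition sinhc_sqrt z : R := limn (pseries sinh_coeff z).
Definition dsinhc_sqrt z : R := limn (pseries (pseries_diffs sinh_coeff) z).

Lemma diffs_cosh_coeff : pseries_diffs cosh_coeff = fun n => 2^-1 * sinh_coeff n.
Proof.
apply/funext => n; rewrite /pseries_diffs /cosh_coeff /sinh_coeff doubleS factS natrM.
rewrite invfM mulrA; congr (_ * _).
by rewrite -doubleS -mul2n natrM invfM mulrCA mulfV ?mulr1// pnatr_eq0.
Qed.

(** Domination by the exponential series, a class stable under formal differentiation; this supplies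
    every convergence that termwise differentiation asks for. *)
Definition subexponential c := forall n, 0 <= c n <= n`!%:R^-1.

Lemma subexponential_diffs c : subexponential c -> subexponential (pseries_diffs c).
Proof.
move=> hc n; have /andP[h1 h2] := hc n.+1; rewrite /pseries_diffs mulr_ge0//=.
apply: (le_trans (ler_wpM2l _ h2)) => //.
by rewrite factS natrM invfM mulrA mulfV ?mul1r// pnatr_eq0.
Qed.

Lemma fact_inv_le (m n : nat) : (n <= m)%N -> 0 <= (m`!%:R : R)^-1 <= n`!%:R^-1.
Proof.
move=> nm; rewrite invr_ge0 ler0n/= lef_pV2 ?posrE ?ltr0n ?fact_gt0//.
by rewrite ler_nat leq_fact.
Qed.

Lemma subexponential_cosh : subexponential cosh_coeff.
Proof. by move=> n; apply: fact_inv_le; rewrite -addnn leq_addr. Qed.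

Lemma subexponential_sinh : subexponential sinh_coeff.
Proof. by move=> n; apply: fact_inv_le; rewrite -addnn -addnS leq_addr. Qed.

Lemma is_derive_pseries c x : subexponential c ->
  is_derive x (1 : R) (fun y => limn (pseries c y)) (limn (pseries (pseries_diffs c) x)).
Proof.
move=> hc; apply: (@pseries_snd_diffs R c (`|x| + 1)).
- exact: pseries_cvg_norm.
- by apply: pseries_cvg_norm; exact: subexponential_diffs.
- by apply: pseries_cvg_norm; do 2 apply: subexponential_diffs.
- by rewrite [ltRHS]ger0_norm ?ltrDl// addr_ge0.
Qed.

Lemma is_derive_cosh_sqrt z : is_derive z (1 : R) cosh_sqrt (sinhc_sqrt z / 2).
Proof.
have := is_derive_pseries z subexponential_cosh; rewrite diffs_cosh_coeff.
rewrite (_ : limn _ = sinhc_sqrt z / 2)//.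
rewrite (_ : pseries _ z = (fun n => 2^-1 * pseries sinh_coeff z n)).
  rewrite limM ?lim_cst//; first by rewrite mulrC.
  - exact: cvg_cst.
  - exact: pseries_cvg_norm subexponential_sinh.
apply/funext => n; rewrite /pseries /series /= big_distrr /=.
by apply: eq_bigr => i _; rewrite mulrA.
Qed.

Lemma is_derive_sinhc_sqrt z : is_derive z (1 : R) sinhc_sqrt (dsinhc_sqrt z).
Proof. exact: is_derive_pseries subexponential_sinh. Qed.

(** With S and C for the two functions this is (y S(y^2))' = C(y^2) at z = y^2; on coefficients, (2
    i + 1) / (2 i + 1)! = 1 / (2 i)!. *)
Lemma sinhc_sqrt_ode z : sinhc_sqrt z + 2 * z * dsinhc_sqrt z = cosh_sqrt z.
Proof.
have c1 : pseries sinh_coeff z @ \oo --> sinhc_sqrt z.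
  exact: pseries_cvg_norm subexponential_sinh.
have c2 := @pseries_diffs_equiv R sinh_coeff z
  (pseries_cvg_norm (subexponential_diffs subexponential_sinh)).
have c3 : (fun n => pseries sinh_coeff z n + 2 * z *
    series (fun i => i%:R * sinh_coeff i * z ^+ i.-1) n) @ \oo -->
    sinhc_sqrt z + 2 * z * dsinhc_sqrt z.
  by apply: cvgD => //; apply: cvgM => //; exact: cvg_cst.
rewrite -(cvg_lim (@Rhausdorff R) c3) /cosh_sqrt; apply: (congr1 (fun f : nat -> R => limn f)).
apply/funext => n; rewrite /pseries /series /= big_distrr /= -big_split /=.
apply: eq_bigr => i _; rewrite (_ : cosh_coeff i = (i.*2.+1)%:R * sinh_coeff i); last first.
  rewrite /cosh_coeff /sinh_coeff factS natrM invfM mulrA mulfV ?mul1r//.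
have -> : (i.*2.+1)%:R = 1 + 2 * i%:R :> R by rewrite -addn1 natrD -muln2 natrM; ring.
case: i => [|i]; first by rewrite /= !mul0r mulr0 !addr0 mulr0 addr0 mul1r.
by rewrite /= exprS; ring.
Qed.

Lemma pseries_at0 c : limn (pseries c 0) = c 0%N.
Proof.
(* The partial sum of index 0 is empty; from index 1 on the sums are constant. *)
apply: (cvg_lim (@Rhausdorff R)); rewrite -(cvg_shiftS (pseries c 0)).
rewrite (_ : (fun n => pseries c 0 n.+1) = fun=> c 0%N); first exact: cvg_cst.
apply/funext => n; rewrite /pseries /series /= big_nat_recl//= expr0 mulr1 big1 ?addr0//.
by move=> i _; rewrite expr0n mulr0.
Qed.

Lemma cosh_sqrt0 : cosh_sqrt 0 = 1.
Proof. by rewrite /cosh_sqrt pseries_at0 /cosh_coeff /= fact0 invr1. Qed.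

Lemma derivable_continuous (f df : R -> R) :
  (forall x, is_derive x (1 : R) f (df x)) -> continuous f.
Proof.
by move=> d x; apply/differentiable_continuous/derivable1_diffP; have [] := d x.
Qed.

Lemma continuous_cosh_sqrt : continuous cosh_sqrt.
Proof. exact: derivable_continuous is_derive_cosh_sqrt. Qed.

Lemma continuous_sinhc_sqrt : continuous sinhc_sqrt.
Proof. exact: derivable_continuous is_derive_sinhc_sqrt. Qed.

Lemma is_derive_quadratic (f : R -> R) (D x d : R) :
  is_derive (D * x ^+ 2) (1 : R) f d ->
  is_derive x (1 : R) (fun y => f (D * y ^+ 2)) (d * (2 * D * x)).
Proof.
move=> df; have dg : is_derive x (1 : R) (fun y : R => D * y ^+ 2) (2 * D * x).
  by apply: is_derive_eq; rewrite /GRing.scale /=; ring.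
by have := @is_derive1_comp R f (fun y : R => D * y ^+ 2) x d (2 * D * x) df dg.
Qed.

End CoshSqrt.

(** * Explicit flow of the eigenvalue system on one interval *)

Section Flow.
Context {R : realType}.
Variables (k P : R).
Implicit Types (v l a b x : R).

(** The eigenvalue equation for [l] at velocity [v], solved for the derivatives. *)
Definition ode v l (c q : R -> R) := forall x : R,
  is_derive x (1 : R) c (- ((l + k * P ^+ 2) / v) * c x + k * P / v * q x) /\
  is_derive x (1 : R) q ((l + k) * q x - k * P * c x).

(* The matrix of the system is [h + B'] with [B'] traceless, and [B' ^+ 2 = D]
   is scalar: hence exp (x B') = cosh (x sqrt D) + sinh (x sqrt D) / sqrt D B'. *)
Definition half_trace v l := ((l + k) - (l + k * P ^+ 2) / v) / 2.
Definition half_gap v l := - ((l + k) + (l + k * P ^+ 2) / v) / 2.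
Definition discr v l := half_gap v l ^+ 2 - k ^+ 2 * P ^+ 2 / v.

(** Entire functions of [discr * x ^+ 2] avoid a case distinction on the sign of [discr], and make
    the flow jointly continuous in [l] and x. *)
Definition even_part v l x := cosh_sqrt (discr v l * x ^+ 2).
Definition odd_part v l x := x * sinhc_sqrt (discr v l * x ^+ 2).

Definition flow_c v l a b x := expR (half_trace v l * x) *
  (even_part v l x * a + odd_part v l x * (half_gap v l * a + k * P / v * b)).
Definition flow_q v l a b x := expR (half_trace v l * x) *
  (even_part v l x * b + odd_part v l x * (- (k * P) * a - half_gap v l * b)).

Lemma is_derive_even_part v l x :
  is_derive x (1 : R) (even_part v l) (discr v l * odd_part v l x).
Proof.
have := is_derive_quadratic (is_derive_cosh_sqrt (discr v l * x ^+ 2)).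
by congr is_derive; rewrite /odd_part; field.
Qed.

Lemma is_derive_odd_part v l x :
  is_derive x (1 : R) (odd_part v l) (even_part v l x).
Proof.
have d := is_derive_quadratic (is_derive_sinhc_sqrt (discr v l * x ^+ 2)).
rewrite /odd_part /even_part -sinhc_sqrt_ode.
by apply: is_derive_eq; rewrite /GRing.scale /=; ring.
Qed.

Lemma is_derive_expR_lin (h x : R) :
  is_derive x (1 : R) (fun y => expR (h * y)) (h * expR (h * x)).
Proof.
have dg : is_derive x (1 : R) (fun y : R => h * y) h.
  by apply: is_derive_eq; rewrite /GRing.scale /=; ring.
have := @is_derive1_comp R expR (fun y : R => h * y) x _ h (is_derive_expR (h * x)) dg.
by rewrite mulrC.
Qed.

Lemma flow_ode v l a b : 0 < v -> ode v l (flow_c v l a b) (flow_q v l a b).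
Proof.
move=> v0 x; have v_neq0 : v != 0 by rewrite gt_eqF.
have de := is_derive_even_part v l x; have do_ := is_derive_odd_part v l x.
split; rewrite /flow_c /flow_q.
  apply: is_derive_eq; rewrite /GRing.scale /= /discr /half_trace /half_gap.
  by field.
apply: is_derive_eq; rewrite /GRing.scale /= /discr /half_trace /half_gap.
by field.
Qed.

Lemma flow0 v l a b : flow_c v l a b 0 = a /\ flow_q v l a b 0 = b.
Proof.
rewrite /flow_c /flow_q /even_part /odd_part !mulr0 expR0 !expr0n /= !mulr0.
by rewrite cosh_sqrt0; split; ring.
Qed.

Lemma flow_linear v l a b a' b' (r : R) x :
  flow_c v l (a + r * a') (b + r * b') x = flow_c v l a b x + r * flow_c v l a' b' x /\
  flow_q v l (a + r * a') (b + r * b') x = flow_q v l a b x + r * flow_q v l a' b' x.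
Proof. by rewrite /flow_c /flow_q; split; ring. Qed.

Section Continuity.
Context {T : topologicalType}.
Implicit Types (f g : T -> R).

Lemma continuous_addf f g : continuous f -> continuous g -> continuous (fun z => f z + g z).
Proof. by move=> cf cg z; apply: cvgD; [exact: cf|exact: cg]. Qed.

Lemma continuous_mulf f g : continuous f -> continuous g -> continuous (fun z => f z * g z).
Proof. by move=> cf cg z; apply: cvgM; [exact: cf|exact: cg]. Qed.

Lemma continuous_oppf f : continuous f -> continuous (fun z => - f z).
Proof. by move=> cf z; apply: cvgN; exact: cf. Qed.

Lemma continuous_cstf (y : R) : continuous (fun _ : T => y).
Proof. by move=> z; exact: cvg_cst. Qed.

Lemma continuous_compf (h : R -> R) f : continuous h -> continuous f ->
  continuous (fun z => h (f z)).
Proof. by move=> ch cf z; apply: continuous_comp; [exact: cf|exact: ch]. Qed.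

Lemma continuous_flow v (L A B X : T -> R) :
  continuous L -> continuous A -> continuous B -> continuous X ->
  continuous (fun z => flow_c v (L z) (A z) (B z) (X z)) /\
  continuous (fun z => flow_q v (L z) (A z) (B z) (X z)).
Proof.
move=> cL cA cB cX.
have cE := @continuous_expR R.
have cst y : continuous (fun _ : T => y : R) by exact: continuous_cstf.
have cl : continuous (fun z => L z + k) by exact: continuous_addf.
have cm : continuous (fun z => (L z + k * P ^+ 2) / v).
  by apply: continuous_mulf => //; exact: continuous_addf.
have cg : continuous (fun z => half_gap v (L z)).
  by apply: continuous_mulf => //; apply: continuous_oppf; exact: continuous_addf.
have ch : continuous (fun z => half_trace v (L z)).
  by apply: continuous_mulf => //; apply: continuous_addf => //; exact: continuous_oppf.
have cd : continuous (fun z => discr v (L z) * X z ^+ 2).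
  apply: continuous_mulf.
    rewrite /discr; apply: continuous_addf; last exact: continuous_cstf.
    by apply: (continuous_compf (h := fun y => y ^+ 2)) => //; exact: exprn_continuous.
  by apply: (continuous_compf (h := fun y => y ^+ 2)) => //; exact: exprn_continuous.
have ce : continuous (fun z => even_part v (L z) (X z)).
  by apply: (continuous_compf (h := cosh_sqrt)) => //; exact: continuous_cosh_sqrt.
have co : continuous (fun z => odd_part v (L z) (X z)).
  apply: continuous_mulf => //.
  by apply: (continuous_compf (h := sinhc_sqrt)) => //; exact: continuous_sinhc_sqrt.
have cx : continuous (fun z => expR (half_trace v (L z) * X z)).
  by apply: (continuous_compf (h := expR)) => //; exact: continuous_mulf.
split; apply: continuous_mulf => //.
  apply: continuous_addf; first exact: (continuous_mulf ce cA).
  apply: (continuous_mulf co); apply: continuous_addf; first exact: (continuous_mulf cg cA).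
  exact: (continuous_mulf (cst _) cB).
apply: continuous_addf; first exact: (continuous_mulf ce cB).
apply: (continuous_mulf co); apply: continuous_addf; first exact: (continuous_mulf (cst _) cA).
by apply: continuous_oppf; exact: (continuous_mulf cg cB).
Qed.

End Continuity.
End Flow.

(** * Existence of a positive eigenfunction *)

Section Growth.
Context {R : realType}.
Implicit Types (f g : R -> R) (m s t x : R).

Lemma expR_cancel m s t : expR (m * t) * expR (- m * s) = expR (m * (t - s)).
Proof. by rewrite -expRD; congr expR; ring. Qed.

(** Integrating factor: [expR (- m * x) * f x] has the nonnegative derivative
    [expR (- m * x) * g x]. *)
Lemma growth_le f g m s t : s <= t ->
  (forall x : R, is_derive x (1 : R) f (m * f x + g x)) ->
  (forall x, s <= x <= t -> 0 <= g x) -> expR (m * (t - s)) * f s <= f t.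
Proof.
move=> + df g0; rewrite le_eqVlt => /orP[/eqP <-|st].
  by rewrite subrr mulr0 expR0 mul1r.
pose F x := expR (- m * x) * f x.
have dF x : is_derive x (1 : R) F (expR (- m * x) * g x).
  by apply: is_derive_eq; rewrite /GRing.scale /=; ring.
have [x xst e] := MVT st (fun x _ => dF x) (continuous_subspaceT (derivable_continuous dF)).
have : F s <= F t.
  rewrite -subr_ge0 e mulr_ge0 ?subr_ge0 ?(ltW st)// mulr_ge0 ?expR_ge0// g0//.
  by move: xst; rewrite in_itv/= => /andP[/ltW -> /ltW ->].
rewrite /F -(ler_pM2l (expR_gt0 (m * t))) !mulrA !expR_cancel.
by rewrite subrr mulr0 expR0 mul1r.
Qed.

Lemma growth_lt f g m s t : s < t ->
  (forall x : R, is_derive x (1 : R) f (m * f x + g x)) ->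
  (forall x, s < x < t -> 0 < g x) -> expR (m * (t - s)) * f s < f t.
Proof.
move=> st df g0.
pose F x := expR (- m * x) * f x.
have dF x : is_derive x (1 : R) F (expR (- m * x) * g x).
  by apply: is_derive_eq; rewrite /GRing.scale /=; ring.
have [x xst e] := MVT st (fun x _ => dF x) (continuous_subspaceT (derivable_continuous dF)).
have : F s < F t.
  rewrite -subr_gt0 e; apply: mulr_gt0; last by rewrite subr_gt0.
  by apply: mulr_gt0; [exact: expR_gt0|apply: g0; move: xst; rewrite in_itv].
rewrite /F -(ltr_pM2l (expR_gt0 (m * t))) !mulrA !expR_cancel.
by rewrite subrr mulr0 expR0 mul1r.
Qed.

End Growth.

(** * Signs and Wronskians on one interval *)

Section Stage.
Context {R : realType}.
Variables (k P v l : R).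
Hypotheses (k_gt0 : 0 < k) (P_gt0 : 0 < P) (v_gt0 : 0 < v).
Implicit Types (c q : R -> R).

Lemma stage_c_ge0 c q x : ode k P v l c q -> 0 <= c 0 -> 0 <= x <= 1 ->
  (forall y, 0 <= y <= 1 -> 0 <= q y) -> 0 <= c x.
Proof.
move=> o c0 /andP[x0 x1] q0.
have := growth_le x0 (fun y => (o y).1) _.
have h : forall y, 0 <= y <= x -> 0 <= k * P / v * q y.
  move=> y /andP[y0 yx]; apply: mulr_ge0; first by rewrite ltW// divr_gt0// mulr_gt0.
  by apply: q0; rewrite y0 (le_trans yx x1).
by move=> /(_ h); apply: le_trans; rewrite mulr_ge0 ?expR_ge0.
Qed.

Lemma stage_c_gt0 c q x : ode k P v l c q -> 0 < c 0 -> 0 <= x <= 1 ->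
  (forall y, 0 <= y <= 1 -> 0 <= q y) -> 0 < c x.
Proof.
move=> o c0 /andP[x0 x1] q0.
have := growth_le x0 (fun y => (o y).1) _.
have h : forall y, 0 <= y <= x -> 0 <= k * P / v * q y.
  move=> y /andP[y0 yx]; apply: mulr_ge0; first by rewrite ltW// divr_gt0// mulr_gt0.
  by apply: q0; rewrite y0 (le_trans yx x1).
by move=> /(_ h); apply: lt_le_trans; rewrite mulr_gt0 ?expR_gt0.
Qed.

Lemma stage_c_gt0_right c q x : ode k P v l c q -> 0 <= c 0 -> 0 < x <= 1 ->
  (forall y, 0 <= y <= 1 -> 0 < q y) -> 0 < c x.
Proof.
move=> o c0 /andP[x0 x1] q0.
have := growth_lt x0 (fun y => (o y).1) _.
have h : forall y, 0 < y < x -> 0 < k * P / v * q y.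
  move=> y /andP[y0 yx]; rewrite mulr_gt0 ?divr_gt0 ?mulr_gt0// q0// ltW//=.
  exact: le_trans (ltW yx) x1.
by move=> /(_ h); apply: le_lt_trans; rewrite mulr_ge0 ?expR_ge0.
Qed.

Lemma stage_q_le c q x y : ode k P v l c q -> 0 <= x -> x <= y -> y <= 1 ->
  (forall z, 0 <= z <= 1 -> 0 <= c z) -> q y <= expR ((l + k) * (y - x)) * q x.
Proof.
move=> o x0 xy y1 c0.
have d (z : R) : is_derive z (1 : R) (fun z => - q z) ((l + k) * (- q z) + k * P * c z).
  have [_ dq] := o z; apply: is_derive_eq; ring.
have := growth_le xy d _.
have h : forall z, x <= z <= y -> 0 <= k * P * c z.
  move=> z /andP[xz zy]; apply: mulr_ge0; first by rewrite ltW// mulr_gt0.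
  by apply: c0; rewrite (le_trans x0 xz) (le_trans zy y1).
by move=> /(_ h); rewrite mulrN lerN2.
Qed.

Definition wronskian (c q c1 q1 : R -> R) (x : R) := c x * q1 x - c1 x * q x.

(** Liouville's formula: the Wronskian is multiplied by the exponential of the trace [m] of the
    system. *)
Lemma stage_wronskian c q c1 q1 x : ode k P v l c q -> ode k P v l c1 q1 ->
  0 < wronskian c q c1 q1 0 -> 0 <= x -> 0 < wronskian c q c1 q1 x.
Proof.
move=> o o1 w0 x0.
pose m := (l + k) - (l + k * P ^+ 2) / v.
have d (y : R) : is_derive y (1 : R) (wronskian c q c1 q1) (m * wronskian c q c1 q1 y + 0).
  have [dc dq] := o y; have [dc1 dq1] := o1 y.
  apply: is_derive_eq; rewrite /wronskian /m /GRing.scale /=; ring.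
have := growth_le x0 d _ => /(_ (fun _ _ => lexx 0)).
by apply: lt_le_trans; rewrite mulr_gt0// expR_gt0.
Qed.

(** The derivative of [q / q1] is - k P times the Wronskian over [q1 ^+ 2]: the terms in l + k
    cancel. *)
Lemma stage_ratio c q c1 q1 x y : ode k P v l c q -> ode k P v l c1 q1 ->
  0 < wronskian c q c1 q1 0 -> (forall z, 0 <= z <= 1 -> 0 < q1 z) ->
  0 <= x -> x < y -> y <= 1 -> q y / q1 y < q x / q1 x.
Proof.
move=> o o1 w0 q10 x0 xy y1.
have mvt : exists2 z, z \in `]x, y[ & q y / q1 y - q x / q1 x =
    (- (k * P) * wronskian c q c1 q1 z / q1 z ^+ 2) * (y - x).
  apply: (@MVT R (fun z => q z / q1 z)
    (fun z => - (k * P) * wronskian c q c1 q1 z / q1 z ^+ 2)) => //.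
    move=> z; rewrite in_itv/= => /andP[xz zy].
    have q1z : q1 z != 0.
      by rewrite gt_eqF// q10// (le_trans x0 (ltW xz)) (le_trans (ltW zy)).
    have [_ dq] := o z; have [_ dq1] := o1 z.
    have dv := is_deriveV q1z dq1.
    have dd := is_deriveM dq dv.
    apply: is_derive_eq dd _; rewrite /wronskian /GRing.scale /= ; field.
    exact: q1z.
  have cq : continuous q by apply: derivable_continuous => z; exact: (o z).2.
  have cq1 : continuous q1 by apply: derivable_continuous => z; exact: (o1 z).2.
  apply/subspace_continuousP => z; rewrite /= in_itv/= => /andP[xz zy].
  apply: cvg_within_filter; apply: cvgM; first exact: cq.
  apply: cvgV; last exact: cq1.
  by rewrite gt_eqF// q10// (le_trans x0 xz) (le_trans zy).
have [z] := mvt; rewrite in_itv/= => /andP[xz zy] e.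
rewrite -subr_lt0 e pmulr_llt0 ?subr_gt0// mulNr -mulrA mulNr oppr_lt0.
have z0 : 0 <= z by rewrite (le_trans x0 (ltW xz)).
apply: divr_gt0; last by rewrite exprn_gt0// q10// z0 (le_trans (ltW zy)).
by apply: mulr_gt0 => //; apply: mulr_gt0 => //; exact: (stage_wronskian o o1).
Qed.

End Stage.

(** * Monodromy over one period *)

Section Monodromy.
Context {R : realType}.
Variables (k P v1 v2 v3 v4 : R).
Hypotheses (k_gt0 : 0 < k) (P_gt0 : 0 < P).
Hypotheses (v1_gt0 : 0 < v1) (v2_gt0 : 0 < v2) (v3_gt0 : 0 < v3) (v4_gt0 : 0 < v4).
Implicit Types (l a b x : R) (n : nat).

(* Stages are numbered from 0; at the end of stage n, the component c is
   multiplied by [jump n]. *)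
Definition speed n : R := nth v4 [:: v1; v2; v3] n.
Definition jump n : R := nth (v4 / v1) [:: 1; v2 / v3; 1] n.

(** The values of (c, q) at the start of stage n, after the jump; index 4 is the state after a full
    period, so it is linear in (a, b) with matrix the monodromy. *)
Fixpoint entry l a b n : R * R :=
  if n is n'.+1 then
    let y := entry l a b n' in
    (jump n' * flow_c k P (speed n') l y.1 y.2 1, flow_q k P (speed n') l y.1 y.2 1)
  else (a, b).

Definition stage_c l a b n x :=
  flow_c k P (speed n) l (entry l a b n).1 (entry l a b n).2 x.
Definition stage_q l a b n x :=
  flow_q k P (speed n) l (entry l a b n).1 (entry l a b n).2 x.

(** The default of [nth] is the value for the last stage, so positivity holds for every index, here
    and in [jump_gt0]. *)
Lemma speed_gt0 n : 0 < speed n.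
Proof. by case: n => [|[|[|n]]] //=; rewrite /speed nth_default. Qed.

Lemma jump_gt0 n : 0 < jump n.
Proof.
rewrite /jump; case: n => [|[|[|n]]] //=; rewrite ?divr_gt0//.
by rewrite nth_default// divr_gt0.
Qed.

Lemma stage_ode l a b n : ode k P (speed n) l (stage_c l a b n) (stage_q l a b n).
Proof. exact/flow_ode/speed_gt0. Qed.

Lemma stage0 l a b n :
  stage_c l a b n 0 = (entry l a b n).1 /\ stage_q l a b n 0 = (entry l a b n).2.
Proof. exact: flow0. Qed.

Lemma entryS l a b n :
  entry l a b n.+1 = (jump n * stage_c l a b n 1, stage_q l a b n 1).
Proof. by []. Qed.

Lemma entry_linear l (r : R) n :
  (entry l 1 r n).1 = (entry l 1 0 n).1 + r * (entry l 0 1 n).1 /\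
  (entry l 1 r n).2 = (entry l 1 0 n).2 + r * (entry l 0 1 n).2.
Proof.
elim: n => [|n [e1 e2]]; first by rewrite /=; split; ring.
rewrite !entryS /stage_c /stage_q /= e1 e2.
have [-> ->] := flow_linear k P (speed n) l (entry l 1 0 n).1 (entry l 1 0 n).2
  (entry l 0 1 n).1 (entry l 0 1 n).2 r 1.
by split => //; ring.
Qed.

Definition q_positive l a b := forall n x, (n < 4)%N -> 0 <= x <= 1 -> 0 < stage_q l a b n x.

Definition mono11 l := (entry l 1 0 4).1.
Definition mono12 l := (entry l 0 1 4).1.
Definition mono21 l := (entry l 1 0 4).2.
Definition mono22 l := (entry l 0 1 4).2.
Definition char_det l := (mono11 l - 1) * (mono22 l - 1) - mono12 l * mono21 l.

Lemma c_nonneg l a b : 0 <= a -> (forall n x, (n < 4)%N -> 0 <= x <= 1 -> 0 <= stage_q l a b n x) ->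
  forall n, (n < 4)%N -> 0 <= (entry l a b n).1 /\
    forall x, 0 <= x <= 1 -> 0 <= stage_c l a b n x.
Proof.
move=> a0 q0; elim=> [|n ih] n4.
  split => // x x01; apply: (stage_c_ge0 k_gt0 P_gt0 (speed_gt0 0) (stage_ode l a b 0)) => //.
    by rewrite (stage0 l a b 0).1.
  by move=> y y01; exact: q0.
have [e0 c0] := ih (ltnW n4).
have e1 : 0 <= (entry l a b n.+1).1.
  by rewrite entryS mulr_ge0 ?(ltW (jump_gt0 n))// c0// ler01 lexx.
split => // x x01.
apply: (stage_c_ge0 k_gt0 P_gt0 (speed_gt0 n.+1) (stage_ode l a b n.+1)) => //.
  by rewrite (stage0 l a b n.+1).1.
by move=> y y01; exact: q0.
Qed.

Lemma c_positive l a b : 0 < a -> q_positive l a b ->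
  forall n, (n < 4)%N -> 0 < (entry l a b n).1 /\
    forall x, 0 <= x <= 1 -> 0 < stage_c l a b n x.
Proof.
move=> a0 q0; elim=> [|n ih] n4.
  split => // x x01; apply: (stage_c_gt0 k_gt0 P_gt0 (speed_gt0 0) (stage_ode l a b 0)) => //.
    by rewrite (stage0 l a b 0).1.
  by move=> y y01; apply: ltW; exact: q0.
have [e0 c0] := ih (ltnW n4).
have e1 : 0 < (entry l a b n.+1).1.
  by rewrite entryS mulr_gt0 ?jump_gt0// c0// ler01 lexx.
split => // x x01.
apply: (stage_c_gt0 k_gt0 P_gt0 (speed_gt0 n.+1) (stage_ode l a b n.+1)) => //.
  by rewrite (stage0 l a b n.+1).1.
by move=> y y01; apply: ltW; exact: q0.
Qed.

Lemma q_positiveW l a b : q_positive l a b ->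
  forall n x, (n < 4)%N -> 0 <= x <= 1 -> 0 <= stage_q l a b n x.
Proof. by move=> q0 n x n4 x01; apply: ltW; exact: q0. Qed.

Lemma mono12_gt0 l : q_positive l 0 1 -> 0 < mono12 l.
Proof.
move=> q0; have cn := c_nonneg (lexx 0) (q_positiveW q0).
have [e3 _] := cn 3%N isT.
rewrite /mono12 entryS mulr_gt0 ?jump_gt0//.
apply: (stage_c_gt0_right k_gt0 P_gt0 (speed_gt0 3) (stage_ode l 0 1 3)).
- by rewrite (stage0 l 0 1 3).1.
- by rewrite ltr01 lexx.
- by move=> y y01; exact: q0.
Qed.

(** A jump only multiplies the Wronskian by the positive factor [jump n]. *)
Lemma entry_wronskian l a b : q_positive l 0 1 -> 0 < a -> forall n, (n <= 4)%N ->
  0 < (entry l a b n).1 * (entry l 0 1 n).2 - (entry l 0 1 n).1 * (entry l a b n).2.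
Proof.
move=> q0 a0; elim=> [|n ih] n4; first by rewrite /= mulr1 mul0r subr0.
have := stage_wronskian (stage_ode l a b n) (stage_ode l 0 1 n) _ ler01.
rewrite /wronskian !(stage0 _ _ _ n).1 !(stage0 _ _ _ n).2 => /(_ (ih (ltnW n4))).
move=> h; rewrite (_ : _ - _ = jump n * (stage_c l a b n 1 * stage_q l 0 1 n 1 -
  stage_c l 0 1 n 1 * stage_q l a b n 1)); last by rewrite !entryS /=; ring.
exact: (mulr_gt0 (jump_gt0 n) h).
Qed.

Lemma stage_ratio_lt l a b n x y : q_positive l 0 1 -> 0 < a -> (n < 4)%N ->
  0 <= x -> x < y -> y <= 1 ->
  stage_q l a b n y / stage_q l 0 1 n y < stage_q l a b n x / stage_q l 0 1 n x.
Proof.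
move=> q0 a0 n4 x0 xy y1.
apply: (stage_ratio k_gt0 P_gt0 (stage_ode l a b n) (stage_ode l 0 1 n)) => //.
  rewrite /wronskian !(stage0 _ _ _ n).1 !(stage0 _ _ _ n).2.
  by apply: entry_wronskian => //; exact: ltnW.
by move=> z z01; exact: q0.
Qed.

Lemma entry_ratio_lt l a b n : q_positive l 0 1 -> 0 < a -> (n < 4)%N ->
  (entry l a b n.+1).2 / (entry l 0 1 n.+1).2 < (entry l a b n).2 / (entry l 0 1 n).2.
Proof.
move=> q0 a0 n4; rewrite -!(stage0 _ _ _ n).2 !entryS /=.
exact: stage_ratio_lt.
Qed.

(** The ratio of second components of the solutions from (1, 0) and (0, 1) starts at 0, strictly
    decreases on each stage, and does not see the jumps. *)
Lemma mono21_lt0 l : q_positive l 0 1 -> mono21 l < 0.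
Proof.
move=> q0; have q4 : 0 < (entry l 0 1 4).2 by rewrite entryS q0// ler01 lexx.
have r n := entry_ratio_lt (n := n) 0 q0 ltr01.
have := lt_trans (r 3%N isT) (lt_trans (r 2%N isT) (lt_trans (r 1%N isT) (r 0%N isT))).
by rewrite [X in _ < X]/= mul0r pmulr_llt0// invr_gt0.
Qed.

(* The ratio of the second components of the solutions from (a, b) and (0, 1)
   decreases along the whole period. *)
Lemma q_positive_transfer l a b : q_positive l 0 1 -> 0 < a ->
  0 < (entry l a b 4).2 -> q_positive l a b.
Proof.
move=> q0 a0 e4 n x n4 /andP[x0 x1].
have q4 : 0 < (entry l 0 1 4).2 by rewrite entryS q0// ler01 lexx.
have r m := entry_ratio_lt (n := m) b q0 a0.
have last_gt0 m : (m <= 4)%N -> 0 < (entry l a b m).2 / (entry l 0 1 m).2.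
  have r4 : 0 < (entry l a b 4).2 / (entry l 0 1 4).2 by exact: divr_gt0.
  have r3 := lt_trans r4 (r 3%N isT); have r2 := lt_trans r3 (r 2%N isT).
  have r1 := lt_trans r2 (r 1%N isT); have r0 := lt_trans r1 (r 0%N isT).
  by move: m => [|[|[|[|[|m]]]]].
have qx : 0 < stage_q l 0 1 n x by apply: q0 => //; rewrite x0.
suff : 0 < stage_q l a b n x / stage_q l 0 1 n x by rewrite pmulr_lgt0 ?invr_gt0.
have e1 := last_gt0 n.+1 n4; rewrite !entryS /= in e1.
move: x1; rewrite le_eqVlt => /orP[/eqP ->//|x1].
exact: (lt_trans e1 (stage_ratio_lt b q0 a0 n4 x0 x1 (lexx 1))).
Qed.

(** At l = - k the second equation is [q' = - k P c], and [c >= 0]. This makes - k a parameter where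
    the good properties fail. *)
Lemma mono22_decay : q_positive (- k) 0 1 -> mono22 (- k) <= 1.
Proof.
move=> q0; have cn := c_nonneg (lexx 0) (q_positiveW q0).
have step n : (n < 4)%N -> (entry (- k) 0 1 n.+1).2 <= (entry (- k) 0 1 n).2.
  move=> n4; rewrite -(stage0 _ _ _ n).2 entryS /=.
  have := stage_q_le k_gt0 P_gt0 (stage_ode (- k) 0 1 n) (lexx 0) ler01 (lexx 1) (cn n n4).2.
  by rewrite addNr mul0r expR0 mul1r.
exact: (le_trans (step 3%N isT) (le_trans (step 2%N isT) (le_trans (step 1%N isT) (step 0%N isT)))).
Qed.

(* If c >= 0, then expR (- (l + k) x) q decreases, so that positivity of q at the
   end of the period propagates backwards. *)
Lemma q_positive_of_c l b : (forall n x, (n < 4)%N -> 0 <= x <= 1 -> 0 <= stage_c l 0 b n x) ->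
  0 < (entry l 0 b 4).2 -> q_positive l 0 b.
Proof.
move=> c0 e4.
have back n x : (n < 4)%N -> 0 <= x <= 1 -> 0 < (entry l 0 b n.+1).2 -> 0 < stage_q l 0 b n x.
  move=> n4 /andP[x0 x1]; rewrite entryS /= => h.
  have := stage_q_le k_gt0 P_gt0 (stage_ode l 0 b n) x0 x1 (lexx 1) (fun z => c0 n z n4).
  by move=> /(lt_le_trans h); rewrite pmulr_rgt0// expR_gt0.
have e n : (n < 4)%N -> 0 < (entry l 0 b n.+1).2 -> 0 < (entry l 0 b n).2.
  by move=> n4 h; rewrite -(stage0 _ _ _ n).2; apply: back => //; rewrite lexx ler01.
have e3 := e 3%N isT e4; have e2 := e 2%N isT e3; have e1 := e 1%N isT e2.
by move=> [|[|[|[|n]]]] x //= n4 x01; exact: back.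
Qed.

Section AtZero.
Hypotheses (v23 : v2 <= v3) (v41 : v4 <= v1).

Lemma jump_le1 n : jump n <= 1.
Proof.
by rewrite /jump; case: n => [|[|[|n]]] //=; rewrite ?nth_default ?ler_pdivrMr ?mul1r.
Qed.

(** At l = 0 the quantity w = q - P c solves a scalar linear equation, so it stays positive, and
    [c'] and [q'] are positive multiples of it. The jumps are at most 1: they lower [c] and can only
    raise w. *)
Lemma zero_invariant n : 0 <= (entry 0 0 1 n).1 /\ 0 < (entry 0 0 1 n).2 - P * (entry 0 0 1 n).1 /\
  1 <= (entry 0 0 1 n).2 /\ ((0 < n)%N -> 1 < (entry 0 0 1 n).2) /\
  forall x, 0 <= x <= 1 -> 1 <= stage_q 0 0 1 n x.
Proof.
have stage m : 0 <= (entry 0 0 1 m).1 -> 0 < (entry 0 0 1 m).2 - P * (entry 0 0 1 m).1 ->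
    forall x, 0 <= x <= 1 -> (entry 0 0 1 m).1 <= stage_c 0 0 1 m x /\
      0 < stage_q 0 0 1 m x - P * stage_c 0 0 1 m x /\
      (entry 0 0 1 m).2 <= stage_q 0 0 1 m x /\ (0 < x -> (entry 0 0 1 m).2 < stage_q 0 0 1 m x).
  move=> c0 w0.
  pose w x := stage_q 0 0 1 m x - P * stage_c 0 0 1 m x.
  have o := stage_ode 0 0 1 m; have s0 := speed_gt0 m.
  have dw (x : R) : is_derive x (1 : R) w ((k - k * P ^+ 2 / speed m) * w x + 0).
    have [dc dq] := o x; apply: is_derive_eq; rewrite /w /GRing.scale /=.
    by field; rewrite gt_eqF.
  have wpos x : 0 <= x -> 0 < w x.
    move=> x0; have := growth_le x0 dw (fun _ _ => lexx 0).
    by apply: lt_le_trans; rewrite mulr_gt0 ?expR_gt0// /w (stage0 _ _ _ m).1 (stage0 _ _ _ m).2.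
  have dc (x : R) : is_derive x (1 : R) (stage_c 0 0 1 m) (0 * stage_c 0 0 1 m x + k * P / speed m * w x).
    have [d _] := o x; apply: is_derive_eq; rewrite /w; field; by rewrite gt_eqF.
  have dq (x : R) : is_derive x (1 : R) (stage_q 0 0 1 m) (0 * stage_q 0 0 1 m x + k * w x).
    have [_ d] := o x; apply: is_derive_eq; rewrite /w; ring.
  move=> x /andP[x0 x1]; split.
    have := growth_le x0 dc _; rewrite mul0r expR0 mul1r (stage0 _ _ _ m).1; apply.
    move=> y /andP[y0 _]; apply: mulr_ge0; last exact/ltW/wpos.
    by rewrite ltW// divr_gt0// mulr_gt0.
  split; first exact: wpos.
  split.
    have := growth_le x0 dq _; rewrite mul0r expR0 mul1r (stage0 _ _ _ m).2; apply.
    by move=> y /andP[y0 _]; apply: mulr_ge0; [exact: ltW|apply: ltW; exact: wpos].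
  move=> xp; have := growth_lt xp dq _; rewrite mul0r expR0 mul1r (stage0 _ _ _ m).2; apply.
  by move=> y /andP[y0 _]; apply: mulr_gt0 => //; apply: wpos; exact: ltW.
have i01 : 0 <= (1 : R) <= 1 by rewrite ler01 lexx.
elim: n => [|n [c0 [w0 [q1 [_ _]]]]].
  have w0 : 0 < (entry 0 0 1 0).2 - P * (entry 0 0 1 0).1 by rewrite /= mulr0 subr0.
  split => //; split => //; split => //; split => // x x01.
  by have [_ [_ [h _]]] := stage 0%N (lexx _) w0 x x01.
have [h1 [h2 [h3 h4]]] := stage n c0 w0 1 i01.
have c1 : 0 <= (entry 0 0 1 n.+1).1.
  by rewrite entryS mulr_ge0 ?(ltW (jump_gt0 n))// (le_trans c0 h1).
have w1 : 0 < (entry 0 0 1 n.+1).2 - P * (entry 0 0 1 n.+1).1.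
  rewrite entryS; apply: (lt_le_trans h2); rewrite lerD2l lerN2.
  apply: ler_wpM2l; first exact: ltW.
  by rewrite /= ler_piMl ?jump_le1// (le_trans c0 h1).
have q2 : 1 < (entry 0 0 1 n.+1).2 by rewrite entryS; exact: (le_lt_trans q1 (h4 ltr01)).
split => //; split => //; split; first exact: ltW.
split => // x x01; have [_ [_ [h _]]] := stage n.+1 c1 w1 x x01.
exact: (le_trans (ltW q2) h).
Qed.

Lemma zero_q_positive : q_positive 0 0 1.
Proof.
move=> n x n4 x01; have [_ [_ [_ [_ h]]]] := zero_invariant n.
exact: (lt_le_trans ltr01 (h x x01)).
Qed.

Lemma zero_mono22 : 1 < mono22 0.
Proof. by have [_ [_ [_ [h _]]]] := zero_invariant 4; exact: h. Qed.

End AtZero.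

(** The number r solves the second row of (M - 1) (1, r) = 0; eliminating it from the first row
    leaves the determinant over [mono22 l - 1]. *)
Lemma closing_solution l (r := - mono21 l / (mono22 l - 1)) :
  q_positive l 0 1 -> 1 < mono22 l ->
  [/\ 0 < r, q_positive l 1 r, (entry l 1 r 4).2 = r &
      (entry l 1 r 4).1 = 1 + char_det l / (mono22 l - 1)].
Proof.
move=> q0 m22; have m0 : 0 < mono22 l - 1 by rewrite subr_gt0.
have r0 : 0 < r by rewrite divr_gt0// oppr_gt0 mono21_lt0.
have [e1 e2] := entry_linear l r 4.
have e2' : (entry l 1 r 4).2 = r.
  by rewrite e2 -/(mono21 l) -/(mono22 l) /r; field; rewrite gt_eqF.
split => //; first by apply: q_positive_transfer => //; rewrite e2'.
rewrite e1 -/(mono11 l) -/(mono12 l) /r /char_det; field; by rewrite gt_eqF.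
Qed.

(** At l = 0 the net flux [v c - P q] is conserved on each stage and across the jumps, but it
    decreases at -1 and 1, where the velocity drops at constant [c]; strictly at -1. The solution
    that closes in [q] therefore returns with first component below 1, which is the sign of the
    determinant. *)
Lemma zero_char_det : v2 < v1 -> v2 <= v3 -> v4 <= v3 -> v4 <= v1 -> char_det 0 < 0.
Proof.
move=> v21 v23 v43 v41.
have m22 := zero_mono22 v23 v41.
have [r0 qp e2 e1] := closing_solution (zero_q_positive v23 v41) m22.
set r := - mono21 0 / (mono22 0 - 1) in r0 qp e2 e1.
have cp n (n4 : (n < 4)%N) := (c_positive ltr01 qp n4).2.
have i01 : 0 <= (1 : R) <= 1 by rewrite ler01 lexx.
have flux n : speed n * stage_c 0 1 r n 1 - P * stage_q 0 1 r n 1 =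
    speed n * (entry 0 1 r n).1 - P * (entry 0 1 r n).2.
  have s0 := speed_gt0 n.
  have d (x : R) : is_derive x (1 : R) (fun x => speed n * stage_c 0 1 r n x - P * stage_q 0 1 r n x)
      (0 * (speed n * stage_c 0 1 r n x - P * stage_q 0 1 r n x) + 0).
    have [dc dq] := stage_ode 0 1 r n x; apply: is_derive_eq; rewrite /GRing.scale /=.
    by field; rewrite gt_eqF.
  (* Constancy follows from [growth_le] for the quantity and for its opposite. *)
  have dN (x : R) : is_derive x (1 : R) (fun x => - (speed n * stage_c 0 1 r n x - P * stage_q 0 1 r n x))
      (0 * (- (speed n * stage_c 0 1 r n x - P * stage_q 0 1 r n x)) + 0).
    by have dd := d x; apply: is_derive_eq; ring.
  have := growth_le ler01 d (fun _ _ => lexx 0); have := growth_le ler01 dN (fun _ _ => lexx 0).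
  rewrite mul0r expR0 !mul1r (stage0 _ _ _ n).1 (stage0 _ _ _ n).2 lerN2 => h1 h2.
  by apply/eqP; rewrite eq_le h1 h2.
have f0 := flux 0%N; have f1 := flux 1%N; have f2 := flux 2%N; have f3 := flux 3%N.
have c0 := cp 0%N isT 1 i01; have c2 := cp 2%N isT 1 i01.
move: f0 f1 f2 f3; rewrite [entry 0 1 r 3]entryS [entry 0 1 r 2]entryS [entry 0 1 r 1]entryS.
rewrite /= /speed /jump /= => f0 f1 f2 f3.
have : v1 * (entry 0 1 r 4).1 < v1.
  have cancel (x y z : R) : x != 0 -> x * (y / x * z) = y * z by move=> ?; field.
  rewrite [entry 0 1 r 4]entryS /= /jump /= cancel ?gt_eqF//.
  have e4 : stage_q 0 1 r 3 1 = r by rewrite -[RHS]e2 entryS.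
  rewrite e4 in f3.
  have e23 : v3 * (v2 / v3 * stage_c 0 1 r 1 1) = v2 * stage_c 0 1 r 1 1.
    by rewrite cancel ?gt_eqF.
  rewrite e23 in f2.
  have g0 : v2 * stage_c 0 1 r 0 1 < v1 * stage_c 0 1 r 0 1 by rewrite ltr_pM2r.
  have g2 : v4 * stage_c 0 1 r 2 1 <= v3 * stage_c 0 1 r 2 1 by rewrite ler_pM2r.
  by rewrite !mul1r in f1 f3 *; lra.
rewrite e1 mulrDr mulr1 gtrDl pmulr_rlt0// pmulr_llt0// invr_gt0 subr_gt0//.
Qed.

Lemma continuous_entry a b n :
  continuous (fun l => (entry l a b n).1) /\ continuous (fun l => (entry l a b n).2).
Proof.
elim: n => [|n [c1 c2]]; first by split => /= x; exact: cvg_cst.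
have cid : continuous (fun l : R => l) by move=> x; exact: cvg_id.
have [h1 h2] := continuous_flow k P (speed n) cid c1 c2 (@continuous_cstf R R 1).
split => //; exact: (continuous_mulf (@continuous_cstf R R (jump n)) h1).
Qed.

Lemma continuous_stage (T : topologicalType) (L X : T -> R) a b n :
  continuous L -> continuous X ->
  continuous (fun z => stage_c (L z) a b n (X z)) /\
  continuous (fun z => stage_q (L z) a b n (X z)).
Proof.
move=> cL cX; have [c1 c2] := continuous_entry a b n.
apply: (continuous_flow k P (speed n) cL _ _ cX).
  exact: (continuous_compf (h := fun l => (entry l a b n).1)).
exact: (continuous_compf (h := fun l => (entry l a b n).2)).
Qed.

(** Joint continuity in the parameter and the position, and compactness of [0, 1] on each of the
    four stages. *)
Lemma q_positive_open l : q_positive l 0 1 -> \forall l' \near l, q_positive l' 0 1.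
Proof.
move=> q0.
have one n : (n < 4)%N -> \forall l' \near l, forall x, 0 <= x <= 1 -> 0 < stage_q l' 0 1 n x.
  move=> n4.
  have := (compact_near_coveringP `[(0 : R), 1]%classic).1 (@segment_compact R 0 1).
  move=> /(_ R (nbhs l) (fun l' x => 0 < stage_q l' 0 1 n x) _) h.
  have {h} h : \forall l' \near l, `[(0 : R), 1]%classic `<=` (fun x => 0 < stage_q l' 0 1 n x).
    apply: h => x /=; rewrite in_itv/= => x01.
    have c : continuous (fun z : R * R => stage_q z.2 0 1 n z.1).
      have cf : continuous (fun z : R * R => z.1) by move=> z; exact: cvg_fst.
      have cs : continuous (fun z : R * R => z.2) by move=> z; exact: cvg_snd.
      exact: (continuous_stage 0 1 n cs cf).2.
    have := c (x, l); move=> /cvgr_gt /(_ 0 (q0 n x n4 x01)).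
    by [].
  apply: filterS h => l' hl x x01; apply: hl; by rewrite /= in_itv.
have h0 := one 0%N isT; have h1 := one 1%N isT; have h2 := one 2%N isT; have h3 := one 3%N isT.
apply: filterS (filterI (filterI h0 h1) (filterI h2 h3)).
by move=> l' [[g0 g1] [g2 g3]] [|[|[|[|n]]]] x // _ x01; [exact: g0|exact: g1|exact: g2|exact: g3].
Qed.

Theorem principal_solution : v2 < v1 -> v2 <= v3 -> v4 <= v3 -> v4 <= v1 ->
  exists l r : R, [/\ - k <= l < 0, 0 < r, q_positive l 1 r & entry l 1 r 4 = (1, r)].
Proof.
move=> v21 v23 v43 v41.
pose bad l := ~ [/\ q_positive l 0 1, 1 < mono22 l & char_det l < 0].
have good0 : ~ bad 0.
  by move=> h; apply: h; split; [exact: zero_q_positive|exact: zero_mono22|exact: zero_char_det].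
have badk : bad (- k).
  by move=> [q0 m22 _]; have := mono22_decay q0; rewrite leNgt m22.
pose S := [set l | - k <= l <= 0 /\ bad l].
have Sk : S (- k) by split => //; rewrite lexx oppr_le0 ltW.
have Sub : has_ubound S by exists 0 => x [/andP[_ ]].
have Ssup : has_sup S by split => //; exists (- k).
pose l := sup S.
have lk : - k <= l by exact: ub_le_sup.
have l0 : l <= 0 by apply: ge_sup; [exists (- k)|move=> x [/andP[_ ]]].
have c11 : continuous mono11 by exact: (continuous_entry 1 0 4).1.
have c12 : continuous mono12 by exact: (continuous_entry 0 1 4).1.
have c21 : continuous mono21 by exact: (continuous_entry 1 0 4).2.
have c22 : continuous mono22 by exact: (continuous_entry 0 1 4).2.
have cdet : continuous char_det.
  apply: continuous_addf; first by apply: continuous_mulf; apply: continuous_addf => //; exact: continuous_cstf.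
  by apply: continuous_oppf; exact: continuous_mulf.
(* The good properties are open, while bad parameters accumulate at the supremum or attain it. *)
have badl : bad l.
  move=> [q0 m22 D0].
  have : \forall l' \near l, [/\ q_positive l' 0 1, 1 < mono22 l' & char_det l' < 0].
    have h1 := q_positive_open q0.
    have h2 : \forall l' \near l, 1 < mono22 l' by apply: (cvgr_gt _ (c22 l)).
    have h3 : \forall l' \near l, char_det l' < 0 by apply: (cvgr_lt _ (cdet l)).
    by apply: filterS (filterI h1 (filterI h2 h3)) => l' [? [? ?]]; split.
  move=> /nbhs_ballP[e /= e0 he].
  have [l' Sl' l'l] := sup_adherent e0 Ssup; have [_ bad'] := Sl'.
  apply: bad'; apply: he; rewrite /ball /= ltr_norml.
  have l'le : l' <= l by apply: ub_le_sup.
  by rewrite -/l in l'l; apply/andP; split; lra.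
have ll0 : l < 0.
  rewrite lt_neqAle l0 andbT; apply/eqP => e; apply: good0; by rewrite -e.
have good l' : l < l' -> l' <= 0 -> [/\ q_positive l' 0 1, 1 < mono22 l' & char_det l' < 0].
  move=> ll' l'0; apply: contrapT => h.
  have : l' <= l by apply: ub_le_sup => //; split => //; rewrite l'0 andbT (le_trans lk (ltW ll')).
  by rewrite leNgt ll'.
have near_good : \forall l' \near l^'+, [/\ q_positive l' 0 1, 1 < mono22 l' & char_det l' < 0].
  near=> l'; apply: good; first by near: l'; exact: nbhs_right_gt.
  by near: l'; exact: nbhs_right_le.
(* All parameters in ]l, 0] are good, so limits from the right keep the inequalities in weak form;
   the strict ones are recovered below. *)
have lim_le (f : R -> R) (y : R) : continuous f -> (\forall l' \near l^'+, y <= f l') -> y <= f l.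
  move=> cf h; have cl : f x @[x --> l^'+] --> f l by exact/cvg_at_right_filter/cf.
  rewrite -(cvg_lim (@Rhausdorff R) cl); apply: limr_ge => //; exact: cvgP cl.
have m22 : 1 <= mono22 l.
  by apply: (lim_le mono22) => //; apply: filterS near_good => x [_ /ltW].
have cge n x : (n < 4)%N -> 0 <= x <= 1 -> 0 <= stage_c l 0 1 n x.
  move=> n4 x01; apply: (lim_le (fun l => stage_c l 0 1 n x)).
    have cid : continuous (fun l : R => l) by move=> z; exact: cvg_id.
    exact: (continuous_stage 0 1 n cid (@continuous_cstf R R x)).1.
  apply: filterS near_good => l' [q0 _ _].
  exact: (c_nonneg (lexx 0) (q_positiveW q0) n4).2.
(* Weak positivity of [c] survives the limit, and [mono22 l >= 1] makes [q] positive at the end of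
   the period, hence before. *)
have q0 : q_positive l 0 1.
  by apply: q_positive_of_c => //; exact: (lt_le_trans ltr01 m22).
have D0 : char_det l <= 0.
  rewrite -oppr_ge0; apply: (lim_le (fun l => - char_det l)).
    exact: continuous_oppf.
  by apply: filterS near_good => x [_ _ /ltW]; rewrite oppr_ge0.
(* If M22 were 1 the determinant would be - M12 M21, which is positive. *)
have m22' : 1 < mono22 l.
  rewrite lt_neqAle m22 andbT; apply/eqP => e.
  move: D0; rewrite /char_det -e subrr mulr0 add0r oppr_le0.
  by rewrite pmulr_rge0 ?mono12_gt0// leNgt mono21_lt0.
(* A negative determinant would make l good. *)
have Dl : char_det l = 0.
  apply/eqP; rewrite eq_le D0 leNgt; apply/negP => D1; apply: badl; by split.
have [r0 qp e2 e1] := closing_solution q0 m22'.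
exists l, (- mono21 l / (mono22 l - 1)); split => //; first by rewrite lk.
by rewrite [LHS]surjective_pairing e2 e1 Dl mul0r addr0.
Unshelve. all: by end_near. Qed.

End Monodromy.

(** * Piecewise smooth states *)

Section Pieces.
Context {R : realType}.
Local Notation mu := (@lebesgue_measure R).
Implicit Types (c q : nat -> R -> R) (f g w : R -> R).

Definition glue c (x : R) : R :=
  if x < -1 then c 1%N x else if x < 0 then c 2%N x
  else if x < 1 then c 3%N x else c 4%N x.

Lemma glueE c i (x : R) : (1 <= i <= 4)%N -> x \in `]node i, node i.+1[ -> glue c x = c i x.
Proof.
case: i => [|[|[|[|[|i]]]]] // _; rewrite ?node1 ?node2 ?node3 ?node4 ?node5 in_itv/= => /andP[h1 h2];
  rewrite /glue.
- by rewrite h2.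
- by rewrite h2 ifF//; apply/negbTE; rewrite -leNgt; lra.
- by rewrite h2 !ifF//; apply/negbTE; rewrite -leNgt; lra.
- by rewrite !ifF//; apply/negbTE; rewrite -leNgt; lra.
Qed.

Lemma continuous_bounded f (a b : R) : a <= b -> continuous f ->
  exists2 M, 0 <= M & forall x, x \in `[a, b] -> `|f x| <= M.
Proof.
move=> ab cf.
have cnf : continuous (fun x => `|f x|).
  by move=> x; apply: continuous_comp; [exact: cf|exact: norm_continuous].
have [x0 _ hc] := @EVT_max R (fun x => `|f x|) a b ab (continuous_subspaceT cnf).
by exists `|f x0|.
Qed.

Lemma L2_bounded f (a b M : R) : measurable_fun `]a, b[ f ->
  (forall x, x \in `]a, b[ -> `|f x| <= M) -> L2 a b f.
Proof.
move=> mf fM; split => //.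
apply: (integrable_dominated (mu := mu) (g := (fun=> M ^+ 2))) => //.
- exact: measurable_funX.
- move=> x xi; rewrite ger0_norm ?sqr_ge0//.
  have := fM x xi; rewrite ler_norml => /andP[h1 h2]; nra.
- exact: integrable_itv_cst.
Qed.

Lemma continuous_measurable_itv f (a b : R) : continuous f -> measurable_fun `]a, b[ f.
Proof. by move=> /(continuous_L2 a b)[]. Qed.

Lemma measurable_switch (a b t : R) f g : measurable_fun `]a, b[ f ->
  measurable_fun `]a, b[ g -> measurable_fun `]a, b[ (fun x => if x < t then f x else g x).
Proof.
move=> mf mg; apply: measurable_fun_if => //.
- exact: measurable_fun_ltr.
- by apply: measurable_funS mf.
- by apply: measurable_funS mg.
Qed.

Lemma L2_glue c : (forall i, (1 <= i <= 4)%N -> continuous (c i)) -> L2 (-2) 2 (glue c).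
Proof.
move=> cc.
have m22 : -2 <= 2 :> R by lra.
have [M1 M10 h1] := continuous_bounded m22 (cc 1%N isT).
have [M2 M20 h2] := continuous_bounded m22 (cc 2%N isT).
have [M3 M30 h3] := continuous_bounded m22 (cc 3%N isT).
have [M4 M40 h4] := continuous_bounded m22 (cc 4%N isT).
have mc i (i14 : (1 <= i <= 4)%N) := continuous_measurable_itv (a := -2) (b := 2) (cc i i14).
apply: (@L2_bounded _ _ _ (M1 + M2 + M3 + M4)).
  by do 3 (apply: measurable_switch; first exact: mc); exact: mc.
move=> x /subset_itv_oo_cc xi; rewrite /glue.
have := h1 x xi; have := h2 x xi; have := h3 x xi; have := h4 x xi.
by case: ifP => _; [lra|case: ifP => _; [lra|case: ifP => _; lra]].
Qed.

Lemma test_function_ends (a b : R) phi : test_function a b phi -> phi a = 0 /\ phi b = 0.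
Proof.
move=> [_ _ [a' [b' [aa' bb' h]]]]; split; apply: h; rewrite in_itv/= negb_and -!ltNge.
  by rewrite aa'.
by rewrite bb' orbT.
Qed.

(** Integration by parts: the product of [w] with a test function vanishes at both ends. *)
Lemma H1_deriv_smooth (a b : R) (f g w dw : R -> R) : a < b -> L2 a b f -> L2 a b g ->
  (forall x : R, is_derive x (1 : R) w (dw x)) -> continuous dw ->
  (forall x, x \in `]a, b[ -> f x = w x) -> (forall x, x \in `]a, b[ -> g x = dw x) ->
  H1_deriv a b f g.
Proof.
move=> ab Lf Lg dW cdw fw gw; split => // phi tphi.
have [pa pb] := test_function_ends tphi; have [dphi cphi _] := tphi.
have cw := derivable_continuous dW.
have dp (x : R) : is_derive x (1 : R) phi (derive1 phi x).
  by rewrite derive1E; apply: DeriveDef.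
have cp := derivable_continuous dp.
rewrite (@eq_Rintegral _ _ _ mu _ (fun x => w x * derive1 phi x)); last first.
  by move=> x; rewrite inE => xi; rewrite fw.
rewrite [X in - X](@eq_Rintegral _ _ _ mu _ (fun x => dw x * phi x)); last first.
  by move=> x; rewrite inE => xi; rewrite gw.
have i1 : mu.-integrable `]a, b[ (EFin \o (fun x => w x * derive1 phi x)).
  by apply: continuous_itv_integrable; exact: continuous_mulf.
have i2 : mu.-integrable `]a, b[ (EFin \o (fun x => dw x * phi x)).
  by apply: continuous_itv_integrable; exact: continuous_mulf.
apply/eqP; rewrite -addr_eq0 -RintegralD//; apply/eqP.
have dF (x : R) : is_derive x (1 : R) (fun x => w x * phi x) (w x * derive1 phi x + dw x * phi x).
  by apply: is_derive_eq; rewrite /GRing.scale /=; ring.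
have cF : continuous (fun x => w x * derive1 phi x + dw x * phi x).
  by apply: continuous_addf; exact: continuous_mulf.
by rewrite (Rintegral_FTC ab cF dF) pa pb !mulr0 subrr.
Qed.

Variables (k P v1 v2 v3 v4 : R).
Local Notation v := (velocity v1 v2 v3 v4).

Definition glueC (c c' : nat -> R -> R) (x : R) : R[i] := glue c x +i* glue c' x.

Definition image_c c q dc i (x : R) := - v i * dc i x - k * P ^+ 2 * c i x + k * P * q i x.
Definition image_q c q dq i (x : R) := dq i x + k * P * c i x - k * q i x.

Definition smooth_pieces c dc := forall i, (1 <= i <= 4)%N ->
  (forall x : R, is_derive x (1 : R) (c i) (dc i x)) /\ continuous (dc i).

Lemma smooth_pieces_continuous c dc : smooth_pieces c dc ->
  forall i, (1 <= i <= 4)%N -> continuous (c i).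
Proof. by move=> s i i14; exact: derivable_continuous (s i i14).1. Qed.

Lemma glueC_L2 c c' : (forall i, (1 <= i <= 4)%N -> continuous (c i)) ->
  (forall i, (1 <= i <= 4)%N -> continuous (c' i)) -> complex_L2 (-2) 2 (glueC c c').
Proof. by move=> h h'; split; exact: L2_glue. Qed.

Lemma glueC_H1 c c' dc dc' i : (1 <= i <= 4)%N -> smooth_pieces c dc -> smooth_pieces c' dc' ->
  complex_H1_deriv (node i) (node i.+1) (glueC c c') (glueC dc dc').
Proof.
move=> i14 s s'; have [n1 n2] := @node_sub R i i14.
have half (b db : nat -> R -> R) : smooth_pieces b db ->
    H1_deriv (node i) (node i.+1) (glue b) (glue db).
  move=> sb; apply: (H1_deriv_smooth (node_lt i) _ _ (sb i i14).1 (sb i i14).2).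
  - exact: L2_sub_itv n1 n2 (L2_glue (smooth_pieces_continuous sb)).
  - by apply: (L2_sub_itv n1 n2 (L2_glue _)) => j j14; exact: (sb j j14).2.
  - by move=> x xi; exact: glueE.
  - by move=> x xi; exact: glueE.
by split; exact: half.
Qed.

Lemma glueC_rep c c' i : (1 <= i <= 4)%N -> continuous (c i) -> continuous (c' i) ->
  continuous_rep (node i) (node i.+1) (glueC c c') (fun x => c i x +i* c' i x).
Proof.
move=> i14 h h'; split.
- exact: continuous_subspaceT.
- exact: continuous_subspaceT.
- by apply: aeW => x xi; rewrite /glueC !(glueE _ i14 xi).
Qed.

(** Piecewise C^1 data with the right boundary values lie in the domain; the primed families carry
    the imaginary parts. *)
Lemma pieces_opA c q c' q' dc dq dc' dq' :
  smooth_pieces c dc -> smooth_pieces q dq -> smooth_pieces c' dc' -> smooth_pieces q' dq' ->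
  boundary_data v1 v2 v3 v4 c q -> boundary_data v1 v2 v3 v4 c' q' ->
  let u := (glueC c c', glueC q q') in
  let f := (glueC (image_c c q dc) (image_c c' q' dc'), glueC (image_q c q dq) (image_q c' q' dq')) in
  [/\ inX u, inX f & opA k P v1 v2 v3 v4 u f].
Proof.
move=> sc sq sc' sq' [[b1 b2 b3 b4] [b5 b6 b7 b8]] [[b1' b2' b3' b4'] [b5' b6' b7' b8']] u f.
have cc := smooth_pieces_continuous sc; have cq := smooth_pieces_continuous sq.
have cc' := smooth_pieces_continuous sc'; have cq' := smooth_pieces_continuous sq'.
have ic (c0 q0 d0 : nat -> R -> R) : smooth_pieces c0 d0 ->
    (forall i, (1 <= i <= 4)%N -> continuous (q0 i)) ->
    forall i, (1 <= i <= 4)%N -> continuous (image_c c0 q0 d0 i).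
  move=> s0 cq0 i i14; rewrite /image_c.
  apply: continuous_addf; last by apply: continuous_mulf; [exact: continuous_cstf|exact: cq0].
  apply: continuous_addf.
    by apply: continuous_mulf; [exact: continuous_cstf|exact: (s0 i i14).2].
  apply: continuous_oppf; apply: continuous_mulf; first exact: continuous_cstf.
  exact: smooth_pieces_continuous s0 i i14.
have iq (c0 q0 d0 : nat -> R -> R) : smooth_pieces q0 d0 ->
    (forall i, (1 <= i <= 4)%N -> continuous (c0 i)) ->
    forall i, (1 <= i <= 4)%N -> continuous (image_q c0 q0 d0 i).
  move=> s0 cc0 i i14; rewrite /image_q.
  apply: continuous_addf.
    apply: continuous_addf; first exact: (s0 i i14).2.
    by apply: continuous_mulf; [exact: continuous_cstf|exact: cc0].
  apply: continuous_oppf; apply: continuous_mulf; first exact: continuous_cstf.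
  exact: smooth_pieces_continuous s0 i i14.
have uX : inX u by split; exact: glueC_L2.
have fX : inX f by split; apply: glueC_L2; (exact: ic || exact: iq).
split => //; split => //.
  split.
    move=> i i14; split.
      by exists (glueC dc dc'); exact: glueC_H1.
    by exists (glueC dq dq'); exact: glueC_H1.
  exists (fun i x => c i x +i* c' i x), (fun i x => q i x +i* q' i x); split.
  - by move=> i i14; split; apply: glueC_rep => //; auto.
  - split; rewrite ?b1 ?b2 ?b1' ?b2'//.
      by rewrite /GRing.mul /= !mul0r !subr0 !addr0 b3 b3'.
    by rewrite /GRing.mul /= !mul0r !subr0 !addr0 b4 b4'.
  - by split; rewrite ?b5 ?b6 ?b7 ?b8 ?b5' ?b6' ?b7' ?b8'.
exists (glueC dc dc'), (glueC dq dq') => i i14; split; try exact: glueC_H1.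
apply: aeW => x xi; rewrite /f /u /= /glueC !(glueE _ i14 xi) /image_c /image_q.
by split; apply/eqP; rewrite eq_complex /=; apply/andP; split; apply/eqP; ring.
Qed.

Lemma ae_itv_witness (a b : R) (Q : R -> Prop) : a < b ->
  {ae mu, forall x, x \in `]a, b[ -> Q x} -> exists2 x, x \in `]a, b[ & Q x.
Proof.
move=> ab h; apply: contrapT => no.
have /negligibleP : mu.-negligible `]a, b[%classic.
  apply: negligibleS h => x /= xi hq; apply: no; exists x => //; exact: hq.
move=> /(_ (measurable_itv _)); rewrite /= lebesgue_measure_itv/= lte_fin ab.
by move=> /eqP; rewrite -EFinB eqe subr_eq0 gt_eqF.
Qed.

End Pieces.

(** * Density of the domain *)

Section Density.
Context {R : realType}.
Local Notation mu := (@lebesgue_measure R).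
Implicit Types (f g : R -> R).

(** Vanishing at all nodes fulfils every boundary condition at once, whatever the velocities. *)
Definition smooth_vanishing (phi dphi : R -> R) :=
  [/\ forall x : R, is_derive x (1 : R) phi (dphi x), continuous dphi &
      forall i, (1 <= i <= 5)%N -> phi (node i) = 0].

Lemma clamp_lipschitz (a b x y : R) : `|clamp a b x - clamp a b y| <= `|x - y|.
Proof.
wlog xy : x y / x <= y.
  move=> h; case/orP: (le_total x y) => xy; first exact: h.
  by rewrite distrC (distrC x); exact: h.
rewrite distrC (distrC x) (ger0_norm (_ : 0 <= y - x)) ?subr_ge0// ler_norml.
rewrite /clamp; case: (leP x b) => ?; case: (leP y b) => ?; case: (leP a x) => ?;
  case: (leP a y) => ?; case: (leP a b) => ?; apply/andP; split; lra.
Qed.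

(** The primitive is an integral from minus infinity, so [f] is cut off by [kap], equal to 1 on
    [-2, 2] and to 0 outside [-3, 3]. *)
Lemma antiderivative f (M : R) : continuous f -> (forall x, `|f x| <= M) ->
  exists h G : R -> R, [/\ continuous h, forall x, -2 <= x <= 2 -> h x = f x,
    forall x, `|h x| <= M & forall x : R, is_derive x (1 : R) G (h x)].
Proof.
move=> cf fM.
pose kap (x : R) := pos (1 - pos (`|x| - 2)).
have ckap : continuous kap.
  have cn : continuous (fun x : R => `|x|) by exact: norm_continuous.
  apply: (continuous_compf (h := pos)); first exact: continuous_pos.
  apply: continuous_addf; first exact: continuous_cstf.
  apply: continuous_oppf; apply: (continuous_compf (h := pos)); first exact: continuous_pos.
  by apply: continuous_addf => //; exact: continuous_cstf.
have kap01 x : 0 <= kap x <= 1.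
  rewrite /kap pos_ge0/=; case: (posE (1 - pos (`|x| - 2))) => -[-> _] //.
  by have := pos_ge0 (`|x| - 2); lra.
have kap1 x : -2 <= x <= 2 -> kap x = 1.
  move=> x2; have : `|x| <= 2 by rewrite ler_norml.
  by rewrite /kap /pos => h; rewrite (max_r (_ : `|x| - 2 <= 0)) ?subr_le0// subr0 max_l.
have kap0 x : 3 <= `|x| -> kap x = 0.
  by move=> h; rewrite /kap /pos max_r// (max_l (_ : 0 <= `|x| - 2)); lra.
pose h x := kap x * f x.
have ch : continuous h by exact: continuous_mulf.
have hM x : `|h x| <= M.
  rewrite normrM; have /andP[k0 k1] := kap01 x; rewrite (ger0_norm k0).
  by have := fM x; have := normr_ge0 (f x); nra.
have ih (y : R) : mu.-integrable `]-oo, y] (EFin \o h).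
  have sub : mu.-integrable [set: R] (EFin \o h).
    have e : EFin \o h = (EFin \o h) \_ `[(-3 : R), 3].
      apply/funext => x; rewrite patchE; case: ifPn => // /negP xn.
      rewrite /= /h kap0 ?mul0r//; rewrite leNgt; apply/negP => x3; apply: xn.
      rewrite inE /= in_itv/=; move: x3; rewrite ltr_norml => /andP[/ltW -> /ltW ->]//.
    rewrite e; apply: (iffLR (integrable_restrict mu (measurable_itv `[(-3 : R), 3]) measurableT (EFin \o h))); rewrite setTI.
    apply: continuous_compact_integrable; first exact: segment_compact.
    exact: continuous_subspaceT.
  by apply: integrableS sub => //.
pose G x := \int[mu]_(t in `]-oo, x]) h t.
exists h, G; split => //.
  by move=> x x2; rewrite /h kap1// mul1r.
move=> x; have x1 : x < x + 1 by lra.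
have [d e] := @continuous_FTC1 R h (BInfty _ true) x (x + 1) x1 (ih _) (ltNyr x) (ch x).
by rewrite derive1E in e; exact: (DeriveDef d e).
Qed.

(** The square makes it nonnegative, with the nodes as its only zeros. *)
Definition node_poly (x : R) := ((x + 2) * (x + 1) * x * (x - 1) * (x - 2)) ^+ 2.
Definition dnode_poly (x : R) := 2 * ((x + 2) * (x + 1) * x * (x - 1) * (x - 2)) *
  ((x + 1) * x * (x - 1) * (x - 2) + (x + 2) * x * (x - 1) * (x - 2) +
   (x + 2) * (x + 1) * (x - 1) * (x - 2) + (x + 2) * (x + 1) * x * (x - 2) +
   (x + 2) * (x + 1) * x * (x - 1)).

Lemma is_derive_node_poly (x : R) : is_derive x (1 : R) node_poly (dnode_poly x).
Proof.
apply: is_derive_eq; rewrite /dnode_poly /GRing.scale /=; ring.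
Qed.

Lemma node_poly_ge0 x : 0 <= node_poly x.
Proof. exact: sqr_ge0. Qed.

Lemma node_poly_node i : (1 <= i <= 5)%N -> node_poly (node i) = 0.
Proof.
case: i => [|[|[|[|[|[|i]]]]]] // _;
  rewrite /node_poly ?node1 ?node2 ?node3 ?node4 ?node5; ring.
Qed.

(** A rational cutoff with values in [0, 1], null at the nodes and tending to 1 elsewhere. *)
Definition cutoff (n : nat) (x : R) := n%:R * node_poly x / (1 + n%:R * node_poly x).

Lemma cutoff_den n x : 0 < 1 + n%:R * node_poly x.
Proof. by apply: ltr_pwDl => //; rewrite mulr_ge0// node_poly_ge0. Qed.

Lemma cutoff_itv n x : 0 <= cutoff n x <= 1.
Proof.
have d := cutoff_den n x; have h : 0 <= n%:R * node_poly x by rewrite mulr_ge0// node_poly_ge0.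
by rewrite /cutoff divr_ge0 ?(ltW d)//= ler_pdivrMr// mul1r lerDr.
Qed.

Lemma is_derive_cutoff n (x : R) :
  is_derive x (1 : R) (cutoff n) (n%:R * dnode_poly x / (1 + n%:R * node_poly x) ^+ 2).
Proof.
have d0 : 1 + n%:R * node_poly x != 0 by rewrite gt_eqF// cutoff_den.
have dn := is_derive_node_poly x.
have d1 : is_derive x (1 : R) (fun y => n%:R * node_poly y) (n%:R * dnode_poly x).
  by apply: is_derive_eq; rewrite /GRing.scale /=; ring.
have d2 : is_derive x (1 : R) (fun y => 1 + n%:R * node_poly y) (n%:R * dnode_poly x).
  by apply: is_derive_eq; rewrite /GRing.scale /=; ring.
have d3 := is_deriveV (f := fun y => 1 + n%:R * node_poly y) d0 d2.
apply: is_derive_eq (is_deriveM d1 d3) _; rewrite /GRing.scale /=; field; exact: d0.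
Qed.

Lemma continuous_dnode_poly : continuous dnode_poly.
Proof.
pose h (x : R) := (x + 2) * (x + 1) * x * (x - 1) * (x - 2).
pose dh (x : R) := (x + 1) * x * (x - 1) * (x - 2) + (x + 2) * x * (x - 1) * (x - 2) +
   (x + 2) * (x + 1) * (x - 1) * (x - 2) + (x + 2) * (x + 1) * x * (x - 2) +
   (x + 2) * (x + 1) * x * (x - 1).
(* Expanded, h = x^5 - 5 x^3 + 4 x and dh = 5 x^4 - 15 x^2 + 4. *)
pose ddh (x : R) := 20 * x ^+ 3 - 30 * x.
have d1 (x : R) : is_derive x (1 : R) h (dh x).
  by apply: is_derive_eq; rewrite /dh /GRing.scale /=; ring.
have d2 (x : R) : is_derive x (1 : R) dh (ddh x).
  by apply: is_derive_eq; rewrite /ddh /GRing.scale /=; ring.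
have c1 := derivable_continuous d1; have c2 := derivable_continuous d2.
apply: (continuous_mulf (f := fun x => 2 * h x)) => //.
by apply: continuous_mulf => //; exact: continuous_cstf.
Qed.

Lemma continuous_node_poly : continuous node_poly.
Proof. exact: derivable_continuous is_derive_node_poly. Qed.

Definition dcutoff n x := n%:R * dnode_poly x / (1 + n%:R * node_poly x) ^+ 2.

Lemma continuous_dcutoff n : continuous (dcutoff n).
Proof.
apply: continuous_mulf.
  by apply: continuous_mulf; [exact: continuous_cstf|exact: continuous_dnode_poly].
move=> x; apply: cvgV; first by rewrite expf_neq0// gt_eqF// cutoff_den.
have c : continuous (fun x => 1 + n%:R * node_poly x).
  apply: continuous_addf; first exact: continuous_cstf.
  by apply: continuous_mulf; [exact: continuous_cstf|exact: continuous_node_poly].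
exact: (continuous_mulf c c).
Qed.

Lemma continuous_cutoff n : continuous (cutoff n).
Proof. exact: derivable_continuous (is_derive_cutoff n). Qed.

Lemma cutoff_cvg x : node_poly x != 0 -> cutoff ^~ x @ \oo --> (1 : R).
Proof.
move=> x0; have p0 : 0 < node_poly x by rewrite lt_neqAle eq_sym x0 node_poly_ge0.
apply/cvgrPdist_le => e e0; near=> n.
have d := cutoff_den n x.
rewrite (_ : 1 - _ = (1 + n%:R * node_poly x)^-1); last by rewrite /cutoff; field; rewrite gt_eqF.
rewrite ger0_norm ?invr_ge0 ?(ltW d)// invf_ple ?posrE//.
have : e^-1 / node_poly x <= n%:R by near: n; exact: nbhs_infty_ger.
by rewrite ler_pdivrMr//; lra.
Unshelve. all: by end_near. Qed.

Lemma ae_node_poly : {ae mu, forall x, x \in `](-2)%R, 2%R[ -> node_poly x != 0}.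
Proof.
have one (t : R) : {ae mu, forall x, x != t}.
  exists [set t]; split => //; first exact: lebesgue_measure_set1.
  by move=> x /= /negP; rewrite negbK => /eqP.
have h : {ae mu, forall x, x != -1 /\ (x != 0 /\ x != 1)}.
  have h01 : {ae mu, forall x, x != 0 /\ x != 1} by apply: (ae_imply2 _ (one 0) (one 1)).
  by apply: (ae_imply2 _ (one (-1)) h01).
apply: (ae_imply _ h) => x [h1 [h2 h3]]; rewrite in_itv/= => /andP[h4 h5].
rewrite /node_poly expf_neq0// !mulf_neq0 ?subr_eq0//.
- by rewrite gt_eqF//; lra.
- by rewrite addr_eq0.
- by rewrite lt_eqF.
Qed.

Lemma difference_quotient (G h : R -> R) (x r : R) : 0 < r -> (forall x : R, is_derive x (1 : R) G (h x)) ->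
  exists2 y, x <= y <= x + r & (G (x + r) - G x) / r = h y.
Proof.
move=> r0 d; have cG := derivable_continuous d.
have xr : x < x + r by lra.
have [y yi e] := MVT xr (fun y _ => d y) (continuous_subspaceT cG).
exists y; first by move: yi; rewrite in_itv/= => /andP[/ltW -> /ltW].
by rewrite e addrAC subrr add0r mulfK// gt_eqF.
Qed.

Lemma difference_quotient_cvg (G h : R -> R) (x : R) : continuous h ->
  (forall x : R, is_derive x (1 : R) G (h x)) ->
  (fun n : nat => (G (x + 1 / n.+1%:R) - G x) / (1 / n.+1%:R)) @ \oo --> h x.
Proof.
move=> ch d; apply/cvgrPdist_le => e e0.
have /cvgrPdist_le /(_ e e0) /nbhs_ballP[r /= r0 hr] := ch x.
have /cvgrPdist_lt /(_ r r0) := cvg_shrinking (@ltr01 R).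
apply: filterS => n; rewrite sub0r normrN.
have n0 : 0 < 1 / n.+1%:R :> R by rewrite divr_gt0.
rewrite gtr0_norm// => nr.
have [y /andP[y1 y2] ->] := difference_quotient x n0 d.
apply: hr; rewrite /ball /= ler0_norm ?subr_le0// opprB ltrBlDl.
by apply: le_lt_trans y2 _; rewrite ltrD2l.
Qed.

(** Multiply the cutoff by the difference quotient of a primitive of [g]. The quotient is C^1 and
    bounded by M, being a value of the integrand; off the nodes the product tends to [g], with
    squared error dominated by (2 M)^2. *)
Lemma smooth_approximation_continuous g (M e : R) : continuous g -> (forall x, `|g x| <= M) ->
  0 < e -> exists phi dphi, smooth_vanishing phi dphi /\
    \int[mu]_(x in `](-2)%R, 2%R[) (g x - phi x) ^+ 2 <= e.
Proof.
move=> cg gM e0; have [h [G [ch hg hM dG]]] := antiderivative cg gM.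
have cG := derivable_continuous dG.
pose r n : R := 1 / n.+1%:R; have r0 n : 0 < r n by rewrite divr_gt0.
pose D n x := (G (x + r n) - G x) / r n.
pose phi n x := cutoff n x * D n x.
pose dphi n x := dcutoff n x * D n x + cutoff n x * ((h (x + r n) - h x) / r n).
have csh n : continuous (fun x : R => x + r n).
  by apply: continuous_addf; [move=> x; exact: cvg_id|exact: continuous_cstf].
have cD n : continuous (D n).
  apply: continuous_mulf; last exact: continuous_cstf.
  apply: continuous_addf; last exact: continuous_oppf.
  exact: continuous_compf.
have cphi n : continuous (phi n) by apply: continuous_mulf => //; exact: continuous_cutoff.
have sphi n : smooth_vanishing (phi n) (dphi n).
  split.
  - move=> x; have d1 := is_derive_cutoff n x; have d2 := dG x.
    by apply: is_derive_eq; rewrite /dphi /dcutoff /GRing.scale /=; ring.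
  - apply: continuous_addf; apply: continuous_mulf => //.
    + exact: continuous_dcutoff.
    + exact: continuous_cutoff.
    + apply: continuous_mulf; last exact: continuous_cstf.
      by apply: continuous_addf; [exact: continuous_compf|exact: continuous_oppf].
  - by move=> i i15; rewrite /phi /cutoff node_poly_node// mulr0 mul0r mul0r.
have bphi n x : `|phi n x| <= M.
  have [y _ e1] := difference_quotient x (r0 n) dG; rewrite /phi /D e1 normrM.
  have /andP[k0 k1] := cutoff_itv n x; rewrite (ger0_norm k0).
  by have := hM y; have := normr_ge0 (h y); nra.
have lim : (fun n => \int[mu]_(x in `](-2)%R, 2%R[) (g x - phi n x) ^+ 2) @ \oo -->
    \int[mu]_(x in `](-2)%R, 2%R[) (0 : R).
  apply: (@Rintegral_dominated_cvg R _ _ mu _ _ _ (fun=> (2 * M) ^+ 2)) => //.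
  - move=> n; apply: measurable_funX; apply: measurable_funB;
      exact: continuous_measurable_itv.
  - apply: (ae_imply _ ae_node_poly) => x hx xi; have p0 := hx xi.
    have xi' := xi; move: xi'; rewrite /= in_itv/= => /andP[x1 x2].
    have c1 : phi ^~ x @ \oo --> (1 * h x : R).
      by apply: cvgM; [exact: cutoff_cvg|exact: difference_quotient_cvg].
    have c2 : (fun n => g x - phi n x) @ \oo --> (0 : R).
      rewrite -(subrr (g x)); apply: cvgB; first exact: cvg_cst.
      by move: c1; rewrite mul1r hg//; lra.
    by rewrite -(mul0r (0 : R)); exact: (cvgM c2 c2).
  - exact: integrable_itv_cst.
  - move=> n x xi; rewrite ger0_norm ?sqr_ge0//.
    by have := gM x; have := bphi n x; rewrite !ler_norml => /andP[h1 h2] /andP[h3 h4]; nra.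
have /cvgrPdist_le /(_ e e0) [N _ hN] := lim.
exists (phi N), (dphi N); split=> //.
have := hN N (leqnn N); rewrite Rintegral_cst//= mul0r sub0r normrN.
exact: le_trans (ler_norm _).
Qed.

(** Density in L^1 is enough: clamping to [-M, M] does not increase the error, and then
    [(f - g) ^+ 2 <= 2 * M * |f - g|]. *)
Lemma clamp_approximation f (M e : R) : L2 (-2) 2 f -> 0 <= M -> (forall x, `|f x| <= M) -> 0 < e ->
  exists g, [/\ continuous g, forall x, `|g x| <= M &
    \int[mu]_(x in `](-2)%R, 2%R[) (f x - g x) ^+ 2 <= e].
Proof.
move=> Lf M0 fM e0.
have ff : (mu `](-2)%R, 2%R[%classic < +oo)%E.
  by rewrite /= lebesgue_measure_itv/= lte_fin; case: ifP => // _; rewrite -EFinB ltry.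
have [g_ [cg ig lim]] := @approximation_continuous_integrable R _ f (measurable_itv _) ff (L2_integrable Lf).
(* An L^1 error d gives a squared error at most 2 M d <= e; the 1 covers M = 0. *)
pose d := e / (2 * M + 1); have d0 : 0 < d by rewrite divr_gt0//; lra.
have [_ /fine_cvgP[_ /cvgrPdist_le /(_ d d0)]] := (I, lim).
move=> [N _ /(_ N (leqnn N))]; rewrite sub0r normrN => hN.
have Lg := continuous_L2 (-2) 2 (cg N).
have id : mu.-integrable `](-2)%R, 2%R[ (EFin \o (fun x => `|f x - g_ N x|)).
  have i0 := integrable_sub (mu := mu) (measurable_itv `](-2)%R, 2%R[) (L2_integrable Lf) (L2_integrable Lg).
  by apply: (integrable_norm (mu := mu)).
pose g x := clamp (- M) M (g_ N x).
have cg1 : continuous g by apply: continuous_compf => //; exact: continuous_clamp.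
have MM : - M <= M by lra.
have gM x : `|g x| <= M by rewrite ler_norml; exact: clamp_itv.
exists g; split => //.
have fg x : `|f x - g x| <= `|f x - g_ N x|.
  rewrite -{1}(@clamp_id _ (- M) M (f x)); first exact: clamp_lipschitz.
  by have := fM x; rewrite ler_norml.
have b x : (f x - g x) ^+ 2 <= 2 * M * `|f x - g_ N x|.
  rewrite -real_normK ?num_real// expr2; apply: ler_pM => //.
  by rewrite (le_trans (ler_normB _ _))//; have := fM x; have := gM x; lra.
have L := L2_add Lf (L2_scale (-1) (continuous_L2 (-2) 2 cg1)).
have i2 : mu.-integrable `](-2)%R, 2%R[ (EFin \o (fun x => (f x - g x) ^+ 2)).
  by have := L2_sqr L; apply: eq_integrable => // x _ /=; rewrite mulN1r.
have i3 := integrable_scale (mu := mu) (2 * M) (measurable_itv `](-2)%R, 2%R[) id.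
have b1 : \int[mu]_(x in `](-2)%R, 2%R[) (f x - g x) ^+ 2 <=
    \int[mu]_(x in `](-2)%R, 2%R[) (2 * M * `|f x - g_ N x|).
  by apply: (ae_le_Rintegral (mu := mu)) => //; apply: aeW => x _; exact: b.
apply: (le_trans b1); rewrite RintegralZl//.
have b2 : \int[mu]_(x in `](-2)%R, 2%R[) `|f x - g_ N x| <= d.
  by apply: le_trans hN; exact: ler_norm.
have : 2 * M * \int[mu]_(x in `](-2)%R, 2%R[) `|f x - g_ N x| <= 2 * M * d.
  by apply: ler_wpM2l => //; lra.
move=> b3; apply: (le_trans b3); rewrite /d mulrA ler_pdivrMr; last by lra.
by nra.
Qed.

Lemma approximation_smooth f (M e : R) : L2 (-2) 2 f -> 0 <= M ->
  (forall x, `|f x| <= M) -> 0 < e ->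
  exists phi dphi, smooth_vanishing phi dphi /\
    \int[mu]_(x in `](-2)%R, 2%R[) (f x - phi x) ^+ 2 <= e.
Proof.
move=> Lf M0 fM e0; have e4 : 0 < e / 4 by rewrite divr_gt0.
have [g [cg gM hg]] := clamp_approximation Lf M0 fM e4.
have [phi [dphi [s hphi]]] := smooth_approximation_continuous cg gM e4.
exists phi, dphi; split => //.
have cphi : continuous phi by case: s => d _ _; exact: derivable_continuous d.
have sq f1 f2 : L2 (-2) 2 f1 -> L2 (-2) 2 f2 ->
    mu.-integrable `](-2)%R, 2%R[ (EFin \o (fun x => (f1 x - f2 x) ^+ 2)).
  move=> L1 L2'; have := L2_sqr (L2_add L1 (L2_scale (-1) L2')).
  by apply: eq_integrable => // x _ /=; rewrite mulN1r.
have Lg := continuous_L2 (-2) 2 cg; have Lp := continuous_L2 (-2) 2 cphi.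
have i1 := integrable_scale (mu := mu) 2 (measurable_itv `](-2)%R, 2%R[) (sq _ _ Lf Lg).
have i2 := integrable_scale (mu := mu) 2 (measurable_itv `](-2)%R, 2%R[) (sq _ _ Lg Lp).
have b : \int[mu]_(x in `](-2)%R, 2%R[) (f x - phi x) ^+ 2 <=
    \int[mu]_(x in `](-2)%R, 2%R[) (2 * (f x - g x) ^+ 2 + 2 * (g x - phi x) ^+ 2).
  apply: (ae_le_Rintegral (mu := mu)) => //; first exact: sq.
    by apply: integrable_add.
  apply: aeW => x _; have := sqr_ge0 (f x - g x - (g x - phi x)); nra.
apply: (le_trans b); rewrite RintegralD// !RintegralZl//; try exact: sq.
by lra.
Qed.

Lemma L2_clamp (a b M : R) f : 0 <= M -> L2 a b f -> L2 a b (fun x => clamp (- M) M (f x)).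
Proof.
move=> M0 [mf _]; apply: (@L2_bounded _ _ _ _ M).
  apply: measurableT_comp mf.
  by apply: continuous_measurable_fun; exact: continuous_clamp.
by move=> x _; rewrite ler_norml; apply: clamp_itv; lra.
Qed.

Lemma approximation_ess_bounded f (M e : R) : L2 (-2) 2 f ->
  {ae mu, forall x, x \in `](-2)%R, 2%R[ -> `|f x| <= M} -> 0 < e ->
  exists phi dphi, smooth_vanishing phi dphi /\
    \int[mu]_(x in `](-2)%R, 2%R[) (f x - phi x) ^+ 2 <= e.
Proof.
move=> Lf fM e0; have m22 : -2 < 2 :> R by lra.
have M0 : 0 <= M by have [x _] := ae_itv_witness m22 fM; exact: le_trans.
have MM : - M <= M by lra.
pose g x := clamp (- M) M (f x).
have gM x : `|g x| <= M by rewrite ler_norml; exact: clamp_itv.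
have Lg : L2 (-2) 2 g by exact: L2_clamp.
have [mf _] := Lf; have [mg _] := Lg.
have [phi [dphi [s hphi]]] := approximation_smooth Lg M0 gM e0.
exists phi, dphi; split=> //; apply: le_trans hphi.
have cphi : continuous phi by case: s => d _ _; exact: derivable_continuous d.
have [mphi _] := continuous_L2 (-2) 2 cphi.
rewrite (@ae_Rintegral _ _ _ mu _ _ (fun x => (g x - phi x) ^+ 2))//.
- by apply: measurable_funX; exact: measurable_funB.
- by apply: measurable_funX; exact: measurable_funB.
apply: (ae_imply _ fM) => x hx xi; rewrite /g clamp_id//.
by have := hx xi; rewrite ler_norml.
Qed.

Variables (k P v1 v2 v3 v4 : R).

Lemma boundary_data_vanishing (phi psi : R -> R) :
  (forall i, (1 <= i <= 5)%N -> phi (node i) = 0) ->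
  (forall i, (1 <= i <= 5)%N -> psi (node i) = 0) ->
  boundary_data v1 v2 v3 v4 (fun=> phi) (fun=> psi).
Proof.
move=> h h'; have := h 1%N isT; have := h 5%N isT; have := h 3%N isT.
have := h' 1%N isT; have := h' 5%N isT; rewrite node1 node3 node5 => e1 e2 e3 e4 e5.
by split; split; rewrite ?e1 ?e2 ?e3 ?e4 ?e5 ?mulr0.
Qed.

Lemma glue_cst f : glue (fun=> f) = f.
Proof. by apply/funext => x; rewrite /glue !if_same. Qed.

Lemma normX_energy (u : state R) : inX u -> normX u ^+ 2 =
  energy (fun x => complex.Re (u.1 x)) (fun x => complex.Re (u.2 x)) +
  energy (fun x => complex.Im (u.1 x)) (fun x => complex.Im (u.2 x)).
Proof.
move=> [[L1 L2'] [L3 L4]]; rewrite normX_sqr// /energy -RintegralD//; try exact: energy_integrable.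
by apply: eq_Rintegral => x _; rewrite /square_norm /sqr_modulus; ring.
Qed.

(** Real and imaginary parts of both components are approximated separately by functions vanishing
    at the nodes. *)
Lemma dense_domain (u : state R) (e : R) : inX u -> boundedX u -> 0 < e ->
  exists w f : state R, [/\ inX w, inX f, opA k P v1 v2 v3 v4 w f & normX (subX u w) <= e].
Proof.
move=> uX [M uM] e0.
(* Four real approximations share the squared distance [e ^+ 2]. *)
have d0 : 0 < e ^+ 2 / 4 by rewrite divr_gt0// exprn_gt0.
have app p : is_part p -> exists phi dphi psi dpsi,
    [/\ smooth_vanishing phi dphi, smooth_vanishing psi dpsi &
     energy (fun x => p (u.1 x) - phi x) (fun x => p (u.2 x) - psi x) <= e ^+ 2 / 2].
  move=> hp; have [L1 L2'] := inX_part hp uX.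
  have h1 : {ae mu, forall x, x \in `](-2)%R, 2%R[ -> `|(p \o u.1) x| <= M}.
    apply: (ae_imply _ uM) => x hx xi; have [h _] := hx xi.
    exact: le_trans (part_le_modulus _ hp) h.
  have h2 : {ae mu, forall x, x \in `](-2)%R, 2%R[ -> `|(p \o u.2) x| <= M}.
    apply: (ae_imply _ uM) => x hx xi; have [_ h] := hx xi.
    exact: le_trans (part_le_modulus _ hp) h.
  have [phi [dphi [s1 b1]]] := approximation_ess_bounded L1 h1 d0.
  have [psi [dpsi [s2 b2]]] := approximation_ess_bounded L2' h2 d0.
  exists phi, dphi, psi, dpsi; split => //.
  have cphi : continuous phi by case: s1 => d _ _; exact: derivable_continuous d.
  have cpsi : continuous psi by case: s2 => d _ _; exact: derivable_continuous d.
  have sq f1 f2 : L2 (-2) 2 f1 -> continuous f2 ->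
      mu.-integrable `](-2)%R, 2%R[ (EFin \o (fun x => (f1 x - f2 x) ^+ 2)).
    move=> Lf cf; have := L2_sqr (L2_add Lf (L2_scale (-1) (continuous_L2 (-2) 2 cf))).
    by apply: eq_integrable => // x _ /=; rewrite mulN1r.
  have i1 := sq _ _ L1 cphi; have i2 := sq _ _ L2' cpsi.
  rewrite /energy RintegralD//; move: b1 b2; rewrite /=; lra.
have [phi [dphi [psi [dpsi [s1 s2 b]]]]] := app _ (or_introl erefl).
have [phi' [dphi' [psi' [dpsi' [s1' s2' b']]]]] := app _ (or_intror erefl).
have sm (f df : R -> R) : smooth_vanishing f df -> smooth_pieces (fun=> f) (fun=> df).
  by move=> [h1 h2 _].
have [[_ _ n1] [_ _ n2] [_ _ n1'] [_ _ n2']] := And4 s1 s2 s1' s2'.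
have [wX fX Aw] := pieces_opA k P (sm _ _ s1) (sm _ _ s2) (sm _ _ s1') (sm _ _ s2')
  (boundary_data_vanishing n1 n2) (boundary_data_vanishing n1' n2').
eexists; eexists; split; [exact: wX|exact: fX|exact: Aw|].
have sX := inX_sub uX wX.
rewrite -ler_sqr ?nnegrE ?normX_ge0 ?(ltW e0)// normX_energy//.
rewrite [X in X + _ <= _](_ : _ = energy (fun x => complex.Re (u.1 x) - phi x)
    (fun x => complex.Re (u.2 x) - psi x)); last first.
  by congr (energy _ _); apply/funext => x;
    rewrite /= mulN1r partD ?partN /= ?glue_cst//; left.
rewrite [X in _ + X <= _](_ : _ = energy (fun x => complex.Im (u.1 x) - phi' x)
    (fun x => complex.Im (u.2 x) - psi' x)); last first.
  by congr (energy _ _); apply/funext => x;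
    rewrite /= mulN1r partD ?partN /= ?glue_cst//; right.
lra.
Qed.

End Density.

(** * Maximum principle *)

Section MaximumPrinciple.
Context {R : realType}.
Implicit Types (f df g : R -> R).

Lemma negative_drift f df g (x y : R) : y < x ->
  (forall z, y < z < x -> is_derive z (1 : R) f (df z)) ->
  (forall z, y <= z <= x -> {for z, continuous f}) ->
  (forall z, y < z < x -> df z <= g z) -> {for x, continuous g} -> g x < 0 ->
  exists2 z, y <= z <= x & f x < f z.
Proof.
move=> yx d cf dg cg gx.
have : \forall z \near x, g z < 0 by exact: cvgr_lt cg _ gx.
move=> /nbhs_ballP[r /= r0 hr].
pose s := Num.max y (x - r / 2).
have sx : s < x by rewrite gt_max yx/=; lra.
have ys : y <= s by rewrite le_max lexx.
have sr : x - r / 2 <= s by rewrite le_max lexx orbT.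
have within_sx z : s < z < x -> y < z < x by move=> /andP[? ->]; rewrite andbT; lra.
have cw : {within `[s, x], continuous f}.
  apply: continuous_in_subspaceT => z; rewrite inE /= in_itv/= => /andP[z1 z2].
  by apply: cf; rewrite z2 (le_trans ys).
have dd z : z \in `]s, x[ -> is_derive z (1 : R) f (df z).
  by rewrite in_itv/= => /within_sx; exact: d.
have [z zi e] := MVT sx dd cw.
have zi' : s < z < x by move: zi; rewrite in_itv.
exists s; first by rewrite ys ltW.
have gz : g z < 0 by apply: hr; rewrite /ball /= ltr_norml; lra.
have := dg z (within_sx z zi'); nra.
Qed.

Lemma positive_drift f df g (x y : R) : x < y ->
  (forall z, x < z < y -> is_derive z (1 : R) f (df z)) ->
  (forall z, x <= z <= y -> {for z, continuous f}) ->
  (forall z, x < z < y -> g z <= df z) -> {for x, continuous g} -> 0 < g x ->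
  exists2 z, x <= z <= y & f x < f z.
Proof.
move=> yx d cf dg cg gx.
have : \forall z \near x, 0 < g z by exact: cvgr_gt cg _ gx.
move=> /nbhs_ballP[r /= r0 hr].
pose s := Num.min y (x + r / 2).
have sx : x < s by rewrite lt_min yx/=; lra.
have ys : s <= y by rewrite ge_min lexx.
have sr : s <= x + r / 2 by rewrite ge_min lexx orbT.
have within_sx z : x < z < s -> x < z < y by move=> /andP[-> ?]; rewrite /=; lra.
have cw : {within `[x, s], continuous f}.
  apply: continuous_in_subspaceT => z; rewrite inE /= in_itv/= => /andP[z1 z2].
  by apply: cf; rewrite z1 (le_trans z2).
have dd z : z \in `]x, s[ -> is_derive z (1 : R) f (df z).
  by rewrite in_itv/= => /within_sx; exact: d.
have [z zi e] := MVT sx dd cw.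
have zi' : x < z < s by move: zi; rewrite in_itv.
exists s; first by rewrite ys ltW.
have gz : 0 < g z by apply: hr; rewrite /ball /= ltr_norml; lra.
have := dg z (within_sx z zi'); nra.
Qed.

Lemma family_max (F : nat -> R -> R) (a b : nat -> R) n : (forall j, a j <= b j) ->
  (forall j, (j <= n)%N -> {within `[a j, b j], continuous (F j)}) ->
  exists j x, [/\ (j <= n)%N, a j <= x <= b j &
    forall i y, (i <= n)%N -> a i <= y <= b i -> F i y <= F j x].
Proof.
move=> ab; elim: n => [|n ih] cF.
  have [x xi h] := EVT_max (ab 0%N) (cF 0%N (leqnn _)).
  rewrite in_itv/= in xi; exists 0%N, x; split => //.
  by move=> i y; rewrite leqn0 => /eqP -> yi; apply: h; rewrite in_itv.
have [j [x [jn xi h]]] := ih (fun j jn => cF j (leqW jn)).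
have [y yi h'] := EVT_max (ab n.+1) (cF n.+1 (leqnn _)).
have [le|lt] := lerP (F j x) (F n.+1 y).
- rewrite in_itv/= in yi; exists n.+1, y; split => //.
  move=> i z; rewrite leq_eqVlt ltnS => /orP[/eqP -> zi|in_ zi].
    by apply: h'; rewrite in_itv.
  exact: le_trans (h i z in_ zi) le.
- exists j, x; split; [exact: leqW|by []|].
  move=> i z; rewrite leq_eqVlt ltnS => /orP[/eqP -> zi|in_ zi]; last exact: h.
  by apply: le_trans (ltW lt); apply: h'; rewrite in_itv.
Qed.

Variables (k P v1 v2 v3 v4 : R).
Hypotheses (k_gt0 : 0 < k) (P_gt0 : 0 < P).
Hypotheses (v1_gt0 : 0 < v1) (v2_gt0 : 0 < v2) (v3_gt0 : 0 < v3) (v4_gt0 : 0 < v4).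
Local Notation v := (velocity v1 v2 v3 v4).

Definition positive_solution (l : R) (c q : nat -> R -> R) :=
  [/\ forall i, (1 <= i <= 4)%N -> ode k P (v i) l (c i) (q i),
      forall i x, (1 <= i <= 4)%N -> node i <= x <= node i.+1 -> 0 < c i x /\ 0 < q i x &
      boundary_data v1 v2 v3 v4 c q].

(* The eigenvalue equation for [s + i t], with c = a + i b and q = d + i e. *)
Definition eigen_ode (s t : R) (a b d e : nat -> R -> R) := forall i, (1 <= i <= 4)%N ->
  [/\ continuous (a i), continuous (b i), continuous (d i) & continuous (e i)] /\
  forall x, node i < x < node i.+1 ->
  [/\ is_derive x (1 : R) (a i) ((- (s + k * P ^+ 2) * a i x + t * b i x + k * P * d i x) / v i),
      is_derive x (1 : R) (b i) ((- (s + k * P ^+ 2) * b i x - t * a i x + k * P * e i x) / v i),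
      is_derive x (1 : R) (d i) ((s + k) * d i x - t * e i x - k * P * a i x) &
      is_derive x (1 : R) (e i) ((s + k) * e i x + t * d i x - k * P * b i x)].

Lemma velocity_gt0 i : (1 <= i <= 4)%N -> 0 < v i.
Proof. by case: i => [|[|[|[|[|i]]]]]. Qed.

Section Comparison.
Variables (l s t : R) (c q a b d e : nat -> R -> R).
Hypotheses (pos_cq : positive_solution l c q) (eig : eigen_ode s t a b d e).
Hypotheses (bd_re : boundary_data v1 v2 v3 v4 a d) (bd_im : boundary_data v1 v2 v3 v4 b e).

(** The squared modulus of the quotient, differentiable even where the eigenfunction vanishes. *)
Definition ratio_c i x := (a i x ^+ 2 + b i x ^+ 2) / c i x ^+ 2.
Definition ratio_q i x := (d i x ^+ 2 + e i x ^+ 2) / q i x ^+ 2.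

Lemma continuous_ratio (f g h : R -> R) (x : R) : continuous f -> continuous g ->
  continuous h -> h x != 0 -> {for x, continuous (fun y => (f y ^+ 2 + g y ^+ 2) / h y ^+ 2)}.
Proof.
move=> cf cg ch h0.
have sq (w : R -> R) : continuous w -> continuous (fun y => w y ^+ 2).
  by move=> cw; apply: (continuous_compf (h := fun y => y ^+ 2)) => //; exact: exprn_continuous.
apply: cvgM; first by apply: cvgD; exact: sq.
by apply: cvgV; [rewrite expf_neq0|exact: sq].
Qed.

Lemma positive_solution_continuous i : (1 <= i <= 4)%N -> continuous (c i) /\ continuous (q i).
Proof.
move=> i14; have [od _ _] := pos_cq; have h := od i i14.
by split; [exact: derivable_continuous (fun x => (h x).1)|exact: derivable_continuous (fun x => (h x).2)].
Qed.

Lemma continuous_ratio_c i x : (1 <= i <= 4)%N -> node i <= x <= node i.+1 ->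
  {for x, continuous (ratio_c i)}.
Proof.
move=> i14 xi; have [[? ? _ _] _] := eig i14; have [? _] := positive_solution_continuous i14.
have [_ p _] := pos_cq; have [cx _] := p i x i14 xi.
by apply: continuous_ratio => //; rewrite gt_eqF.
Qed.

Lemma continuous_ratio_q i x : (1 <= i <= 4)%N -> node i <= x <= node i.+1 ->
  {for x, continuous (ratio_q i)}.
Proof.
move=> i14 xi; have [[_ _ ? ?] _] := eig i14; have [_ ?] := positive_solution_continuous i14.
have [_ p _] := pos_cq; have [_ qx] := p i x i14 xi.
by apply: continuous_ratio => //; rewrite gt_eqF.
Qed.

(** The imaginary part t of the eigenvalue has dropped out: it only rotates (a, b) and (d, e). *)
Definition dratio_c i x := (- 2 * (s - l) * ratio_c i x +
  2 * k * P * ((a i x * d i x + b i x * e i x) / c i x ^+ 2 - ratio_c i x * q i x / c i x)) / v i.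
Definition dratio_q i x := 2 * (s - l) * ratio_q i x -
  2 * k * P * ((a i x * d i x + b i x * e i x) / q i x ^+ 2 - ratio_q i x * c i x / q i x).

Lemma is_derive_ratio (f g h : R -> R) (f' g' h' x : R) : is_derive x (1 : R) f f' ->
  is_derive x (1 : R) g g' -> is_derive x (1 : R) h h' -> h x != 0 ->
  is_derive x (1 : R) (fun y => (f y ^+ 2 + g y ^+ 2) / h y ^+ 2)
    (2 * (f x * f' + g x * g') / h x ^+ 2 - 2 * (f x ^+ 2 + g x ^+ 2) * h' / h x ^+ 3).
Proof.
move=> df dg dh h0.
have d1 : is_derive x (1 : R) (fun y => f y ^+ 2 + g y ^+ 2) (2 * (f x * f' + g x * g')).
  by apply: is_derive_eq; rewrite /GRing.scale /=; ring.
have d2 : is_derive x (1 : R) (fun y => h y ^+ 2) (2 * h x * h').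
  by apply: is_derive_eq; rewrite /GRing.scale /=; ring.
have h20 : h x ^+ 2 != 0 by rewrite expf_neq0.
have d3 := is_deriveV (f := fun y => h y ^+ 2) h20 d2.
apply: is_derive_eq (is_deriveM d1 d3) _; rewrite /GRing.scale /=; by field.
Qed.

Lemma is_derive_ratio_c i x : (1 <= i <= 4)%N -> node i < x < node i.+1 ->
  is_derive x (1 : R) (ratio_c i) (dratio_c i x).
Proof.
move=> i14 xi; have [_ /(_ x xi)[da db _ _]] := eig i14.
have [od p _] := pos_cq; have [dc _] := od i i14 x.
have xi' : node i <= x <= node i.+1 by case/andP: xi => /ltW -> /ltW ->.
have [cx _] := p i x i14 xi'; have vi := velocity_gt0 i14.
have c0 : c i x != 0 by rewrite gt_eqF.
have v0 : v i != 0 by rewrite gt_eqF.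
apply: is_derive_eq (is_derive_ratio da db dc c0) _.
by rewrite /dratio_c /ratio_c; field; rewrite v0 c0.
Qed.

Lemma is_derive_ratio_q i x : (1 <= i <= 4)%N -> node i < x < node i.+1 ->
  is_derive x (1 : R) (ratio_q i) (dratio_q i x).
Proof.
move=> i14 xi; have [_ /(_ x xi)[_ _ dd de]] := eig i14.
have [od p _] := pos_cq; have [_ dq] := od i i14 x.
have xi' : node i <= x <= node i.+1 by case/andP: xi => /ltW -> /ltW ->.
have [_ qx] := p i x i14 xi'.
have q0 : q i x != 0 by rewrite gt_eqF.
apply: is_derive_eq (is_derive_ratio dd de dq q0) _.
by rewrite /dratio_q /ratio_q; field; rewrite q0.
Qed.

(** For the quotients X = (x, y) / m and Z = (z, w) / n this is 2 X.Z <= |X|^2 + |Z|^2, multiplied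
    by n / m. *)
Lemma cross_le (x y z w m n : R) : 0 < m -> 0 < n ->
  2 * ((x * z + y * w) / m ^+ 2) <= n / m * ((z ^+ 2 + w ^+ 2) / n ^+ 2 + (x ^+ 2 + y ^+ 2) / m ^+ 2).
Proof.
move=> m0 n0; rewrite -subr_ge0.
rewrite (_ : _ - _ = ((m * z - n * x) ^+ 2 + (m * w - n * y) ^+ 2) / (m ^+ 3 * n)).
  by rewrite divr_ge0 ?addr_ge0 ?sqr_ge0// mulr_ge0 ?exprn_ge0// ltW.
by field; rewrite !gt_eqF.
Qed.

(** By [cross_le] and [ratio_q <= M] the derivative is at most [g], and where the ratio equals M
    only the negative term - 2 (s - l) M / v of [g] remains. The ratio is then larger slightly to
    the left, so the left end is excluded from the claim. *)
Lemma ratio_c_no_max (M : R) i x : l < s -> 0 < M ->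
  (forall y, node i <= y <= node i.+1 -> ratio_c i y <= M /\ ratio_q i y <= M) ->
  (1 <= i <= 4)%N -> node i < x <= node i.+1 -> ratio_c i x <> M.
Proof.
move=> ls M0 hM i14 /andP[x1 x2] eM; have [od p _] := pos_cq.
have [cc cq] := positive_solution_continuous i14; have vi := velocity_gt0 i14.
have sub z : node i < z < x -> node i <= z <= node i.+1 by lra.
pose g z := (- 2 * (s - l) * ratio_c i z + k * P * (q i z / c i z) * (M - ratio_c i z)) / v i.
have xi : node i <= x <= node i.+1 by lra.
have [cx _] := p i x i14 xi.
have cg : {for x, continuous g}.
  have cr := continuous_ratio_c i14 xi.
  apply: cvgM; last exact: cvg_cst.
  apply: cvgD; first by apply: cvgM; [exact: cvg_cst|exact: cr].
  apply: cvgM; last by apply: cvgB; [exact: cvg_cst|exact: cr].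
  apply: cvgM; first exact: cvg_cst.
  by apply: cvgM; [exact: cq|apply: cvgV; [rewrite gt_eqF|exact: cc]].
have gx : g x < 0.
  rewrite /g eM subrr mulr0 addr0 pmulr_llt0 ?invr_gt0//; nra.
have dg z : node i < z < x -> dratio_c i z <= g z.
  move=> zi; have zi' := sub z zi; have [cz qz] := p i z i14 zi'.
  have [_ nz] := hM z zi'.
  rewrite /dratio_c /g ler_pM2r ?invr_gt0// lerD2l -(mulrA (ratio_c i z)).
  have h := cross_le (a i z) (b i z) (d i z) (e i z) cz qz.
  rewrite -/(ratio_c i z) -/(ratio_q i z) in h.
  have r0 : 0 < q i z / c i z by rewrite divr_gt0.
  have h2 := ler_wpM2l (ltW r0) nz.
  have kP : 0 <= k * P by rewrite mulr_ge0// ltW.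
  have := ler_wpM2l kP (lerD h h2).
  move: (q i z / c i z) (ratio_c i z) (ratio_q i z) => r m n; lra.
have dd z : node i < z < x -> is_derive z (1 : R) (ratio_c i) (dratio_c i z).
  by move=> zi; apply: is_derive_ratio_c => //; lra.
have cf z : node i <= z <= x -> {for z, continuous (ratio_c i)}.
  by move=> zi; apply: continuous_ratio_c => //; lra.
have [z zi h] := negative_drift x1 dd cf dg cg gx.
have zi' : node i <= z <= node i.+1 by lra.
by have [hz _] := hM z zi'; rewrite eM in h; lra.
Qed.

(** Mirror image: [q] is transported to the left, so the ratio is larger slightly to the right of a
    point where it equals M. *)
Lemma ratio_q_no_max (M : R) i x : l < s -> 0 < M ->
  (forall y, node i <= y <= node i.+1 -> ratio_c i y <= M /\ ratio_q i y <= M) ->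
  (1 <= i <= 4)%N -> node i <= x < node i.+1 -> ratio_q i x <> M.
Proof.
move=> ls M0 hM i14 /andP[x1 x2] eM; have [od p _] := pos_cq.
have [cc cq] := positive_solution_continuous i14.
have sub z : x < z < node i.+1 -> node i <= z <= node i.+1 by lra.
pose g z := 2 * (s - l) * ratio_q i z - k * P * (c i z / q i z) * (M - ratio_q i z).
have xi : node i <= x <= node i.+1 by lra.
have [_ qx] := p i x i14 xi.
have cg : {for x, continuous g}.
  have cr := continuous_ratio_q i14 xi.
  apply: cvgB; first by apply: cvgM; [exact: cvg_cst|exact: cr].
  apply: cvgM; last by apply: cvgB; [exact: cvg_cst|exact: cr].
  apply: cvgM; first exact: cvg_cst.
  by apply: cvgM; [exact: cc|apply: cvgV; [rewrite gt_eqF|exact: cq]].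
have gx : 0 < g x by rewrite /g eM subrr mulr0 subr0; nra.
have dg z : x < z < node i.+1 -> g z <= dratio_q i z.
  move=> zi; have zi' := sub z zi; have [cz qz] := p i z i14 zi'.
  have [nz _] := hM z zi'.
  rewrite /dratio_q /g lerD2l lerN2 -(mulrA (ratio_q i z)).
  have h := cross_le (d i z) (e i z) (a i z) (b i z) qz cz.
  rewrite -/(ratio_c i z) -/(ratio_q i z) (mulrC (d i z)) (mulrC (e i z)) in h.
  have r0 : 0 < c i z / q i z by rewrite divr_gt0.
  have h2 := ler_wpM2l (ltW r0) nz.
  have kP : 0 <= k * P by rewrite mulr_ge0// ltW.
  have := ler_wpM2l kP (lerD h h2).
  move: (c i z / q i z) (ratio_c i z) (ratio_q i z) => r m n; lra.
have dd z : x < z < node i.+1 -> is_derive z (1 : R) (ratio_q i) (dratio_q i z).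
  by move=> zi; apply: is_derive_ratio_q => //; lra.
have cf z : x <= z <= node i.+1 -> {for z, continuous (ratio_q i)}.
  by move=> zi; apply: continuous_ratio_q => //; lra.
have [z zi h] := positive_drift x2 dd cf dg cg gx.
have zi' : node i <= z <= node i.+1 by lra.
by have [_ hz] := hM z zi'; rewrite eM in h; lra.
Qed.

Definition predecessor i := if i == 1%N then 4%N else i.-1.

(** The jump factors cancel, since the eigenfunction and the positive solution satisfy the same
    conditions. *)
Lemma ratio_c_node i : (1 <= i <= 4)%N ->
  ratio_c i (node i) = ratio_c (predecessor i) (node (predecessor i).+1).
Proof.
have [_ p [[b1 b2 b3 b4] _]] := pos_cq.
have [[b1' b2' b3' b4'] _] := bd_re; have [[b1'' b2'' b3'' b4''] _] := bd_im.
have sol (x y z w : R) : 0 < w -> z * x = w * y -> y = z / w * x.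
  by move=> w0 h; rewrite mulrAC h mulrAC mulfV ?mul1r// gt_eqF.
have scale (r x y z : R) : 0 < r -> 0 < z ->
    ((r * x) ^+ 2 + (r * y) ^+ 2) / (r * z) ^+ 2 = (x ^+ 2 + y ^+ 2) / z ^+ 2.
  by move=> r0 z0; field; rewrite !gt_eqF.
have pn j y : (1 <= j <= 4)%N -> node j <= y <= node j.+1 -> 0 < c j y.
  by move=> j14 yj; have [] := p j y j14 yj.
have p1 : 0 < c 1%N (-2) by apply: pn => //; rewrite node1 node2; lra.
have p3 : 0 < c 3%N 0 by apply: pn => //; rewrite node3 node4; lra.
case: i => [|[|[|[|[|i]]]]] // _; rewrite /predecessor /= ?node1 ?node2 ?node3 ?node4 ?node5 /ratio_c.
- rewrite (sol _ _ _ _ v4_gt0 b3) (sol _ _ _ _ v4_gt0 b3') (sol _ _ _ _ v4_gt0 b3'').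
  by rewrite scale ?divr_gt0.
- by rewrite b1 b1' b1''.
- rewrite (sol _ _ _ _ v2_gt0 b4) (sol _ _ _ _ v2_gt0 b4') (sol _ _ _ _ v2_gt0 b4'').
  by rewrite scale ?divr_gt0.
- by rewrite b2 b2' b2''.
Qed.

Lemma ratio_q_node i : (1 <= i <= 4)%N ->
  ratio_q i (node i) = ratio_q (predecessor i) (node (predecessor i).+1).
Proof.
have [_ _ [_ [b1 b2 b3 b4]]] := pos_cq.
have [_ [b1' b2' b3' b4']] := bd_re; have [_ [b1'' b2'' b3'' b4'']] := bd_im.
case: i => [|[|[|[|[|i]]]]] // _; rewrite /predecessor /= ?node1 ?node2 ?node3 ?node4 ?node5 /ratio_q.
- by rewrite b4 b4' b4''.
- by rewrite b1 b1' b1''.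
- by rewrite b2 b2' b2''.
- by rewrite b3 b3' b3''.
Qed.

Lemma predecessor_range i : (1 <= i <= 4)%N -> (1 <= predecessor i <= 4)%N.
Proof. by case: i => [|[|[|[|[|i]]]]]. Qed.

Lemma predecessor_onto i : (1 <= i <= 4)%N -> exists2 j, (1 <= j <= 4)%N & predecessor j = i.
Proof.
case: i => [|[|[|[|[|i]]]]] // _;
  [by exists 2%N|by exists 3%N|by exists 4%N|by exists 1%N].
Qed.

Lemma ratio_le0 : l < s -> forall i x, (1 <= i <= 4)%N -> node i <= x <= node i.+1 ->
  ratio_c i x <= 0 /\ ratio_q i x <= 0.
Proof.
move=> ls.
(* All eight quotients in one family: indices 0 to 3 for [c] and 4 to 7 for [q] on intervals 1 to
   4. *)
pose F j := if (j < 4)%N then ratio_c j.+1 else ratio_q (j - 3).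
pose id j := if (j < 4)%N then j.+1 else (j - 3)%N.
have id14 j : (j <= 7)%N -> (1 <= id j <= 4)%N by case: j => [|[|[|[|[|[|[|[|j]]]]]]]].
have cF j : (j <= 7)%N -> {within `[node (id j), node (id j).+1], continuous (F j)}.
  move=> j7; apply: continuous_in_subspaceT => x; rewrite inE /= in_itv/= => xi.
  have := id14 j j7; move: xi; rewrite /F /id; case: ifP => _ xi j14.
    exact: continuous_ratio_c.
  exact: continuous_ratio_q.
have [j [x [j7 xj hj]]] := family_max (fun j => ltW (node_lt (id j))) cF.
have hM i y : (1 <= i <= 4)%N -> node i <= y <= node i.+1 ->
    ratio_c i y <= F j x /\ ratio_q i y <= F j x.
  case: i => // i i4' yi; have i4 : (i < 4)%N by [].
  split.
    by have := hj i y; rewrite /F /id i4; apply => //; exact: leq_trans (ltnW i4) _.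
  have := hj (i + 4)%N y; rewrite /F /id ltnNge leq_addl/=.
  rewrite -addnBA// addn1; apply => //.
  by rewrite (leq_add2r 4 i 3).
have [K0|K0] := lerP (F j x) 0.
  by move=> i y i14 yi; have [h1 h2] := hM i y i14 yi; split; lra.
exfalso; move: xj hM K0 (id14 j j7); rewrite /F /id; case: ifP => _.
  move: (j.+1) => i xi hM K0 i14.
  (* A maximum at the left end is moved to the right end of the preceding interval, cyclically. *)
  have [xe|xn] := eqVneq x (node i).
    have p14 := predecessor_range i14; rewrite xe ratio_c_node// in hM K0.
    apply: (ratio_c_no_max ls K0 (fun y => hM _ y p14) p14 _ erefl).
    by rewrite node_lt lexx.
  apply: (ratio_c_no_max ls K0 (fun y => hM _ y i14) i14 _ erefl).
  by rewrite lt_neqAle eq_sym xn.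
move: (j - 3)%N => i xi hM K0 i14.
(* A maximum at the right end is moved to the left end of the following interval. *)
have [xe|xn] := eqVneq x (node i.+1).
  have [i' i'14 ii'] := predecessor_onto i14.
  rewrite xe -ii' -ratio_q_node// in hM K0.
  apply: (ratio_q_no_max ls K0 (fun y => hM _ y i'14) i'14 _ erefl).
  by rewrite node_lt lexx.
apply: (ratio_q_no_max ls K0 (fun y => hM _ y i14) i14 _ erefl).
by case/andP: xi => -> h /=; rewrite lt_neqAle xn.
Qed.

Lemma eigen_ode_zero : l < s -> forall i x, (1 <= i <= 4)%N -> node i <= x <= node i.+1 ->
  [/\ a i x = 0, b i x = 0, d i x = 0 & e i x = 0].
Proof.
move=> ls i x i14 xi; have [h1 h2] := ratio_le0 ls i14 xi.
have [_ p _] := pos_cq; have [cx qx] := p i x i14 xi.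
have vanish (y z w : R) : 0 < w -> (y ^+ 2 + z ^+ 2) / w ^+ 2 <= 0 -> y = 0 /\ z = 0.
  move=> w0; rewrite pmulr_lle0 ?invr_gt0 ?exprn_gt0// => h.
  have := sqr_ge0 y; have := sqr_ge0 z => h3 h4.
  by split; apply/eqP; rewrite -sqrf_eq0; apply/eqP; lra.
by have [-> ->] := vanish _ _ _ cx h1; have [-> ->] := vanish _ _ _ qx h2.
Qed.

End Comparison.
End MaximumPrinciple.

(** * Eigenfunctions are smooth on each interval *)

Section Regularity.
Context {R : realType}.
Local Notation mu := (@lebesgue_measure R).
Implicit Types (w g G : R -> R).

(** [w] and a primitive of [G] have the same increments, so they differ by a constant near x. *)
Lemma has_increments_derive (a b : R) w g G : -2 <= a -> a < b -> b <= 2 ->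
  L2 a b g -> continuous G -> {ae mu, forall x, x \in `]a, b[ -> g x = G x} ->
  has_increments a b w g -> forall x : R, a < x < b -> is_derive x (1 : R) w (G x).
Proof.
move=> a2 ab b2 Lg cG gG incr.
have m22 : -2 <= 2 :> R by lra.
have [M M0 hM] := continuous_bounded m22 cG.
(* [antiderivative] asks for a bound on the whole line, which [G] itself may lack. *)
have cGc : continuous (fun x => G (clamp (-2) 2 x)).
  by apply: continuous_compf => //; exact: continuous_clamp.
have bGc x : `|G (clamp (-2) 2 x)| <= M by apply: hM; rewrite in_itv; exact: clamp_itv.
have [h [H [ch hG _ dH]]] := antiderivative cGc bGc.
have hH : H1_deriv a b H h by apply: (H1_deriv_smooth ab _ _ dH ch) => //; apply: continuous_L2 => //; exact: derivable_continuous dH.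
have hE x : x \in `]a, b[ -> h x = G x.
  by rewrite in_itv/= => /andP[? ?]; rewrite hG ?clamp_id//; lra.
have eqw s t : a < s -> s <= t -> t < b -> w t - w s = H t - H s.
  move=> as_ st tb; rewrite incr//.
  rewrite (H1_deriv_increment_in hH (derivable_continuous dH) (aeW _ (fun x _ => erefl)) as_ st tb).
  apply: (ae_Rintegral (mu := mu)) => //.
  - by apply: measurable_funM => //; case: Lg.
  - by apply: measurable_funM => //; case: (continuous_L2 a b ch).
  - by apply: (ae_imply _ gG) => x hx xi; rewrite hx// hE.
move=> x xi; have xi' : x \in `]a, b[ by rewrite in_itv.
rewrite -(hE x xi').
have d : is_derive x (1 : R) (fun y => w x - H x + H y) (h x).
  have := is_deriveD (is_derive_cst (w x - H x) x (1 : R)) (dH x).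
  by rewrite add0r.
apply: (near_eq_is_derive _ d); near=> y.
have yi : y \in `]a, b[ by near: y; exact: near_in_itvoo xi'.
move: yi; rewrite in_itv/= => /andP[ay yb]; case/andP: xi => ax xb.
by case: (lerP x y) => [xy|/ltW yx]; [have := eqw x y ax xy yb|have := eqw y x ay yx xb]; lra.
Unshelve. all: by end_near. Qed.

Variables (k P v1 v2 v3 v4 : R).
Hypotheses (v1_gt0 : 0 < v1) (v2_gt0 : 0 < v2) (v3_gt0 : 0 < v3) (v4_gt0 : 0 < v4).
Local Notation v := (velocity v1 v2 v3 v4).
Local Notation A := (opA k P v1 v2 v3 v4).

Lemma interval_derive i (F G c q f g C Q Cx Qx : R -> R) : (1 <= i <= 4)%N ->
  interval_data k P v1 v2 v3 v4 i c q f g C Q Cx Qx -> continuous F -> continuous G ->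
  {ae mu, forall x, x \in `]node i, node i.+1[ -> f x = F x /\ g x = G x} ->
  forall x, node i < x < node i.+1 ->
  is_derive x (1 : R) C ((- F x - k * P ^+ 2 * C x + k * P * Q x) / v i) /\
  is_derive x (1 : R) Q (G x - k * P * C x + k * Q x).
Proof.
move=> i14 [[cC cQ LCx LQx] iC iQ dat] cF cG fg x xi.
have [n1 n2] := @node_sub R i i14; have vi := velocity_gt0 v1_gt0 v2_gt0 v3_gt0 v4_gt0 i14.
have lin (y z : R) (f1 f2 f3 : R -> R) : continuous f1 -> continuous f2 -> continuous f3 ->
    continuous (fun x => f1 x + y * f2 x + z * f3 x).
  by move=> c1 c2 c3; apply: continuous_addf; [apply: continuous_addf => //|];
    apply: continuous_mulf => //; exact: continuous_cstf.
split.
  have cont : continuous (fun x => (- F x - k * P ^+ 2 * C x + k * P * Q x) / v i).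
    apply: continuous_mulf; last exact: continuous_cstf.
    under [X in continuous X]eq_fun do rewrite -mulNr.
    by apply: lin => //; exact: continuous_oppf.
  apply: (has_increments_derive n1 (node_lt i) n2 LCx cont _ iC xi).
  apply: (ae_imply2 _ dat fg) => y h1 h2 yi; have [_ _ e1 _] := h1 yi; have [e2 _] := h2 yi.
  by rewrite -e2 e1; field; rewrite gt_eqF.
have cont : continuous (fun x => G x - k * P * C x + k * Q x).
  under [X in continuous X]eq_fun do rewrite -mulNr.
  exact: lin.
apply: (has_increments_derive n1 (node_lt i) n2 LQx cont _ iQ xi).
apply: (ae_imply2 _ dat fg) => y h1 h2 yi; have [_ _ _ e1] := h1 yi; have [_ e2] := h2 yi.
by rewrite -e2 e1; ring.
Qed.

(** The image of an eigenfunction is a multiple of itself, hence has continuous representatives;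
    solving for the weak derivatives shows that these are continuous too. *)
Lemma eigen_regularity (z : R[i]) (u : state R) : inX u -> A u (scaleX z u) ->
  exists a b d e : nat -> R -> R,
  [/\ eigen_ode k P v1 v2 v3 v4 (complex.Re z) (complex.Im z) a b d e,
      boundary_data v1 v2 v3 v4 a d, boundary_data v1 v2 v3 v4 b e &
      forall i, (1 <= i <= 4)%N -> {ae mu, forall x, x \in `]node i, node i.+1[ ->
        u.1 x = a i x +i* b i x /\ u.2 x = d i x +i* e i x}].
Proof.
move=> uX Au.
have [_ _ _ _ [a [d [ax [dx [h1 bd1]]]]]] := opA_real_graph (or_introl erefl) uX Au.
have [_ _ _ _ [b [e [bx [ex [h2 bd2]]]]]] := opA_real_graph (or_intror erefl) uX Au.
have rep i : (1 <= i <= 4)%N -> {ae mu, forall x, x \in `]node i, node i.+1[ ->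
    u.1 x = a i x +i* b i x /\ u.2 x = d i x +i* e i x}.
  move=> i14; have [_ _ _ d1] := h1 i i14; have [_ _ _ d2] := h2 i i14.
  apply: (ae_imply2 _ d1 d2) => x hx hx' xi.
  have [e1 e2 _ _] := hx xi; have [e3 e4 _ _] := hx' xi.
  by rewrite -e1 -e2 -e3 -e4 /=; case: (u.1 x); case: (u.2 x).
exists a, b, d, e; split => // i i14.
have [[ca cd _ _] _ _ _] := h1 i i14; have [[cb ce _ _] _ _ _] := h2 i i14.
split => // x xi.
have lin (y y' : R) (f g : R -> R) : continuous f -> continuous g ->
    continuous (fun x => y * f x + y' * g x).
  by move=> c1 c2; apply: continuous_addf; apply: continuous_mulf => //; exact: continuous_cstf.
set s := complex.Re z; set t := complex.Im z.
have r1 : {ae mu, forall x, x \in `]node i, node i.+1[ ->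
    (@complex.Re R \o (scaleX z u).1) x = s * a i x + - t * b i x /\
    (@complex.Re R \o (scaleX z u).2) x = s * d i x + - t * e i x}.
  apply: (ae_imply _ (rep i i14)) => y hy yi; have [e1 e2] := hy yi.
  by rewrite /= e1 e2 /s /t; case: (z) => p q /=; split; ring.
have r2 : {ae mu, forall x, x \in `]node i, node i.+1[ ->
    (@complex.Im R \o (scaleX z u).1) x = s * b i x + t * a i x /\
    (@complex.Im R \o (scaleX z u).2) x = s * e i x + t * d i x}.
  apply: (ae_imply _ (rep i i14)) => y hy yi; have [e1 e2] := hy yi.
  by rewrite /= e1 e2 /s /t; case: (z) => p q /=; split; ring.
have [d1 d2] := interval_derive i14 (h1 i i14) (lin s (- t) _ _ ca cb) (lin s (- t) _ _ cd ce) r1 xi.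
have [d3 d4] := interval_derive i14 (h2 i i14) (lin s t _ _ cb ca) (lin s t _ _ ce cd) r2 xi.
split; [apply: is_derive_eq d1 _|apply: is_derive_eq d3 _|apply: is_derive_eq d2 _|apply: is_derive_eq d4 _].
- by congr (_ / _); ring.
- by congr (_ / _); ring.
- by ring.
- by ring.
Qed.

(** The interior nodes are zeros of [node_poly], hence form a null set. *)
Lemma ae_nodes (Q : R -> Prop) :
  (forall i, (1 <= i <= 4)%N -> {ae mu, forall x, x \in `]node i, node i.+1[ -> Q x}) ->
  {ae mu, forall x, x \in `](-2)%R, 2%R[ -> Q x}.
Proof.
move=> h; have h0 := @ae_node_poly R.
have h1 := h 1%N isT; have h2 := h 2%N isT; have h3 := h 3%N isT; have h4 := h 4%N isT.
have h12 : {ae mu, forall x, (x \in `]node 1, node 2[ -> Q x) /\ (x \in `]node 2, node 3[ -> Q x)}.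
  by apply: (ae_imply2 _ h1 h2).
have h34 : {ae mu, forall x, (x \in `]node 3, node 4[ -> Q x) /\ (x \in `]node 4, node 5[ -> Q x)}.
  by apply: (ae_imply2 _ h3 h4).
have h14 : {ae mu, forall x, ((x \in `]node 1, node 2[ -> Q x) /\ (x \in `]node 2, node 3[ -> Q x)) /\
    ((x \in `]node 3, node 4[ -> Q x) /\ (x \in `]node 4, node 5[ -> Q x))}.
  by apply: (ae_imply2 _ h12 h34).
apply: (ae_imply2 _ h0 h14) => x nx [[q1 q2] [q3 q4]] xi.
have {}nx := nx xi; move: xi; rewrite in_itv/= => /andP[x1 x2].
have node_neq j : (1 <= j <= 5)%N -> x != node j.
  by move=> j15; apply: contraNneq nx => ->; rewrite node_poly_node.
have := node_neq 2%N isT; have := node_neq 3%N isT; have := node_neq 4%N isT.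
rewrite !in_itv/= !node1 !node2 !node3 !node4 !node5 in q1 q2 q3 q4 *.
move=> n4 n3 n2.
case: (ltgtP x (-1)) n2 => // [xl _|xl _]; first by apply: q1; lra.
case: (ltgtP x 0) n3 => // [xl2 _|xl2 _]; first by apply: q2; lra.
case: (ltgtP x 1) n4 => // [xl3 _|xl3 _]; first by apply: q3; lra.
by apply: q4; lra.
Qed.

Hypotheses (k_gt0 : 0 < k) (P_gt0 : 0 < P).

Lemma eigenvalue_le (l : R) c q (z : R[i]) : positive_solution k P v1 v2 v3 v4 l c q ->
  is_eigenvalue A z -> complex.Re z <= l.
Proof.
move=> pos [u [uX nz Au]]; rewrite leNgt; apply/negP => lz; apply: nz.
have [a [b [d [e [eo bd1 bd2 rep]]]]] := eigen_regularity uX Au.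
apply: ae_nodes => i i14; apply: (ae_imply _ (rep i i14)) => x hx xi.
have [e1 e2] := hx xi; move: xi; rewrite in_itv/= => /andP[/ltW x1 /ltW x2].
have xi : node i <= x <= node i.+1 by rewrite x1.
have [a0 b0 d0 e0] := eigen_ode_zero k_gt0 P_gt0 v1_gt0 v2_gt0 v3_gt0 v4_gt0 pos eo bd1 bd2 lz i14 xi.
by rewrite e1 e2 a0 b0 d0 e0.
Qed.

Lemma glue_piece (x : R) : -2 < x < 2 -> exists i,
  [/\ (1 <= i <= 4)%N, node i <= x <= node i.+1 & forall c, glue c x = c i x].
Proof.
move=> /andP[x1 x2]; case: (ltP x (-1)) => h1.
  by exists 1%N; split => //; [rewrite node1 node2; lra|move=> c; rewrite /glue h1].
case: (ltP x 0) => h2.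
  exists 2%N; split => //; first by rewrite node2 node3; lra.
  by move=> c; rewrite /glue h2 ltNge h1.
case: (ltP x 1) => h3.
  exists 3%N; split => //; first by rewrite node3 node4; lra.
  by move=> c; rewrite /glue h3 ltNge h1 ltNge h2.
exists 4%N; split => //; first by rewrite node4 node5; lra.
by move=> c; rewrite /glue ltNge h1 ltNge h2 ltNge h3.
Qed.

Definition real_state (c q : nat -> R -> R) : state R :=
  (glueC c (fun=> fun=> 0), glueC q (fun=> fun=> 0)).

Lemma real_state_opA (l : R) c q :
  (forall i, (1 <= i <= 4)%N -> ode k P (v i) l (c i) (q i)) ->
  boundary_data v1 v2 v3 v4 c q ->
  inX (real_state c q) /\ A (real_state c q) (scaleX l%:C (real_state c q)).
Proof.
move=> od bd.
pose dc i x := - ((l + k * P ^+ 2) / v i) * c i x + k * P / v i * q i x.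
pose dq i x := (l + k) * q i x - k * P * c i x.
have cc i (i14 : (1 <= i <= 4)%N) := derivable_continuous (fun x => (od i i14 x).1).
have cq i (i14 : (1 <= i <= 4)%N) := derivable_continuous (fun x => (od i i14 x).2).
have lin (y y' : R) (f g : R -> R) : continuous f -> continuous g ->
    continuous (fun x => y * f x + y' * g x).
  by move=> c1 c2; apply: continuous_addf; apply: continuous_mulf => //; exact: continuous_cstf.
have sc : smooth_pieces c dc.
  by move=> i i14; split=> [x|]; [have [] := od i i14 x|apply: lin; [exact: cc|exact: cq]].
have sq : smooth_pieces q dq.
  move=> i i14; split=> [x|]; first by have [] := od i i14 x.
  under [X in continuous X]eq_fun do rewrite -mulNr.
  by apply: lin; [exact: cq|exact: cc].
have s0 : smooth_pieces (fun=> fun=> 0 : R) (fun=> fun=> 0 : R).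
  by move=> i i14; split=> [x|]; [exact: is_derive_cst|exact: continuous_cstf].
have bd0 : boundary_data v1 v2 v3 v4 (fun=> fun=> 0) (fun=> fun=> 0).
  by split; split; rewrite ?mulr0.
have [uX _ Au] := pieces_opA k P sc sq s0 s0 bd bd0; split => //.
move: Au; rewrite -/(real_state c q).
set f := (X in opA _ _ _ _ _ _ _ X); suff -> : f = scaleX l%:C (real_state c q) by [].
rewrite /f /scaleX /real_state /=; congr pair; apply/funext => x.
  apply/eqP; rewrite eq_complex /=; apply/andP; split; apply/eqP; rewrite /glue.
    have E i : (1 <= i <= 4)%N -> image_c k P v1 v2 v3 v4 c q dc i x = l * c i x - 0 * (0 : R).
      by move=> i14; have vi := velocity_gt0 v1_gt0 v2_gt0 v3_gt0 v4_gt0 i14;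
        rewrite /image_c /dc; field; rewrite gt_eqF.
    by rewrite !E// !if_same; do 3 case: ifP => _ //.
  have E i : image_c k P v1 v2 v3 v4 (fun=> fun=> 0) (fun=> fun=> 0) (fun=> fun=> 0) i x = 0.
    by rewrite /image_c; ring.
  by rewrite !E !if_same; ring.
apply/eqP; rewrite eq_complex /=; apply/andP; split; apply/eqP; rewrite /glue.
  have E i : image_q k P c q dq i x = l * q i x - 0 * (0 : R).
    by rewrite /image_q /dq; ring.
  by rewrite !E// !if_same; do 3 case: ifP => _ //.
have E i : image_q k P (fun=> fun=> 0) (fun=> fun=> 0) (fun=> fun=> 0) i x = 0.
  by rewrite /image_q; ring.
by rewrite !E !if_same; ring.
Qed.

Lemma positive_solution_eigenfunction (l : R) c q : positive_solution k P v1 v2 v3 v4 l c q ->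
  is_eigenfunction A l%:C (real_state c q) /\ strictly_positive (real_state c q).
Proof.
move=> pos; have [od p bd] := pos; have [uX Au] := real_state_opA od bd.
have cc i (i14 : (1 <= i <= 4)%N) := positive_solution_continuous pos i14.
split.
  split => // z0; have m22 : -2 < 2 :> R by lra.
  have [x xi [h _]] := ae_itv_witness m22 z0; move: xi; rewrite in_itv/= => xi.
  have [i [i14 xi' e]] := glue_piece xi; move: h; rewrite /= /glueC !e => -[h].
  by have [] := p i x i14 xi'; rewrite h ltxx.
move=> i i14; have [c1 c2] := cc i i14; exists (c i), (q i); split.
- by apply: glueC_rep => //; exact: continuous_cstf.
- by apply: glueC_rep => //; exact: continuous_cstf.
- by move=> x xi; apply: p => //; move: xi; rewrite in_itv.
Qed.

Lemma positive_solution_largest (l : R) c q : positive_solution k P v1 v2 v3 v4 l c q ->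
  largest_real_eigenvalue A l.
Proof.
move=> pos; have [h _] := positive_solution_eigenfunction pos; split.
  by exists (real_state c q).
by move=> m /(eigenvalue_le pos).
Qed.

(** Interval i is stage i - 1 shifted by [node i]; the fixed vector supplies the conditions between
    2 and -2. *)
Lemma stage_positive_solution (l r : R) : q_positive k P v1 v2 v3 v4 l 1 r ->
  entry k P v1 v2 v3 v4 l 1 r 4 = (1, r) ->
  positive_solution k P v1 v2 v3 v4 l (fun i x => stage_c k P v1 v2 v3 v4 l 1 r i.-1 (x - node i))
    (fun i x => stage_q k P v1 v2 v3 v4 l 1 r i.-1 (x - node i)).
Proof.
move=> q0 e4; split.
- move=> i i14 x.
  have sp : v i = speed v1 v2 v3 v4 i.-1 by case: i i14 => [|[|[|[|[|i]]]]].
  have dl : is_derive x (1 : R) (fun y : R => y - node i) 1.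
    by apply: is_derive_eq; rewrite subr0.
  have [d1 d2] := stage_ode k P v1_gt0 v2_gt0 v3_gt0 v4_gt0 l 1 r i.-1 (x - node i).
  rewrite sp; split.
    by have := is_derive1_comp (g := fun y : R => y - node i) d1 dl; rewrite mulr1.
  by have := is_derive1_comp (g := fun y : R => y - node i) d2 dl; rewrite mulr1.
- move=> i x i14 /andP[x1 x2].
  have i4 : (i.-1 < 4)%N by case: i i14 {x1 x2} => [|[|[|[|[|i]]]]].
  have x01 : 0 <= x - node i <= 1.
    by move: x1 x2; rewrite /node -natr1; lra.
  split; last exact: q0.
  by have [_] := c_positive k_gt0 P_gt0 v1_gt0 v2_gt0 v3_gt0 v4_gt0 ltr01 q0 i4; exact.
- have z n := stage0 k P v1 v2 v3 v4 l 1 r n.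
  have [e1 e2] : (entry k P v1 v2 v3 v4 l 1 r 4).1 = 1 /\ (entry k P v1 v2 v3 v4 l 1 r 4).2 = r.
    by rewrite e4.
  rewrite entryS /= in e1 e2.
  rewrite /boundary_data /= !node1 !node2 !node3 !node4.
  have [n1 n2 n3 n4] : [/\ -1 - -2 = 1 :> R, 1 - 0 = 1 :> R, 2 - 1 = 1 :> R & 0 - -1 = 1 :> R].
    by split; lra.
  have [n5 n6 n7 n8] : [/\ -1 - -1 = 0 :> R, 1 - 1 = 0 :> R, -2 - -2 = 0 :> R & 0 - 0 = 0 :> R].
    by split; lra.
  rewrite n1 n2 n3 n4 n5 n6 n7 n8.
  rewrite (z 1%N).1 (z 3%N).1 (z 0%N).1 (z 2%N).1 (z 1%N).2 (z 3%N).2 (z 0%N).2 (z 2%N).2.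
  (* The first coordinate of the fixed vector, read before the last jump [v4 / v1]. *)
  have -> : stage_c k P v1 v2 v3 v4 l 1 r 3 1 = v1 / v4.
    move: e1; rewrite {1}/jump /= => e1.
    have v10 : v1 != 0 by rewrite gt_eqF.
    have v40 : v4 != 0 by rewrite gt_eqF.
    apply: (@mulfI _ (v4 / v1)); first by rewrite mulf_neq0 ?invr_eq0.
    by rewrite e1 mulrA divfK// divff.
  rewrite e2 !entryS /= /jump /= !mul1r.
  split; split => //.
    by rewrite mulr1 mulrCA mulfV ?mulr1// gt_eqF.
  by rewrite mulrA [v3 * _]mulrC divfK// gt_eqF.
Qed.

End Regularity.

(** * Equal velocities and the eigenvalue 0 *)

Section LimitCase.
Context {R : realType}.
Local Notation mu := (@lebesgue_measure R).
Variables (k P v : R).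
Hypotheses (k_gt0 : 0 < k) (P_gt0 : 0 < P) (v_gt0 : 0 < v).

Lemma constant_of_derive0 (f : R -> R) (a b x : R) : continuous f ->
  (forall y, a < y < b -> is_derive y (1 : R) f 0) -> a <= x <= b -> f x = f a.
Proof.
move=> cf d /andP[]; rewrite le_eqVlt => /orP[/eqP -> //|ax] xb.
have dd y : y \in `]a, x[ -> is_derive y (1 : R) f ((fun=> 0) y).
  by rewrite in_itv/= => /andP[y1 y2]; apply: d; rewrite y1 (lt_le_trans y2).
have [z _ e] := MVT ax dd (continuous_subspaceT cf).
by move: e; rewrite mul0r => /eqP; rewrite subr_eq0 => /eqP.
Qed.

Lemma constant_across_nodes (F : nat -> R -> R) :
  (forall i, (1 <= i <= 4)%N -> continuous (F i)) ->
  (forall i x, (1 <= i <= 4)%N -> node i < x < node i.+1 -> is_derive x (1 : R) (F i) 0) ->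
  F 1%N (-1) = F 2%N (-1) -> F 2%N 0 = F 3%N 0 -> F 3%N 1 = F 4%N 1 ->
  forall i x, (1 <= i <= 4)%N -> node i <= x <= node i.+1 -> F i x = F 1%N (-2).
Proof.
move=> cF dF e1 e2 e3.
have h i x (i14 : (1 <= i <= 4)%N) := constant_of_derive0 (x := x) (cF i i14) (fun y => dF i y i14).
have h1 := h 1%N (-1) isT; have h2 := h 2%N 0 isT; have h3 := h 3%N 1 isT.
rewrite node1 node2 in h1; rewrite node2 node3 in h2; rewrite node3 node4 in h3.
have {}h1 : F 1%N (-1) = F 1%N (-2) by apply: h1; lra.
have {}h2 : F 2%N 0 = F 2%N (-1) by apply: h2; lra.
have {}h3 : F 3%N 1 = F 3%N 0 by apply: h3; lra.
move=> i x i14 xi; rewrite (h i x i14 xi).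
case: i i14 {xi} => [|[|[|[|[|i]]]]] // _; rewrite ?node1 ?node2 ?node3 ?node4//.
- by rewrite -e1.
- by rewrite -e2 h2 -e1.
- by rewrite -e3 h3 -e2 h2 -e1.
Qed.

(** The quantity d - P a is [W * expR (m * x)] with one constant W for all intervals. Each interval
    then changes [a] by a positive multiple of W, and the sum over the period is zero: so W = 0, [a]
    is constant and d = P a. *)
Lemma periodic_constant (a d : nat -> R -> R) :
  (forall i, (1 <= i <= 4)%N -> continuous (a i) /\ continuous (d i)) ->
  (forall i x, (1 <= i <= 4)%N -> node i < x < node i.+1 ->
    is_derive x (1 : R) (a i) (k * P / v * (d i x - P * a i x)) /\
    is_derive x (1 : R) (d i) (k * (d i x - P * a i x))) ->
  boundary_data v v v v a d ->
  exists y, forall i x, (1 <= i <= 4)%N -> node i <= x <= node i.+1 -> a i x = y /\ d i x = P * y.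
Proof.
move=> cad der [[b1 b2 b3 b4] [b5 b6 b7 b8]].
have v0 : v != 0 by rewrite gt_eqF.
have {}b3 := mulfI v0 b3; have {}b4 := mulfI v0 b4.
pose m := k - k * P ^+ 2 / v.
pose E i x := expR (- m * x) * (d i x - P * a i x).
have cE i : (1 <= i <= 4)%N -> continuous (E i).
  move=> i14; have [ca cd] := cad i i14; apply: continuous_mulf.
    by apply: derivable_continuous => x; exact: is_derive_expR_lin.
  apply: continuous_addf => //; apply: continuous_oppf; apply: continuous_mulf => //.
  exact: continuous_cstf.
have dE i x : (1 <= i <= 4)%N -> node i < x < node i.+1 -> is_derive x (1 : R) (E i) 0.
  move=> i14 xi; have [da dd] := der i x i14 xi; have dx := is_derive_expR_lin (- m) x.
  by apply: is_derive_eq; rewrite /GRing.scale /= /m; field.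
pose W := E 1%N (-2).
have EW : forall i x, (1 <= i <= 4)%N -> node i <= x <= node i.+1 -> E i x = W.
  by apply: constant_across_nodes => //; rewrite /E ?b1 -?b4 ?b2 ?b5 ?b6 ?b7.
have wE i x : (1 <= i <= 4)%N -> node i <= x <= node i.+1 ->
    d i x - P * a i x = W * expR (m * x).
  by move=> i14 xi; rewrite -(EW i x i14 xi) /E mulrAC -expRD mulNr addNr expR0 mul1r.
have W0 : W = 0.
  have inc i : (1 <= i <= 4)%N -> exists2 r, 0 < r & a i (node i.+1) - a i (node i) = W * r.
    move=> i14; have [ca _] := cad i i14.
    have dd y : y \in `]node i, node i.+1[ ->
        is_derive y (1 : R) (a i) (k * P / v * (d i y - P * a i y)).
      by rewrite in_itv/= => yi; have [] := der i y i14 yi.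
    have [y yi e] := MVT (node_lt i) dd (continuous_subspaceT ca).
    exists (k * P / v * expR (m * y)); first by rewrite mulr_gt0 ?expR_gt0// divr_gt0// mulr_gt0.
    rewrite e wE//; last by move: yi; rewrite in_itv/= => /andP[/ltW -> /ltW ->].
    by rewrite /node -natr1; ring.
  have [r1 r10 e1] := inc 1%N isT; have [r2 r20 e2] := inc 2%N isT.
  have [r3 r30 e3] := inc 3%N isT; have [r4 r40 e4] := inc 4%N isT.
  rewrite node1 node2 in e1; rewrite node2 node3 in e2; rewrite node3 node4 in e3; rewrite node4 node5 in e4.
  have : W * (r1 + r2 + r3 + r4) = 0 by rewrite !mulrDr; lra.
  by move=> /eqP; rewrite mulf_eq0 => /orP[/eqP //|]; rewrite gt_eqF// !addr_gt0.
have w0 i x : (1 <= i <= 4)%N -> node i <= x <= node i.+1 -> d i x = P * a i x.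
  by move=> i14 xi; apply/eqP; rewrite -subr_eq0 wE// W0 mul0r.
have ac : forall i x, (1 <= i <= 4)%N -> node i <= x <= node i.+1 -> a i x = a 1%N (-2).
  apply: constant_across_nodes => //; first by move=> i i14; have [] := cad i i14.
  move=> i x i14 xi; have [da _] := der i x i14 xi; apply: is_derive_eq da _.
  by rewrite w0 ?subrr ?mulr0//; case/andP: xi => /ltW -> /ltW ->.
by exists (a 1%N (-2)) => i x i14 xi; rewrite w0// (ac i x i14 xi).
Qed.

(** The estimate of the limit case is claimed for every eigenfunction, complex ones included, so the
    whole kernel is determined. *)
Lemma zero_eigenfunction (u : state R) : inX u -> opA k P v v v v u (scaleX 0 u) ->
  exists y y' : R, {ae mu, forall x, x \in `](-2)%R, 2%R[ ->
    u.1 x = y +i* y' /\ u.2 x = (P * y) +i* (P * y')}.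
Proof.
move=> uX Au.
have [a [b [d [e [eo bd1 bd2 rep]]]]] := eigen_regularity v_gt0 v_gt0 v_gt0 v_gt0 uX Au.
have vE i : (1 <= i <= 4)%N -> velocity v v v v i = v by case: i => [|[|[|[|[|i]]]]].
have [] := @periodic_constant a d _ _ bd1.
- by move=> i i14; have [[? _ ? _] _] := eo i i14.
- move=> i x i14 xi; have [_ /(_ x xi)[d1 _ d2 _]] := eo i i14; rewrite vE// in d1.
  by split; [apply: is_derive_eq d1 _|apply: is_derive_eq d2 _] => /=; ring.
move=> y hy; have [] := @periodic_constant b e _ _ bd2.
- by move=> i i14; have [[_ ? _ ?] _] := eo i i14.
- move=> i x i14 xi; have [_ /(_ x xi)[_ d1 _ d2]] := eo i i14; rewrite vE// in d1.
  by split; [apply: is_derive_eq d1 _|apply: is_derive_eq d2 _] => /=; ring.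
move=> y' hy'; exists y, y'; apply: ae_nodes => i i14.
apply: (ae_imply _ (rep i i14)) => x hx xi; have [e1 e2] := hx xi.
have xi' : node i <= x <= node i.+1 by move: xi; rewrite in_itv/= => /andP[/ltW -> /ltW ->].
by rewrite e1 e2; have [-> ->] := hy i x i14 xi'; have [-> ->] := hy' i x i14 xi'.
Qed.

Lemma constant_ode (y : R) : ode k P v 0 (fun=> y) (fun=> P * y).
Proof.
move=> x; split; apply: is_derive_eq (is_derive_cst _ _ _) _; last by ring.
by field; rewrite gt_eqF.
Qed.

Lemma constant_boundary_data (y : R) : boundary_data v v v v (fun=> fun=> y) (fun=> fun=> P * y).
Proof. by []. Qed.

Lemma constant_positive_solution : positive_solution k P v v v v 0 (fun=> fun=> 1) (fun=> fun=> P * 1).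
Proof.
split => //; last by move=> i x _ _; rewrite mulr1.
by move=> i i14; rewrite (_ : velocity v v v v i = v); [exact: constant_ode|case: i i14 => [|[|[|[|[|i]]]]]].
Qed.

End LimitCase.

(** * The lower bound for the principal eigenvalue *)

Section LowerBound.
Context {R : realType}.
Implicit Types (x y a b s t : R).

Lemma sinh_ge t : 0 <= t -> 2 * t <= expR t - expR (- t).
Proof.
rewrite le_eqVlt => /orP[/eqP <-|t0]; first by rewrite oppr0 subrr mulr0.
have d y : is_derive y (1 : R) (fun y => expR y - expR (- y) - 2 * y) (expR y + expR (- y) - 2).
  have d1 : is_derive y (1 : R) (fun y : R => expR (1 * y)) (1 * expR (1 * y)) := is_derive_expR_lin 1 y.
  have d2 : is_derive y (1 : R) (fun y : R => expR (-1 * y)) (-1 * expR (-1 * y)) := is_derive_expR_lin (-1) y.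
  rewrite (_ : (fun y => _) = (fun y => expR (1 * y) - expR (-1 * y) - 2 * y)); last first.
    by apply/funext => z; rewrite mulN1r mul1r.
  by apply: is_derive_eq; rewrite /GRing.scale /= !mulN1r !mul1r opprK mulr1.
have [z _ e] := MVT t0 (fun y _ => d y) (continuous_subspaceT (derivable_continuous d)).
have : 0 <= expR z + expR (- z) - 2.
  rewrite expRN; have ez := expR_gt0 z.
  rewrite (_ : _ - 2 = (expR z - 1) ^+ 2 / expR z); first by rewrite divr_ge0 ?sqr_ge0// ltW.
  by field; rewrite gt_eqF.
by move: e; rewrite /= oppr0 expR0 subrr mulr0 subrr !subr0; nra.
Qed.

Lemma inv_sqrt_le x y a b : 0 < a -> 0 < b -> a ^+ 2 * x = 1 -> b ^+ 2 * y = 1 -> y <= x ->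
  a <= b.
Proof.
move=> a0 b0 ax bY yx; rewrite leNgt; apply/negP => ba.
have b20 : 0 < b ^+ 2 by rewrite exprn_gt0.
have y0 : 0 < y by rewrite -(pmulr_rgt0 _ b20) bY.
have h1 : b ^+ 2 * y < a ^+ 2 * y by rewrite ltr_pM2r// ltr_sqr ?nnegrE ?ltW.
have h2 : a ^+ 2 * y <= a ^+ 2 * x by rewrite ler_pM2l// exprn_gt0.
lra.
Qed.

(** With a and b the inverse square roots of x and y, this is [sinh_ge] at t = ln (b / a), half the
    left-hand side. *)
Lemma ln_sub_le x y a b : 0 < a -> 0 < b -> a ^+ 2 * x = 1 -> b ^+ 2 * y = 1 -> y <= x ->
  ln x - ln y <= (x - y) * (a * b).
Proof.
move=> a0 b0 ax bY yx.
have a20 : 0 < a ^+ 2 by rewrite exprn_gt0.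
have b20 : 0 < b ^+ 2 by rewrite exprn_gt0.
have xE : x = a ^- 2 by apply: (@mulfI _ (a ^+ 2)); rewrite ?gt_eqF// ax mulfV// gt_eqF.
have yE : y = b ^- 2 by apply: (@mulfI _ (b ^+ 2)); rewrite ?gt_eqF// bY mulfV// gt_eqF.
have lE (z : R) : 0 < z -> ln (z ^- 2) = - (2 * ln z).
  by move=> z0; rewrite lnV ?posrE ?exprn_gt0// lnXn// mulr_natl.
have ab := inv_sqrt_le a0 b0 ax bY yx.
have t0 : 0 <= ln b - ln a by rewrite subr_ge0 ler_ln ?posrE.
have := sinh_ge t0.
rewrite opprB !expRD !expRN !lnK ?posrE// => h.
rewrite xE yE !lE//; apply: le_trans (le_trans h _); first by lra.
by rewrite le_eqVlt; apply/orP; left; apply/eqP; field; rewrite !gt_eqF.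
Qed.

Lemma is_derive_ln_comp (f : R -> R) (d x : R) : is_derive x (1 : R) f d -> 0 < f x ->
  is_derive x (1 : R) (fun y => ln (f y)) (d / f x).
Proof.
move=> df fx; have := is_derive1_comp (g := f) (is_derive1_ln fx) df.
by rewrite mulrC.
Qed.

Variables (k P v1 v2 v3 v4 : R).
Hypotheses (k_gt0 : 0 < k) (P_gt0 : 0 < P).
Hypotheses (v1_gt0 : 0 < v1) (v2_gt0 : 0 < v2) (v3_gt0 : 0 < v3) (v4_gt0 : 0 < v4).
Local Notation v := (velocity v1 v2 v3 v4).

Section Growth.
Variables (l : R) (c q : nat -> R -> R).
Hypothesis pos : positive_solution k P v1 v2 v3 v4 l c q.

(** In the derivative of [s ^+ 2 * ln c - ln q] the variable part is k P (s^2 a^2 q / c + c / q),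
    which is at least 2 k P s a. *)
Lemma piece_growth i s a : (1 <= i <= 4)%N -> 0 < a -> a ^+ 2 * v i = 1 ->
  - s ^+ 2 * (l + k * P ^+ 2) * a ^+ 2 - (l + k) + 2 * k * P * s * a <=
  s ^+ 2 * (ln (c i (node i.+1)) - ln (c i (node i))) -
  (ln (q i (node i.+1)) - ln (q i (node i))).
Proof.
move=> i14 a0 av; have [od p _] := pos.
have vE : v i = a ^- 2.
  by apply: (@mulfI _ (a ^+ 2)); rewrite ?gt_eqF ?exprn_gt0// av mulfV// gt_eqF// exprn_gt0.
pose F x := s ^+ 2 * ln (c i x) - ln (q i x).
pose dF x := s ^+ 2 * ((- ((l + k * P ^+ 2) / v i) * c i x + k * P / v i * q i x) / c i x) -
  ((l + k) * q i x - k * P * c i x) / q i x.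
have sub x : x \in `[node i, node i.+1] -> 0 < c i x /\ 0 < q i x.
  by rewrite in_itv/=; exact: p.
have d x : x \in `[node i, node i.+1] -> is_derive x (1 : R) F (dF x).
  move=> xi; have [cx qx] := sub x xi; have [dc dq] := od i i14 x.
  have d1 := is_derive_ln_comp dc cx; have d2 := is_derive_ln_comp dq qx.
  by apply: is_derive_eq; rewrite /GRing.scale /=.
have cF : {within `[node i, node i.+1], continuous F}.
  apply: continuous_in_subspaceT => x; rewrite inE /= => xi.
  by apply/differentiable_continuous/derivable1_diffP; have [] := d x xi.
have [z zi e] := MVT (node_lt i) (fun x xi => d x (subset_itv_oo_cc xi)) cF.
have n1 : node i.+1 - node i = 1 :> R by rewrite /node -natr1; ring.
rewrite (_ : s ^+ 2 * _ - _ = dF z); last by rewrite -[dF z]mulr1 -n1 -e /F; ring.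
have [cz qz] := sub z (subset_itv_oo_cc zi).
rewrite -subr_ge0 (_ : _ - _ = k * P * (q i z / c i z) * (s * a - c i z / q i z) ^+ 2).
  by rewrite mulr_ge0 ?sqr_ge0// ltW// mulr_gt0 ?divr_gt0// mulr_gt0.
by rewrite /dF vE; field; rewrite !gt_eqF.
Qed.

(** Summed over the period the terms in [ln q] cancel, and those in [ln c] leave the logarithms of
    the two jumps. *)
Lemma total_growth s a1 a2 a3 a4 : 0 < a1 -> 0 < a2 -> 0 < a3 -> 0 < a4 ->
  a1 ^+ 2 * v1 = 1 -> a2 ^+ 2 * v2 = 1 -> a3 ^+ 2 * v3 = 1 -> a4 ^+ 2 * v4 = 1 ->
  - s ^+ 2 * (l + k * P ^+ 2) * (a1 ^+ 2 + a2 ^+ 2 + a3 ^+ 2 + a4 ^+ 2) - 4 * (l + k) +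
    2 * k * P * s * (a1 + a2 + a3 + a4) <= s ^+ 2 * (ln v1 - ln v4 + ln v3 - ln v2).
Proof.
move=> a10 a20 a30 a40 e1 e2 e3 e4; have [_ p [[b1 b2 b3 b4] [b5 b6 b7 b8]]] := pos.
have g1 := piece_growth s (i := 1) isT a10 e1; have g2 := piece_growth s (i := 2) isT a20 e2.
have g3 := piece_growth s (i := 3) isT a30 e3; have g4 := piece_growth s (i := 4) isT a40 e4.
have pc i x i14 xi := (p i x i14 xi).1.
have n i : node i <= node i.+1 :> R by exact/ltW/node_lt.
have c1 : 0 < c 1%N (node 1) by apply: pc; rewrite // lexx n.
have c3 : 0 < c 3%N (node 3) by apply: pc; rewrite // lexx n.
have c4 : 0 < c 4%N (node 5) by apply: pc; rewrite // lexx n.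
have c2 : 0 < c 2%N (node 3) by apply: pc; rewrite // lexx n.
rewrite !node1 !node2 !node3 !node4 !node5 in g1 g2 g3 g4 c1 c2 c3 c4.
have := congr1 (@ln R) b3; have := congr1 (@ln R) b4; rewrite !lnM ?posrE// => j2 j1.
rewrite b1 b5 in g1; rewrite b6 in g2; rewrite b2 b7 in g3; rewrite b8 in g1.
rewrite (_ : ln v1 - ln v4 + ln v3 - ln v2 =
  (ln (c 4%N 2) - ln (c 1%N (-2))) + (ln (c 2%N 0) - ln (c 3%N 0))); last by lra.
move: g1 g2 g3 g4; move: (s ^+ 2) => S; lra.
Qed.

Lemma rate_lower_bound a1 a2 a3 a4 : l <= 0 -> v4 <= v1 -> v2 <= v3 ->
  0 < a1 -> 0 < a2 -> 0 < a3 -> 0 < a4 ->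
  a1 ^+ 2 * v1 = 1 -> a2 ^+ 2 * v2 = 1 -> a3 ^+ 2 * v3 = 1 -> a4 ^+ 2 * v4 = 1 ->
  k ^+ 2 * P ^+ 2 * (a1 + a2 + a3 + a4) ^+ 2 <= 4 * (l + k) *
    (ln v1 - ln v4 + ln v3 - ln v2 + k * P ^+ 2 * (a1 ^+ 2 + a2 ^+ 2 + a3 ^+ 2 + a4 ^+ 2)).
Proof.
move=> l0 v41 v23 a10 a20 a30 a40 e1 e2 e3 e4.
set L := ln v1 - _ + _ - _; set S := a1 ^+ 2 + _ + _ + _; set B := a1 + a2 + a3 + a4.
have S0 : 0 < S by rewrite /S !addr_gt0 ?exprn_gt0.
have L0 : 0 <= L.
  have h1 : ln v4 <= ln v1 by rewrite ler_ln ?posrE.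
  have h2 : ln v2 <= ln v3 by rewrite ler_ln ?posrE.
  by rewrite /L; lra.
set D := L + k * P ^+ 2 * S.
have D0 : 0 < D by rewrite ltr_wpDl// mulr_gt0// mulr_gt0// exprn_gt0.
(* This value of s maximizes the quadratic 2 k P B s - D s^2; the term - s^2 l S is nonnegative and
   is dropped. *)
have := total_growth (k * P * B / D) a10 a20 a30 a40 e1 e2 e3 e4.
rewrite -/L -/S -/B => h.
have h2 : 2 * k * P * (k * P * B / D) * B - (k * P * B / D) ^+ 2 * D <= 4 * (l + k).
  have := mulr_ge0_le0 (mulr_ge0 (sqr_ge0 (k * P * B / D)) (ltW S0)) l0.
  by move: h; rewrite /D; move: (_ ^+ 2) => X; lra.
have {}h2 : k ^+ 2 * P ^+ 2 * B ^+ 2 / D <= 4 * (l + k).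
  apply: le_trans h2; rewrite le_eqVlt; apply/orP; left; apply/eqP.
  by field; rewrite gt_eqF.
by move: h2; rewrite ler_pdivrMr.
Qed.

End Growth.

Lemma velocity_bounds i : (1 <= i <= 4)%N -> vmin v1 v2 v3 v4 <= v i <= vmax v1 v2 v3 v4.
Proof.
case: i => [|[|[|[|[|i]]]]] // _; rewrite /vmin /vmax /velocity /= !ge_min !le_max lexx ?orbT//.
Qed.

Lemma vmin_gt0 : 0 < vmin v1 v2 v3 v4.
Proof. by rewrite /vmin !lt_min v1_gt0 v2_gt0 v3_gt0 v4_gt0. Qed.

Lemma M0_gt0 : 0 < M0 k P v1 v2 v3 v4.
Proof.
have /andP[m1 m2] := velocity_bounds (i := 1) isT; have m0 := vmin_gt0.
rewrite /M0; move: m1 m2 m0; move: (vmin _ _ _ _) (vmax _ _ _ _) => m M m1 m2 m0.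
have kP : 0 < k * P ^+ 2 by rewrite mulr_gt0// exprn_gt0.
have Z0 : k * P ^+ 2 * m < m * ((M - m) / 2) + M * (k * P ^+ 2 + 1).
  by nra.
have Zp := lt_trans (mulr_gt0 kP m0) Z0.
rewrite subr_gt0 ltr_pdivrMr// expr2 -!mulrA ltr_pM2l//.
by move: Z0; rewrite -!mulrA.
Qed.

(** Every term of [rate_lower_bound] is compared with [B ^+ 2], B being the sum of the inverse
    square roots of the velocities, so that this factor can be cancelled at the end. *)
Lemma M0_le l c q : positive_solution k P v1 v2 v3 v4 l c q -> l <= 0 ->
  v2 <= v1 -> v2 <= v3 -> v4 <= v3 -> v4 <= v1 -> - M0 k P v1 v2 v3 v4 <= l.
Proof.
move=> pos l0 v21 v23 v43 v41.
pose a (x : R) := (Num.sqrt x)^-1.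
have a0 x : 0 < x -> 0 < a x by move=> x0; rewrite invr_gt0 sqrtr_gt0.
have aE x : 0 < x -> a x ^+ 2 * x = 1.
  by move=> x0; rewrite /a exprVn sqr_sqrtr ?(ltW x0)// mulVf// gt_eqF.
have h := rate_lower_bound pos l0 v41 v23 (a0 _ v1_gt0) (a0 _ v2_gt0) (a0 _ v3_gt0) (a0 _ v4_gt0)
  (aE _ v1_gt0) (aE _ v2_gt0) (aE _ v3_gt0) (aE _ v4_gt0).
have q14 := ln_sub_le (a0 _ v1_gt0) (a0 _ v4_gt0) (aE _ v1_gt0) (aE _ v4_gt0) v41.
have q12 := ln_sub_le (a0 _ v1_gt0) (a0 _ v2_gt0) (aE _ v1_gt0) (aE _ v2_gt0) v21.
have q32 := ln_sub_le (a0 _ v3_gt0) (a0 _ v2_gt0) (aE _ v3_gt0) (aE _ v2_gt0) v23.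
have q34 := ln_sub_le (a0 _ v3_gt0) (a0 _ v4_gt0) (aE _ v3_gt0) (aE _ v4_gt0) v43.
have m0 := vmin_gt0.
have /andP[m1 M1] := velocity_bounds (i := 1) isT; have /andP[m2 M2] := velocity_bounds (i := 2) isT.
have /andP[m3 M3] := velocity_bounds (i := 3) isT; have /andP[m4 M4] := velocity_bounds (i := 4) isT.
rewrite /M0; move: m0 m1 M1 m2 M2 m3 M3 m4 M4; rewrite /velocity /=.
move: (vmin _ _ _ _) (vmax _ _ _ _) => m M m0 m1 M1 m2 M2 m3 M3 m4 M4.
have mM := le_trans m1 M1; have M0' : 0 < M := lt_le_trans m0 mM.
have e1 := aE _ v1_gt0; have e2 := aE _ v2_gt0; have e3 := aE _ v3_gt0; have e4 := aE _ v4_gt0.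
have p1 := a0 _ v1_gt0; have p2 := a0 _ v2_gt0; have p3 := a0 _ v3_gt0; have p4 := a0 _ v4_gt0.
move: h q14 q12 q32 q34 e1 e2 e3 e4 p1 p2 p3 p4.
move: (a v1) (a v2) (a v3) (a v4) => a1 a2 a3 a4 h q14 q12 q32 q34 e1 e2 e3 e4 p1 p2 p3 p4.
set L := ln v1 - _ + _ - _ in h; set S := a1 ^+ 2 + _ + _ + _ in h.
set B := a1 + a2 + a3 + a4 in h.
have range y b : 0 < b -> b ^+ 2 * y = 1 -> m <= y -> y <= M -> a M <= b /\ b ^+ 2 * m <= 1.
  move=> b0 be my yM; have b2 : 0 < b ^+ 2 by rewrite exprn_gt0.
  split; first exact: inv_sqrt_le (a0 M M0') b0 (aE M M0') be yM.
  by rewrite -be ler_pM2l.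
have [r1 s1] := range _ _ p1 e1 m1 M1; have [r2 s2] := range _ _ p2 e2 m2 M2.
have [r3 s3] := range _ _ p3 e3 m3 M3; have [r4 s4] := range _ _ p4 e4 m4 M4.
have mS : m * S <= 4 by rewrite /S; lra.
have MB : 16 <= M * B ^+ 2.
  have Bge : 4 * a M <= B by rewrite /B; lra.
  have aM := aE M M0'; move: (a M) Bge (a0 M M0') aM => t Bt t0 tM.
  have h0 : 0 <= (B - 4 * t) * (B + 4 * t) * M.
    by rewrite mulr_ge0 ?(ltW M0')// mulr_ge0; lra.
  have h1 : (B - 4 * t) * (B + 4 * t) * M = M * B ^+ 2 - 16 * (t ^+ 2 * M) by ring.
  by rewrite tM in h1; lra.
(* Twice [L] is the sum of the four differences [ln v_i - ln v_j] with i = 1, 3 and j = 2, 4. By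
   [ln_sub_le] it is at most (M - m) (a1 + a3) (a2 + a4), and this product is at most B^2 / 4. *)
have LB : 8 * L <= (M - m) * B ^+ 2.
  have bd x y b d : 0 < b -> 0 < d -> x <= M -> m <= y -> (x - y) * (b * d) <= (M - m) * (b * d).
    by move=> b0 d0 xM my; rewrite ler_pM2r ?mulr_gt0//; lra.
  have := bd _ _ _ _ p1 p4 M1 m4; have := bd _ _ _ _ p1 p2 M1 m2.
  have := bd _ _ _ _ p3 p2 M3 m2; have := bd _ _ _ _ p3 p4 M3 m4.
  have : 0 <= (M - m) * (a1 + a3 - a2 - a4) ^+ 2 by rewrite mulr_ge0 ?sqr_ge0//; lra.
  by rewrite /L /B; lra.
have kP : 0 < k * P ^+ 2 by rewrite mulr_gt0// exprn_gt0.
set Z := m * _ + _.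
have Z0 : 0 < Z.
  rewrite /Z ltr_wpDl//; first by apply: mulr_ge0; [exact: ltW|apply: divr_ge0 => //; lra].
  by rewrite mulr_gt0//; lra.
rewrite opprB lerBlDr addrC ler_pdivrMr// -(ler_pM2r (ltr0Sn _ 3)).
have B2 : 0 < B ^+ 2 by rewrite exprn_gt0// /B !addr_gt0.
rewrite -(ler_pM2r B2).
have lk : 0 <= l + k.
  have D0 : 0 < L + k * P ^+ 2 * S.
    have S0 : 0 < S by rewrite /S !addr_gt0 ?exprn_gt0.
    rewrite ltr_wpDl ?mulr_gt0//.
    have h1 : ln v4 <= ln v1 by rewrite ler_ln ?posrE.
    have h2 : ln v2 <= ln v3 by rewrite ler_ln ?posrE.
    by rewrite /L; lra.
  have : 0 <= 4 * (l + k) * (L + k * P ^+ 2 * S).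
    apply: le_trans h; apply: mulr_ge0; last exact: sqr_ge0.
    by apply: mulr_ge0; exact: sqr_ge0.
  by rewrite pmulr_lge0//; lra.
have hm := ler_wpM2r (ltW m0) h.
(* The first term of [Z] comes from [LB], the second from [m * S <= 4] together with
   [16 <= M * B ^+ 2]. *)
have key : 4 * m * (L + k * P ^+ 2 * S) <= Z * B ^+ 2.
  have h1 := ler_wpM2l (ltW m0) LB.
  have h2 := ler_wpM2l (ltW kP) mS; have h3 := ler_wpM2l (ltW kP) MB.
  rewrite /Z; lra.
have := ler_wpM2l lk key.
move: hm; lra.
Qed.

End LowerBound.

(** * Envelopes and proof of the theorem *)

Section Envelope.
Context {R : realType}.
Local Notation mu := (@lebesgue_measure R).
Implicit Types (u e : state R) (p : R[i] -> R).

Lemma archimedean_le0 (c y : R) : 0 < c -> (forall n : nat, y <= c / n.+1%:R) -> y <= 0.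
Proof.
move=> c0 h; rewrite leNgt; apply/negP => y0.
have [N _ hN] : \forall n \near \oo, c / n.+1%:R < y := cvgr_lt 0 (cvg_shrinking c0) _ y0.
by have := hN N (leqnn N); rewrite ltNge h.
Qed.

Section Positive.
Variables (e : state R) (c0 q0 : R -> R) (d : R).
Hypothesis d_gt0 : 0 < d.
Hypothesis modulus_e : {ae mu, forall x, x \in `](-2)%R, 2%R[ ->
  [/\ modulus (e.1 x) = c0 x, modulus (e.2 x) = q0 x, d <= c0 x & d <= q0 x]}.

Lemma envelope_exists p u : is_part p -> boundedX u -> exists2 K, 0 <= K & enveloped p e K u.
Proof.
move=> hp [M uM]; pose K := Num.max M 0 / d.
have K0 : 0 <= K by rewrite divr_ge0 ?(ltW d_gt0)// le_max lexx orbT.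
exists K => //; apply: (ae_imply2 _ uM modulus_e) => x hx hx' xi.
have [m1 m2] := hx xi; have [-> -> d1 d2] := hx' xi.
have bound z w : modulus z <= M -> d <= w -> - (K * w) <= p z <= K * w.
  move=> zM dw; rewrite -ler_norml; apply: le_trans (part_le_modulus z hp) _.
  apply: (le_trans zM); apply: (@le_trans _ _ (K * d)); last exact: ler_wpM2l.
  by rewrite /K divfK ?gt_eqF// le_max lexx.
by split; apply: bound.
Qed.

Lemma envelope_ge0 p u K : enveloped p e K u -> 0 <= K.
Proof.
move=> h; have m22 : -2 < 2 :> R by lra.
have hh : {ae mu, forall x, x \in `](-2)%R, 2%R[ -> 0 <= K}.
  apply: (ae_imply2 _ h modulus_e) => x hx hx' xi.
  have [/andP[h1 h2] _] := hx xi; have [e1 _ d1 _] := hx' xi; rewrite e1 in h1 h2.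
  have c0x := lt_le_trans d_gt0 d1.
  by rewrite -(pmulr_lge0 _ c0x); lra.
by have [] := ae_itv_witness m22 hh.
Qed.

Lemma envelope_le p u K K' : K <= K' -> enveloped p e K u -> enveloped p e K' u.
Proof.
move=> KK h; apply: (ae_imply _ h) => x hx xi.
have [/andP[h1 h2] /andP[h3 h4]] := hx xi.
have m1 := ler_wpM2r (sqrtr_ge0 (sqr_modulus (e.1 x))) KK.
have m2 := ler_wpM2r (sqrtr_ge0 (sqr_modulus (e.2 x))) KK.
rewrite /modulus in h1 h2 h3 h4 *.
by split; apply/andP; split; lra.
Qed.

(** The infimum of the admissible constants is attained: the bounds for inf + 1 / (n + 1) hold
    outside a common null set, as n is countable. *)
Lemma smallest_envelope_exists p u : is_part p -> boundedX u ->
  exists K, smallest_envelope p e u K.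
Proof.
move=> hp bu; have [K0 _ hK0] := envelope_exists hp bu.
pose S := [set K | enveloped p e K u].
have Slb : has_lbound S by exists 0 => K; exact: envelope_ge0.
have Sinf : has_inf S by split => //; exists K0.
exists (inf S); split; last by move=> K hK; exact: ge_inf.
have near_inf (n : nat) : enveloped p e (inf S + n.+1%:R^-1) u.
  have n0 : 0 < n.+1%:R^-1 :> R by rewrite invr_gt0.
  by have [K hK KS] := inf_adherent n0 Sinf; exact: envelope_le (ltW KS) hK.
have all_n := ae_foralln near_inf.
apply: (ae_imply2 _ all_n modulus_e) => x hx hx' xi.
have [-> -> d1 d2] := hx' xi.
have c0x := lt_le_trans d_gt0 d1; have q0x := lt_le_trans d_gt0 d2.
have hn n := hx n xi; have [m1 m2 _ _] := hx' xi; rewrite m1 m2 in hn.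
split; rewrite -[_ && _]andbT -andbA andbT; apply/andP; split.
- rewrite lerNl -subr_le0; apply: (archimedean_le0 c0x) => n.
  by have [/andP[h _] _] := hn n; move: (n.+1%:R^-1) h => r; lra.
- rewrite -subr_le0; apply: (archimedean_le0 c0x) => n.
  by have [/andP[_ h] _] := hn n; move: (n.+1%:R^-1) h => r; lra.
- rewrite lerNl -subr_le0; apply: (archimedean_le0 q0x) => n.
  by have [_ /andP[h _]] := hn n; move: (n.+1%:R^-1) h => r; lra.
- rewrite -subr_le0; apply: (archimedean_le0 q0x) => n.
  by have [_ /andP[_ h]] := hn n; move: (n.+1%:R^-1) h => r; lra.
Qed.

Variables (k P v1 v2 v3 v4 : R).
Hypotheses (k_gt0 : 0 < k) (P_gt0 : 0 < P).
Hypotheses (v1_gt0 : 0 < v1) (v2_gt0 : 0 < v2) (v3_gt0 : 0 < v3) (v4_gt0 : 0 < v4).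
Hypotheses (v21 : v2 <= v1) (v23 : v2 <= v3) (v43 : v4 <= v3) (v41 : v4 <= v1).
Variable T : R -> state R -> state R.
Hypothesis TA : is_semigroup_of (opA k P v1 v2 v3 v4) T.
Variable l : R.
Hypothesis l_le0 : l <= 0.
Hypothesis graph_e : real_graph k P v1 v2 v3 v4 c0 q0 (fun x => l * c0 x) (fun x => l * q0 x).

(** The two bounds are [comparison] with s = 1 and s = - 1. *)
Lemma envelope_propagates p u K : is_part p -> inX u -> boundedX u -> enveloped p e K u ->
  exp_enveloped T l e u p K.
Proof.
move=> hp uX bu hK t t0.
have dense r (r0 : 0 < r) := dense_domain k P v1 v2 v3 v4 uX bu r0.
have comp s := comparison k_gt0 P_gt0 v1_gt0 v2_gt0 v3_gt0 v4_gt0 v21 v23 v43 v41 TA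
  (a := K) (s := s) hp l_le0 graph_e uX dense.
have i1 : {ae mu, forall x, x \in `](-2)%R, 2%R[ ->
    0 <= K * c0 x + 1 * p (u.1 x) /\ 0 <= K * q0 x + 1 * p (u.2 x)}.
  apply: (ae_imply2 _ hK modulus_e) => x hx hx' xi; have [m1 m2 _ _] := hx' xi.
  by have [/andP[h1 h2] /andP[h3 h4]] := hx xi; rewrite -m1 -m2; split; lra.
have i2 : {ae mu, forall x, x \in `](-2)%R, 2%R[ ->
    0 <= K * c0 x + -1 * p (u.1 x) /\ 0 <= K * q0 x + -1 * p (u.2 x)}.
  apply: (ae_imply2 _ hK modulus_e) => x hx hx' xi; have [m1 m2 _ _] := hx' xi.
  by have [/andP[h1 h2] /andP[h3 h4]] := hx xi; rewrite -m1 -m2; split; lra.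
have h1 := comp _ i1 t t0; have h2 := comp _ i2 t t0.
have h3 : {ae mu, forall x, x \in `](-2)%R, 2%R[ ->
    (- (K * expR (t * l) * c0 x) <= p ((T t u).1 x) <= K * expR (t * l) * c0 x) /\
    (- (K * expR (t * l) * q0 x) <= p ((T t u).2 x) <= K * expR (t * l) * q0 x)}.
  apply: (ae_imply2 _ h1 h2) => x hx hx' xi; have [a1 a2] := hx xi; have [b1 b2] := hx' xi.
  by split; apply/andP; split; lra.
apply: (ae_imply2 _ h3 modulus_e) => x hx hx' xi.
by have [-> -> _ _] := hx' xi; exact: hx.
Qed.

Lemma exp_estimate_positive u : inX u -> boundedX u -> exp_estimate T l e u.
Proof.
move=> uX bu p hp; split.
  have [K K0 hK] := envelope_exists hp bu; exists (K + 1); split; first by lra.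
  by apply: envelope_propagates => //; apply: envelope_le hK; lra.
have [K [hK mK]] := smallest_envelope_exists hp bu.
by exists K; split; [split|exact: envelope_propagates].
Qed.

End Positive.

Lemma modulus_real (x : R) : 0 <= x -> modulus x%:C = x.
Proof. by move=> x0; rewrite /modulus /sqr_modulus /= expr0n addr0 sqrtr_sqr ger0_norm. Qed.

(** The lower bound d is the smallest of the minima on the four closed intervals, one-sided limits
    included. *)
Lemma strictly_positive_modulus e : strictly_positive e -> exists2 d, 0 < d &
  {ae mu, forall x, x \in `](-2)%R, 2%R[ ->
    [/\ modulus (e.1 x) = complex.Re (e.1 x), modulus (e.2 x) = complex.Re (e.2 x),
        d <= complex.Re (e.1 x) & d <= complex.Re (e.2 x)]}.
Proof.
move=> pe.
have piece i : (1 <= i <= 4)%N -> exists2 d, 0 < d &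
    {ae mu, forall x, x \in `]node i, node i.+1[ ->
    [/\ modulus (e.1 x) = complex.Re (e.1 x), modulus (e.2 x) = complex.Re (e.2 x),
        d <= complex.Re (e.1 x) & d <= complex.Re (e.2 x)]}.
  move=> i14; have [c [q [[cc _ ce] [cq _ qe] pos]]] := pe i i14.
  have [x xi hx] := EVT_min (ltW (node_lt i)) cc.
  have [y yi hy] := EVT_min (ltW (node_lt i)) cq.
  have [cx _] := pos x xi; have [_ qy] := pos y yi.
  exists (Num.min (c x) (q y)); first by rewrite lt_min cx.
  apply: (ae_imply2 _ ce qe) => z hz hz' zi; rewrite (hz zi) (hz' zi).
  have zi' : z \in `[node i, node i.+1] by exact: subset_itv_oo_cc.
  have [cz qz] := pos z zi'; rewrite !modulus_real ?(ltW cz) ?(ltW qz)//=.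
  by split => //; rewrite ge_min; [rewrite (hx z zi')|rewrite (hy z zi') orbT].
have [d1 d10 h1] := piece 1%N isT; have [d2 d20 h2] := piece 2%N isT.
have [d3 d30 h3] := piece 3%N isT; have [d4 d40 h4] := piece 4%N isT.
pose d := Num.min (Num.min d1 d2) (Num.min d3 d4).
have d0 : 0 < d by rewrite !lt_min d10 d20 d30.
exists d => //; apply: ae_nodes => i i14.
have weaken d' : d <= d' -> {ae mu, forall x, x \in `]node i, node i.+1[ ->
    [/\ modulus (e.1 x) = complex.Re (e.1 x), modulus (e.2 x) = complex.Re (e.2 x),
        d' <= complex.Re (e.1 x) & d' <= complex.Re (e.2 x)]} ->
    {ae mu, forall x, x \in `]node i, node i.+1[ ->
    [/\ modulus (e.1 x) = complex.Re (e.1 x), modulus (e.2 x) = complex.Re (e.2 x),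
        d <= complex.Re (e.1 x) & d <= complex.Re (e.2 x)]}.
  move=> dd h; apply: (ae_imply _ h) => x hx xi; have [m1 m2 a1 a2] := hx xi.
  by split => //; exact: le_trans dd _.
case: i i14 weaken => [|[|[|[|[|i]]]]] // _ weaken.
- by apply: weaken h1; rewrite !ge_min lexx.
- by apply: weaken h2; rewrite !ge_min lexx !orbT.
- by apply: weaken h3; rewrite !ge_min lexx !orbT.
- by apply: weaken h4; rewrite !ge_min lexx !orbT.
Qed.

Lemma eigenfunction_real_graph (k P v1 v2 v3 v4 l : R) e :
  is_eigenfunction (opA k P v1 v2 v3 v4) l%:C e ->
  real_graph k P v1 v2 v3 v4 (fun x => complex.Re (e.1 x)) (fun x => complex.Re (e.2 x))
    (fun x => l * complex.Re (e.1 x)) (fun x => l * complex.Re (e.2 x)).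
Proof.
move=> [eX _ Ae]; have := opA_real_graph (or_introl erefl) eX Ae.
rewrite (_ : _ \o (scaleX _ _).1 = fun x => l * complex.Re (e.1 x)); last first.
  by apply/funext => x; rewrite /= ReM_real.
rewrite (_ : _ \o (scaleX _ _).2 = fun x => l * complex.Re (e.2 x))//.
by apply/funext => x; rewrite /= ReM_real.
Qed.

Lemma constant_real_graph (k P v m : R) : 0 < v ->
  real_graph k P v v v v (fun=> m) (fun=> P * m) (fun=> 0 * m) (fun=> 0 * (P * m)).
Proof.
move=> v0.
have vE i : (1 <= i <= 4)%N -> velocity v v v v i = v by case: i => [|[|[|[|[|i]]]]].
have od i : (1 <= i <= 4)%N -> ode k P (velocity v v v v i) 0 (fun=> m) (fun=> P * m).
  by move=> i14; rewrite vE//; exact: constant_ode.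
have [uX Au] := real_state_opA v0 v0 v0 v0 od (constant_boundary_data P v m).
have := opA_real_graph (or_introl erefl) uX Au.
have gE (y : R) : (fun x => complex.Re (glueC (fun=> fun=> y) (fun=> fun=> 0) x)) = (fun=> y).
  by apply/funext => x; rewrite /= glue_cst.
rewrite (_ : _ \o (scaleX _ _).1 = fun x => 0 * m); last first.
  apply/funext => x.
  by rewrite -[LHS]/(complex.Re (0%:C * glueC (fun=> fun=> m) (fun=> fun=> 0) x)) ReM_real /= glue_cst.
rewrite (_ : _ \o (scaleX _ _).2 = fun x => 0 * (P * m)); last first.
  apply/funext => x.
  by rewrite -[LHS]/(complex.Re (0%:C * glueC (fun=> fun=> P * m) (fun=> fun=> 0) x)) ReM_real /= glue_cst.
by rewrite /real_state /comp /= !gE.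
Qed.

End Envelope.

Theorem theorem1p2 (R : realType) (k P v1 v2 v3 v4 : R)
    (k_gt0 : 0 < k) (P_gt0 : 0 < P)
    (v1_gt0 : 0 < v1) (v2_gt0 : 0 < v2) (v3_gt0 : 0 < v3) (v4_gt0 : 0 < v4) :
  let A := opA k P v1 v2 v3 v4 in
  [/\ (* (i) *)
      v2 < v1 -> v2 < v3 -> v4 < v3 -> v4 < v1 ->
      exists l0 : R,
        [/\ unique (largest_real_eigenvalue A) l0,
            forall z : R[i], is_eigenvalue A z -> re z <= l0,
            exists e : state R,
              is_eigenfunction A l0%:C e /\ strictly_positive e,
            0 < M0 k P v1 v2 v3 v4 &
            - M0 k P v1 v2 v3 v4 <= l0 < 0],
      (* (ii) *)
      v2 < v1 -> v2 < v3 -> v4 < v3 -> v4 < v1 ->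
      forall (l0 : R) (e : state R),
        largest_real_eigenvalue A l0 ->
        is_eigenfunction A l0%:C e -> strictly_positive e ->
      forall T : R -> state R -> state R, is_semigroup_of A T ->
      forall u : state R, inX u -> boundedX u ->
        exp_estimate T l0 e u
    & (* (iii) *)
      v2 <= v1 -> v2 <= v3 -> v4 <= v3 -> v4 <= v1 -> v1 = v2 -> v3 = v4 ->
      largest_real_eigenvalue A 0 /\
      forall e : state R, is_eigenfunction A 0 e ->
      forall T : R -> state R -> state R, is_semigroup_of A T ->
      forall u : state R, inX u -> boundedX u ->
        exp_estimate T 0 e u].
Proof.
have exists_positive : v2 < v1 -> v2 < v3 -> v4 < v3 -> v4 < v1 ->
    exists l c q, l < 0 /\ positive_solution k P v1 v2 v3 v4 l c q.
  move=> v21 v23 v43 v41.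
  have [l [r [/andP[_ l0] _ qp e4]]] := principal_solution k_gt0 P_gt0 v1_gt0 v2_gt0 v3_gt0 v4_gt0
    v21 (ltW v23) (ltW v43) (ltW v41).
  exists l; eexists; eexists; split => //.
  exact: (stage_positive_solution v1_gt0 v2_gt0 v3_gt0 v4_gt0 k_gt0 P_gt0 qp e4).
have largest l c q := @positive_solution_largest R k P v1 v2 v3 v4 v1_gt0 v2_gt0 v3_gt0 v4_gt0
  k_gt0 P_gt0 l c q.
have largest_unique (A : operatorX R) l l' : largest_real_eigenvalue A l ->
    largest_real_eigenvalue A l' -> l = l'.
  by move=> [h1 m1] [h2 m2]; apply/eqP; rewrite eq_le m1// m2.
move=> A; split.
- move=> v21 v23 v43 v41; have [l [c [q [l0 pos]]]] := exists_positive v21 v23 v43 v41.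
  have L := largest _ _ _ pos; exists l; split.
  + by split => // l'; exact: largest_unique.
  + move=> z; exact: (eigenvalue_le v1_gt0 v2_gt0 v3_gt0 v4_gt0 k_gt0 P_gt0 pos).
  + exists (real_state c q).
    exact: (positive_solution_eigenfunction v1_gt0 v2_gt0 v3_gt0 v4_gt0 pos).
  + exact: M0_gt0.
  + rewrite l0 andbT.
    exact: (M0_le k_gt0 P_gt0 v1_gt0 v2_gt0 v3_gt0 v4_gt0 pos (ltW l0) (ltW v21) (ltW v23) (ltW v43) (ltW v41)).
- move=> v21 v23 v43 v41 l e L ee pe T TA u uX bu.
  (* The given largest eigenvalue is identified with the constructed one, which shows that it is not
     positive. *)
  have [l' [c [q [l'0 pos]]]] := exists_positive v21 v23 v43 v41.
  have l0 : l <= 0 by rewrite (largest_unique _ _ _ L (largest _ _ _ pos)) ltW.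
  have [d d0 me] := strictly_positive_modulus pe.
  exact: (exp_estimate_positive d0 me k_gt0 P_gt0 v1_gt0 v2_gt0 v3_gt0 v4_gt0 (ltW v21) (ltW v23)
    (ltW v43) (ltW v41) TA l0 (eigenfunction_real_graph ee)).
- move=> v21 v23 v43 v41 v12 v34.
  (* The weak inequalities between neighbours force the two pairs to agree. *)
  have v13 : v1 = v3 by apply/eqP; rewrite eq_le; apply/andP; split; lra.
  move: largest @A; rewrite -v12 -v34 -v13 => largest A.
  split; first exact: largest (constant_positive_solution k P_gt0 v1_gt0).
  move=> e [eX nz Ae] T TA u uX bu.
  have [y [y' ey]] := zero_eigenfunction k_gt0 P_gt0 v1_gt0 eX Ae.
  (* The estimate only sees moduli, so the complex constant eigenfunction is replaced by the real
     one with constants m and P m. *)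
  pose m := Num.sqrt (y ^+ 2 + y' ^+ 2).
  have m0 : 0 < m.
    rewrite sqrtr_gt0 lt_neqAle eq_sym paddr_eq0 ?sqr_ge0// addr_ge0 ?sqr_ge0// andbT.
    apply/negP; rewrite !sqrf_eq0 => /andP[/eqP y0 /eqP y'0]; apply: nz.
    apply: (ae_imply _ ey) => x hx xi; have [-> ->] := hx xi.
    by rewrite y0 y'0 !mulr0.
  have Pm0 : 0 < P * m by rewrite mulr_gt0.
  have me : {ae @lebesgue_measure R, forall x, x \in `](-2)%R, 2%R[ ->
      [/\ modulus (e.1 x) = m, modulus (e.2 x) = P * m, Num.min m (P * m) <= m &
        Num.min m (P * m) <= P * m]}.
    apply: (ae_imply _ ey) => x hx xi; have [-> ->] := hx xi.
    rewrite !ge_min !lexx orbT; split => //.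
    rewrite /modulus /sqr_modulus /= (_ : _ + _ = P ^+ 2 * (y ^+ 2 + y' ^+ 2)); last by ring.
    by rewrite sqrtrM ?sqr_ge0// sqrtr_sqr gtr0_norm.
  have d0 : 0 < Num.min m (P * m) by rewrite lt_min m0.
  exact: (exp_estimate_positive d0 me k_gt0 P_gt0 v1_gt0 v1_gt0 v1_gt0 v1_gt0 (lexx _) (lexx _)
    (lexx _) (lexx _) TA (lexx 0) (constant_real_graph k P m v1_gt0)).
Qed.
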